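(* Let $(M,\omega)$ be a smooth symplectic manifold of dimension $2n$ ($n\ge2$), let $\nabla$ be a smooth symplectic connection of Ricci-type on $M$, let $(N,\alpha)$ be a smooth $(2n+1)$-dimensional contact manifold and let $\pi:N\to M$ be a smooth submersion with $d\alpha=2\pi^*\omega$. Let $(P,\mu)$ be the symplectic manifold $P=N\times\mathbb{R}$, $\mu=d(e^{2s}p_1^*\alpha)$, where $s$ is the coordinate on $\mathbb{R}$ and $p_1:P\to N$ the projection, and let $\nabla^1$ be the linear connection on $P$ defined in the context. Then the connection $\nabla^1$ on $(P,\mu)$ is symplectic and has zero curvature.
   Context: A symplectic connection on a symplectic manifold is a torsion-free linear connection for which the symplectic form is parallel. Let $R$ be the curvature of $\nabla$, $r(X,Y)=\operatorname{tr}[Z\mapsto R(X,Z)Y]$ its Ricci tensor and $\rho$ the endomorphism with $\omega(X,\rho Y)=r(X,Y)$. For $\dim M=2n\ge4$, $\nabla$ is of Ricci-type if $$\omega(R(X,Y)Z,T)=-\tfrac{1}{2(n+1)}\big[2\omega(X,Y)r(Z,T)+\omega(X,Z)r(Y,T)+\omega(X,T)r(Y,Z)-\omega(Y,Z)r(X,T)-\omega(Y,T)r(X,Z)\big].$$ In that case there are (known fact) a unique vector field $u$ and a unique function $f$ on $M$ with $\nabla_X\rho=-\frac{1}{2n+1}[X\otimes\underline u+u\otimes\underline X]$ and $\nabla_Xu=-\frac{2n+1}{2(n+1)}\rho^2X+fX$, where $\underline X=i(X)\omega$. Contact manifold $(N,\alpha)$: $\alpha$ is a smooth $1$-form with $\alpha\wedge(d\alpha)^n\ne0$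 everywhere. $X$ denotes its Reeb vector field ($i(X)d\alpha=0$, $\alpha(X)=1$), which spans $\operatorname{Ker}\pi_*$ at each point. The exterior derivative convention is $d\alpha(U,V)=U\alpha(V)-V\alpha(U)-\alpha([U,V])$. For a vector field $U$ on $M$, its horizontal lift $\overline U$ is the vector field on $N$ with $\pi_*\overline U=U$ and $\alpha(\overline U)=0$. Put $\nu=\pi^*\omega$. Define the connection $\nabla^N$ on $N$ by $$\nabla^N_{\overline U}\overline V=\overline{\nabla_UV}-\nu(\overline U,\overline V)X,\qquad \nabla^N_X\overline U=\nabla^N_{\overline U}X=-\tfrac{1}{2(n+1)}\overline{\rho U},\qquad \nabla^N_XX=-\tfrac{1}{2(n+1)(2n+1)}\overline u .$$ Let $\gamma$ be the symmetric bilinear form on $TN$ with $$\gamma(X,X)=\tfrac{1}{2(n+1)(2n+1)}\pi^*f,\quad \gamma(X,\overline U)=-\tfrac{1}{2(n+1)(2n+1)}\nu(\overline u,\overline U),\quad \gamma(\overline U,\overline V)=\tfrac{1}{2(n+1)}\nu(\overline U,\overline{\rho V}).$$ A vector field $Z$ on $N$ is extended to $P=N\times\mathbb{R}$ (same letter) so as to coincide with $Z$ along $N\times\{0\}$ and satisfy $[Z,\partial_s]=0$ (i.e. $Z$ is tangent to the slices and independent of $s$). The connection $\nabla^1$ on $P$ is defined by $$\nabla^1_ZZ'=\nabla^N_ZZ'+\gamma(Z,Z')\partial_s,\qquad \nabla^1_Z\partial_s=\nabla^1_{\partial_s}Z=Z,\qquad \nabla^1_{\partial_s}\partial_s=\partial_s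 .$$ *)

(* Defs.v *)
From HB Require Import structures.
From mathcomp Require Import all_boot all_order all_algebra all_fingroup.
From mathcomp Require Import all_classical all_reals all_analysis.

Set Implicit Arguments.
Unset Strict Implicit.
Unset Printing Implicit Defensive.

Import Order.TTheory GRing.Theory Num.Theory numFieldNormedType.Exports.
Local Open Scope classical_set_scope.
Local Open Scope ring_scope.

(* [Ck k A f] is meant for open A; f is C^(k+1) when it is differentiable and
   all its directional derivatives are C^k. *)
Fixpoint Ck (R : realType) (m k : nat) (A : set 'rV[R]_m) (f : 'rV[R]_m -> R)
    : Prop :=
  match k with
  | 0 => forall x, A x -> {for x, continuous f}
  | k'.+1 => (forall x, A x -> differentiable f x) /\
             (forall v, Ck k' A (fun x => 'D_v f x))
  end.

Record chart (R : realType) (m : nat) (T : Type) := Chart {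
  cdom : set T;
  ccoord : T -> 'rV[R]_m;
  cparam : 'rV[R]_m -> T  (* inverse of ccoord on its image *)
}.

(* A topological space with an atlas indexed by its own points: [chart_at p] is
   a chart around p (see [smooth_manifold]).  The tangent space at p is
   'rV[R]_m, a tangent vector being given by its components in [chart_at p]. *)
Record charted_space (R : realType) (m : nat) := ChartedSpace {
  carrier :> topologicalType;
  chart_at : carrier -> chart R m carrier
}.

Section Manifold.
Variables (R : realType) (m : nat) (M : charted_space R m).
Implicit Types (p c : M) (A : set M) (f g : M -> R).

Definition xcoord c (i : 'I_m) : M -> R :=
  fun q => ccoord (chart_at c) q ord0 i.

Definition smooth_on A f : Prop := forall c k,
  Ck k [set x | (ccoord (chart_at c) @` cdom (chart_at c)) x /\
                A (cparam (chart_at c) x)]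
       (f \o cparam (chart_at c)).

Definition smooth_fun f : Prop := smooth_on setT f.

Definition is_chart (a : chart R m M) : Prop :=
  [/\ open (cdom a), open (ccoord a @` cdom a),
      forall q, cdom a q -> cparam a (ccoord a q) = q,
      forall q, cdom a q -> {for q, continuous (ccoord a)} &
      forall x, (ccoord a @` cdom a) x -> {for x, continuous (cparam a)}].

(* The last clause says that the transition maps are smooth. *)
Definition smooth_manifold : Prop :=
  [/\ hausdorff_space M, @second_countable M,
      forall c, is_chart (chart_at c),
      forall c, cdom (chart_at c) c &
      forall c i, smooth_on (cdom (chart_at c)) (xcoord c i)].

Definition tangent_act p (v : 'rV[R]_m) f : R :=
  'D_v (f \o cparam (chart_at p)) (ccoord (chart_at p) p).

Definition vfield : Type := M -> 'rV[R]_m.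
Implicit Types (U V W : vfield).

Definition act U f : M -> R := fun p => tangent_act p (U p) f.

Definition smooth_vfield U : Prop :=
  forall c i, smooth_on (cdom (chart_at c)) (act U (xcoord c i)).

(* [U, V]^i = U(V^i) - V(U^i) in the chart at p *)
Definition bracket U V : vfield := fun p =>
  \row_i (act U (act V (xcoord p i)) p - act V (act U (xcoord p i)) p).

Definition smooth_1form (a : forall p, 'rV[R]_m -> R) : Prop :=
  (forall p, scalar (a p)) /\
  (forall U, smooth_vfield U -> smooth_fun (fun p => a p (U p))).

Definition smooth_bilinear (w : forall p, 'rV[R]_m -> 'rV[R]_m -> R) : Prop :=
  [/\ forall p x, scalar (w p x),
      forall p y, scalar (w p ^~ y) &
      forall U V, smooth_vfield U -> smooth_vfield V ->
        smooth_fun (fun p => w p (U p) (V p))].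

Definition smooth_endo (h : forall p, 'rV[R]_m -> 'rV[R]_m) : Prop :=
  (forall p, linear (h p)) /\
  (forall U, smooth_vfield U -> smooth_vfield (fun p => h p (U p))).

Definition on_fields (w : forall p, 'rV[R]_m -> 'rV[R]_m -> R)
  : vfield -> vfield -> M -> R := fun U V p => w p (U p) (V p).

Definition d1 (a : forall p, 'rV[R]_m -> R) : vfield -> vfield -> M -> R :=
  fun U V p => act U (fun q => a q (V q)) p - act V (fun q => a q (U q)) p
               - a p (bracket U V p).

Definition d2 (w : vfield -> vfield -> M -> R) (U V W : vfield) : M -> R :=
  fun p => act U (w V W) p - act V (w U W) p + act W (w U V) p
           - w (bracket U V) W p + w (bracket U W) V p - w (bracket V W) U p.

(* k-forms as alternating functions of k vector fields; only the values on
   smooth vector fields matter. *)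
Definition kform (k : nat) : Type := ('I_k -> vfield) -> M -> R.

Definition wedge (k l : nat) (a : kform k) (b : kform l) : kform (k + l) :=
  fun Z p => (k`! * l`!)%:R^-1 *
    \sum_(s : 'S_(k + l)) (-1) ^+ s *
      (a (fun i => Z (s (lshift l i))) p * b (fun j => Z (s (rshift k j))) p).

Fixpoint wedge_pow (k : nat) (b : kform k) (n : nat) : kform (n * k) :=
  match n with
  | 0 => fun _ _ => 1
  | n'.+1 => wedge b (@wedge_pow k b n')
  end.

Definition kform1 (a : forall p, 'rV[R]_m -> R) : kform 1 :=
  fun Z p => a p (Z ord0 p).

Definition kform2 (w : vfield -> vfield -> M -> R) : kform 2 :=
  fun Z => w (Z ord0) (Z ord_max).

Definition nowhere_zero (k : nat) (a : kform k) : Prop := forall p,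
  exists Z : 'I_k -> vfield, (forall i, smooth_vfield (Z i)) /\ a Z p <> 0.

Definition symplectic_form (w : forall p, 'rV[R]_m -> 'rV[R]_m -> R) : Prop :=
  [/\ smooth_bilinear w,
      forall p x y, w p x y = - w p y x,
      forall U V W, smooth_vfield U -> smooth_vfield V -> smooth_vfield W ->
        forall p, d2 (on_fields w) U V W p = 0 &
      forall p x, (forall y, w p x y = 0) -> x = 0].

(* Vector fields are total functions M -> 'rV[R]_m, so nab is only constrained on
   the smooth ones. *)
Definition connection (nab : vfield -> vfield -> vfield) : Prop :=
  [/\ forall U V, smooth_vfield U -> smooth_vfield V -> smooth_vfield (nab U V),
      forall f U U' V, smooth_fun f ->
        smooth_vfield U -> smooth_vfield U' -> smooth_vfield V ->
        nab (fun p => f p *: U p + U' p) V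
        = (fun p => f p *: nab U V p + nab U' V p),
      forall U V V', smooth_vfield U -> smooth_vfield V -> smooth_vfield V' ->
        nab U (fun p => V p + V' p) = (fun p => nab U V p + nab U V' p) &
      forall f U V, smooth_fun f -> smooth_vfield U -> smooth_vfield V ->
        nab U (fun p => f p *: V p)
        = (fun p => act U f p *: V p + f p *: nab U V p)].

Definition torsion_free (nab : vfield -> vfield -> vfield) : Prop :=
  forall U V, smooth_vfield U -> smooth_vfield V ->
    forall p, nab U V p - nab V U p = bracket U V p.

Definition parallel_2form (w : vfield -> vfield -> M -> R)
    (nab : vfield -> vfield -> vfield) : Prop :=
  forall U V W, smooth_vfield U -> smooth_vfield V -> smooth_vfield W ->
    forall p, act U (w V W) p = w (nab U V) W p + w V (nab U W) p.

Definition symplectic_connection (w : vfield -> vfield -> M -> R)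
    (nab : vfield -> vfield -> vfield) : Prop :=
  torsion_free nab /\ parallel_2form w nab.

Definition curvature (nab : vfield -> vfield -> vfield) (U V W : vfield)
  : vfield := fun p =>
  nab U (nab V W) p - nab V (nab U W) p - nab (bracket U V) W p.

Definition zero_curvature (nab : vfield -> vfield -> vfield) : Prop :=
  forall U V W, smooth_vfield U -> smooth_vfield V -> smooth_vfield W ->
    forall p, curvature nab U V W p = 0.

(* This determines Rm: every tangent vector extends to a smooth vector field. *)
Definition curvature_tensor (nab : vfield -> vfield -> vfield)
    (Rm : forall p, 'rV[R]_m -> 'rV[R]_m -> 'rV[R]_m -> 'rV[R]_m) : Prop :=
  forall U V W, smooth_vfield U -> smooth_vfield V -> smooth_vfield W ->
    forall p, Rm p (U p) (V p) (W p) = curvature nab U V W p.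

Definition ricci
    (Rm : forall p, 'rV[R]_m -> 'rV[R]_m -> 'rV[R]_m -> 'rV[R]_m)
    (p : M) (x y : 'rV[R]_m) : R :=
  \tr (lin1_mx (fun z => Rm p x z y)).

End Manifold.
Arguments wedge_pow {R m M k} b n.

(* dim M = 2n *)
Definition ricci_type (R : realType) (n : nat) (M : charted_space R (2 * n))
    (w : forall p : M, 'rV[R]_(2 * n) -> 'rV[R]_(2 * n) -> R)
    (Rm : forall p : M, 'rV[R]_(2 * n) -> 'rV[R]_(2 * n) -> 'rV[R]_(2 * n) ->
          'rV[R]_(2 * n)) : Prop :=
  let r := ricci Rm in
  forall p x y z t, w p (Rm p x y z) t =
    - (2 * n.+1%:R)^-1 *
      (2 * w p x y * r p z t + w p x z * r p y t + w p x t * r p y z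
       - w p y z * r p x t - w p y t * r p x z).

(* dim N = 2n + 1 *)
Definition contact_form (R : realType) (n : nat)
    (N : charted_space R (2 * n).+1)
    (a : forall p : N, 'rV[R]_(2 * n).+1 -> R) : Prop :=
  smooth_1form a /\
  nowhere_zero (wedge (kform1 a) (wedge_pow (kform2 (d1 a)) n)).

Definition reeb_field (R : realType) (m : nat) (N : charted_space R m)
    (a : forall p : N, 'rV[R]_m -> R) (X : vfield N) : Prop :=
  [/\ smooth_vfield X,
      forall V, smooth_vfield V -> forall p, d1 a X V p = 0 &
      forall p, a p (X p) = 1].

Section Maps.
Variables (R : realType) (m k : nat).
Variables (N : charted_space R m) (M : charted_space R k).

Definition smooth_map (h : N -> M) : Prop :=
  continuous h /\
  forall (c : M) i, smooth_on (h @^-1` cdom (chart_at c)) (xcoord c i \o h).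

Definition tangent_map (h : N -> M) (q : N) (v : 'rV[R]_m) : 'rV[R]_k :=
  \row_i tangent_act q v (xcoord (h q) i \o h).

Definition submersion (h : N -> M) : Prop :=
  smooth_map h /\ forall q x, exists v, tangent_map h q v = x.

Definition pullback2 (h : N -> M) (w : forall p : M, 'rV[R]_k -> 'rV[R]_k -> R)
    (q : N) (x y : 'rV[R]_m) : R :=
  w (h q) (tangent_map h q x) (tangent_map h q y).

Definition horizontal_lift (h : N -> M) (a : forall q : N, 'rV[R]_m -> R)
    (U : vfield M) (Ubar : vfield N) : Prop :=
  [/\ smooth_vfield Ubar,
      forall q, tangent_map h q (Ubar q) = U (h q) &
      forall q, a q (Ubar q) = 0].

End Maps.

Section Cylinder.
Variables (R : realType) (m : nat) (N : charted_space R m).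

Definition cylinder_chart (q : N * R) : chart R (m + 1) (N * R)%type := {|
  cdom := cdom (chart_at q.1) `*` setT;
  ccoord := fun y => row_mx (ccoord (chart_at q.1) y.1) (const_mx y.2);
  cparam := fun x => (cparam (chart_at q.1) (lsubmx x), rsubmx x ord0 ord0)
|}.

Definition cylinder : charted_space R (m + 1) :=
  @ChartedSpace R (m + 1) (N * R)%type cylinder_chart.

Definition p1 : cylinder -> N := fst.
Definition scoord : cylinder -> R := snd.

(* By the choice of [cylinder_chart], the tangent space at (x, s) is the direct
   sum of the tangent space at x and of that of R: [slice_ext Z] is tangent to
   the slices and independent of s. *)
Definition slice_ext (Z : vfield N) : vfield cylinder :=
  fun q => row_mx (Z (p1 q)) 0.

Definition dds : vfield cylinder := fun _ => row_mx 0 (const_mx 1).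

(* e^(2s) p_1^* a *)
Definition exp_form (a : forall x : N, 'rV[R]_m -> R) (q : cylinder)
    (v : 'rV[R]_(m + 1)) : R :=
  expR (2 * scoord q) * a (p1 q) (tangent_map p1 q v).

End Cylinder.

Arguments dds {R m} N q.

(* Main.v *)
Require Import Defs.
From HB Require Import structures.
From mathcomp Require Import all_boot all_order all_algebra all_fingroup.
From mathcomp Require Import all_classical all_reals all_analysis.
From mathcomp Require Import ring lra.
(* Repeated so that [act] is the derivative along a vector field and not the
   action of a group. *)
Require Import Defs.

(** Torsion, the covariant derivative of mu and curvature are linear over
    functions in each argument.  Since every tangent vector of P extends to a
    vector field (bump functions exist on a Hausdorff manifold), it is enough
    to evaluate them on a family of fields spanning each tangent space.

    At each point of P a tangent vector is determined by its image in M under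
    pi, its value under alpha and its s-component: the fibres of pi are spanned
    by the Reeb field X, because i(X) d(alpha) = 0, d(alpha) = 2 pi^* omega and
    omega is nondegenerate.  The test fields are the
    (A, phi, sigma) = Abar + phi X + sigma d/ds with A a vector field and
    phi, sigma functions on M.  Put c = 1 / (2(n+1)) and j = 2n+1.  On such
    fields everything has an expression on M:
    - nabla1 of (B, psi, tau) along (A, phi, sigma) is again of this form, with
      components
        nabla_A B - c psi rho A - c phi rho B - (c/j) phi psi u
          + sigma B + tau A,
        A(psi) - omega(A, B) + sigma psi + tau phi,
        A(tau) + gamma((A, phi), (B, psi)) + sigma tau
      ([nabla1_basic]);
    - for constant phi, sigma, psi, tau the bracket is ([A, B], - 2 omega(A, B), 0)
      ([bracket_frame]), as X and d/ds commute with each other and with the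
      lifts;
    - mu is 2 e^(2s) (omega(A, B) + sigma psi - tau phi) ([d1_basic]).

    Hence torsion, parallelism and curvature become identities between vectors
    and scalars at a point of M.  Torsion-freeness reduces to that of nabla and
    to the symmetry of the Ricci tensor.  The form mu is parallel because omega is:
    the derivative of e^(2s) is compensated by the identity Z -> nabla1_Z d/ds, and
    the terms - omega(A, B) X and gamma d/ds match those in rho and u
    ([parallel_alg]).  For the curvature, the horizontal component reduces to
    the Ricci-type formula for R and the formulas for nabla rho and nabla u
    ([curvature_hor]), the Reeb component to the symmetry of the Ricci tensor
    ([curvature_al]), and the d/ds component to the formulas for nabla rho and
    nabla u and to df(A) = 2 c omega(u, rho A) ([curvature_s]).

    This last equation is a consequence of the others ([act_f]).  Computing
    R(A, B)u from the formula for nabla u and from the Ricci-type formula, and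
    comparing, gives e(A) B = e(B) A for e(A) = df(A) - 2 c omega(u, rho A);
    pairing with A and choosing B with omega(A, B) <> 0 gives e(A) = 0.

    The analytic preliminaries are the chain rule, the symmetry of second
    derivatives (which makes the bracket act as a commutator) and the existence
    of bump functions.  *)

Set Implicit Arguments.
Unset Strict Implicit.
Unset Printing Implicit Defensive.
Import Order.TTheory GRing.Theory Num.Theory numFieldNormedType.Exports.
Local Open Scope classical_set_scope.
Local Open Scope ring_scope.

(** * Germs of smooth functions on coordinate space *)

Section Germs.
Context {R : realType}.

Lemma near_eq_differentiable (V W : normedModType R) (f g : V -> W) (x : V) :
  (\near x, f x = g x) -> differentiable f x -> differentiable g x.
Proof.
move=> fg /diff_locallyP[dc dE].
have gE : g \o shift x = cst (g x) + 'd f x +o_ 0 id.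
  move/eqaddoP: dE => dE; apply/eqaddoP => e e0.
  have fgx := nbhs_singleton fg.
  have fg' : \forall h \near (0 : V), f (h + x) = g (h + x).
    by move: fg; rewrite (near_shift 0) subr0.
  by near=> h; rewrite /= !fctE /= -fgx -(near fg' h)//; near: h; exact: dE.
have gd := diff_unique dc gE.
by apply/diff_locallyP; rewrite gd.
Unshelve. all: by end_near. Qed.

Lemma near_eq_continuous_at (T S : topologicalType) (f g : T -> S) (x : T) :
  (\near x, f x = g x) -> {for x, continuous f} -> {for x, continuous g}.
Proof.
move=> fg; rewrite /prop_for /continuous_at (nbhs_singleton fg).
by apply: cvg_trans; apply: near_eq_cvg; apply: filterS fg => y ->.
Qed.

Context {m : nat}.
Implicit Types (f g h : 'rV[R]_m -> R) (x v : 'rV[R]_m) (A : set 'rV[R]_m).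

Lemma near_derive f g x v :
  (\near x, f x = g x) -> \near x, 'D_v f x = 'D_v g x.
Proof. by move=> /near_join; apply: filterS => y; exact: near_eq_derive. Qed.

(** [Ck] is a condition at each point of A separately, so smoothness can be
    studied one point at a time. *)
Lemma CkP k A f : Ck k A f <-> forall x, A x -> Ck k [set x] f.
Proof.
elim: k f => [|k IH] f /=.
  split=> [H x Ax _ -> | H x Ax]; first exact: H.
  exact: (H x Ax).
split=> [[df H] x Ax|H].
  by split=> [_ ->|v]; [exact: df|exact: ((IH _).1 (H v) x Ax)].
split=> [x Ax|v]; first by have [d _] := H x Ax; exact: d.
by apply/IH => x Ax; have [_ d] := H x Ax; exact: d.
Qed.

Lemma Ck_near_eq k x f g :
  (\near x, f x = g x) -> Ck k [set x] f -> Ck k [set x] g.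
Proof.
elim: k f g => [|k IH] f g fg /=.
  by move=> H _ ->; apply: near_eq_continuous_at fg _; exact: H.
move=> [df H]; split=> [_ ->|v].
  by apply: near_eq_differentiable fg _; exact: df.
by apply: IH (H v); exact: near_derive.
Qed.

(** Quantifying over a neighbourhood makes smoothness at a point an open
    condition, which the derivatives of f inherit; [Ck k] on the singleton alone
    would not control nearby points. *)
Definition smooth_at f x := \near x, forall k, Ck k [set x] f.

Lemma smooth_at_open f x : smooth_at f x -> \near x, smooth_at f x.
Proof. exact: near_join. Qed.

Lemma smooth_atP f A : open A -> (forall k, Ck k A f) <-> (forall x, A x -> smooth_at f x).
Proof.
move=> oA; split=> [H x Ax|H k].
  have : nbhs x A by exact: open_nbhs_nbhs.
  by apply: filterS => y Ay k; exact: ((CkP k A f).1 (H k) y Ay).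
by apply/CkP => x /H /nbhs_singleton d; exact: d.
Qed.

Lemma smooth_at_near_eq f g x : (\near x, f x = g x) -> smooth_at f x -> smooth_at g x.
Proof.
move=> fg sf; have fg' := near_join fg.
by near=> y => k; apply: (@Ck_near_eq _ _ f); [exact: (near fg')|apply: (near sf)].
Unshelve. all: by end_near. Qed.

Lemma smooth_at_diff f x : smooth_at f x -> differentiable f x.
Proof. by move=> /nbhs_singleton /(_ 1%N) [d _]; exact: d. Qed.

Lemma smooth_at_near_diff f x : smooth_at f x -> \near x, differentiable f x.
Proof. by move=> /smooth_at_open; apply: filterS => y; exact: smooth_at_diff. Qed.

Lemma smooth_at_cont f x : smooth_at f x -> {for x, continuous f}.
Proof. by move=> /smooth_at_diff /differentiable_continuous. Qed.

Lemma smooth_at_D f x v : smooth_at f x -> smooth_at (fun y => 'D_v f y) x.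
Proof. by apply: filterS => y H k; have [_ d] := H k.+1; exact: d. Qed.

Inductive generated (S : ('rV[R]_m -> R) -> Prop) : ('rV[R]_m -> R) -> Prop :=
| generated_base f of S f : generated S f
| generated_add f g of generated S f & generated S g : generated S (fun y => f y + g y)
| generated_mul f g of generated S f & generated S g : generated S (fun y => f y * g y).

Lemma diffD_fun f g x : differentiable f x -> differentiable g x ->
  differentiable (fun y => f y + g y) x.
Proof. exact: differentiableD. Qed.

Lemma diffM_fun f g x : differentiable f x -> differentiable g x ->
  differentiable (fun y => f y * g y) x.
Proof. exact: differentiableM. Qed.

Lemma deriveD_fun f g x v : differentiable f x -> differentiable g x ->
  'D_v (fun y => f y + g y) x = 'D_v f x + 'D_v g x.
Proof. by move=> df dg; rewrite deriveD//; exact: diff_derivable. Qed.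

Lemma deriveM_fun f g x v : differentiable f x -> differentiable g x ->
  'D_v (fun y => f y * g y) x = 'D_v f x * g x + f x * 'D_v g x.
Proof.
move=> df dg; rewrite (@deriveM _ _ f g); try exact: diff_derivable.
by rewrite /GRing.scale/= addrC mulrC.
Qed.

Section Upto.
Variable S : 'rV[R]_m -> ('rV[R]_m -> R) -> Prop.
Hypothesis S_open : forall x h, S x h -> \near x, S x h.
Hypothesis S_diff : forall x h, S x h -> differentiable h x.
Hypothesis S_D : forall x h, S x h -> forall v,
  exists2 h', generated (S x) h' & \near x, h' x = 'D_v h x.

Let generated_open x h : generated (S x) h -> \near x, generated (S x) h.
Proof.
elim=> [f /S_open|f g _ F _ G|f g _ F _ G].
- by apply: filterS => y; exact: generated_base.
- by apply: filterS2 F G => y; exact: generated_add.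
- by apply: filterS2 F G => y; exact: generated_mul.
Qed.

Let generated_diff x h : generated (S x) h -> differentiable h x.
Proof.
elim=> [f /S_diff//|f g _ F _ G|f g _ F _ G].
  exact: diffD_fun.
exact: diffM_fun.
Qed.

Let generated_D x h v : generated (S x) h ->
  exists2 h', generated (S x) h' & \near x, h' x = 'D_v h x.
Proof.
elim=> [f /S_D/(_ v)//|f g Sf [f' F nf] Sg [g' G ng]
       |f g Sf [f' F nf] Sg [g' G ng]].
- exists (fun y => f' y + g' y); first exact: generated_add.
  have Nf := generated_open Sf; have Ng := generated_open Sg.
  near=> y; rewrite deriveD_fun; [|apply: generated_diff..].
  + by rewrite (near nf y)// (near ng y).
  + exact: (near Nf y).
  + exact: (near Ng y).
- exists (fun y => f' y * g y + f y * g' y).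
    by apply: generated_add; apply: generated_mul.
  have Nf := generated_open Sf; have Ng := generated_open Sg.
  near=> y; rewrite deriveM_fun; [|apply: generated_diff..].
  + by rewrite (near nf y)// (near ng y).
  + exact: (near Nf y).
  + exact: (near Ng y).
Unshelve. all: by end_near. Qed.

(** Smoothness by coinduction up to sums and products.  A derivative of a
    composite is a sum of products of derivatives, so a class of functions is
    rarely stable under derivation, but the algebra that it generates is, by the
    Leibniz rule; induction on k then runs over that whole algebra, and no
    formula for higher derivatives is needed. *)
Lemma smooth_at_upto x h : generated (S x) h -> smooth_at h x.
Proof.
move=> Sh; suff H k y f : generated (S y) f -> Ck k [set y] f.
  by move: (generated_open Sh); apply: filterS => y Sy k; exact: H.
elim: k f => [|k IH] f Sf /=.
  by move=> _ ->; exact/differentiable_continuous/generated_diff.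
split=> [_ ->|v]; first exact: generated_diff.
have [f' Sf' nf] := generated_D v Sf.
by apply: Ck_near_eq nf _; exact: IH.
Qed.

End Upto.

Let smooth_at_alg x h : generated (fun f => smooth_at f x) h -> smooth_at h x.
Proof.
apply: (@smooth_at_upto (fun x f => smooth_at f x)) => {x h} x h sh.
- exact: smooth_at_open.
- exact: smooth_at_diff.
- move=> v; exists (fun y => 'D_v h y); last by near=> y.
  by apply: generated_base; exact: smooth_at_D.
Unshelve. all: by end_near. Qed.

Lemma smooth_atD f g x : smooth_at f x -> smooth_at g x -> smooth_at (fun y => f y + g y) x.
Proof. by move=> F G; apply: smooth_at_alg; apply: generated_add; apply: generated_base. Qed.

Lemma smooth_atM f g x : smooth_at f x -> smooth_at g x -> smooth_at (fun y => f y * g y) x.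
Proof. by move=> F G; apply: smooth_at_alg; apply: generated_mul; apply: generated_base. Qed.

Lemma smooth_at_cst a x : smooth_at (fun=> a) x.
Proof.
apply: (@smooth_at_upto (fun _ f => exists a, f = fun=> a)); last first.
  by apply: generated_base; exists a.
- move=> y h [b ->] v; exists (fun=> 0); first by apply: generated_base; exists 0.
  by near=> z; rewrite derive_cst.
- by move=> y h [b ->]; exact: differentiable_cst.
- by move=> y h [b ->]; near=> z; exists b.
Unshelve. all: by end_near. Qed.

Lemma smooth_atN f x : smooth_at f x -> smooth_at (fun y => - f y) x.
Proof.
move=> F; apply: (@smooth_at_near_eq (fun y => -1 * f y)); last first.
  exact: smooth_atM (smooth_at_cst _ _) F.
by near=> y; rewrite mulN1r.
Unshelve. all: by end_near. Qed.

Lemma smooth_at_sum n (F : 'I_n -> 'rV[R]_m -> R) x :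
  (forall i, smooth_at (F i) x) -> smooth_at (fun y => \sum_i F i y) x.
Proof.
elim: n F => [|n IH] F sF.
  by under eq_fun do rewrite big_ord0; exact: smooth_at_cst.
under eq_fun do rewrite big_ord_recl.
by apply: smooth_atD => //; apply: IH.
Qed.

End Germs.

(** * Compositions of smooth functions *)

Section Chain.
Context {R : realType}.

Lemma derive_sum_coord m (f : 'rV[R]_m -> R) x v : differentiable f x ->
  'D_v f x = \sum_i v ord0 i * 'D_(delta_mx ord0 i) f x.
Proof.
move=> df; rewrite deriveE// {1}(row_sum_delta v) linear_sum.
by apply: eq_bigr => i _; rewrite linearZ deriveE.
Qed.

Lemma differentiable_row m l (F : 'rV[R]_m -> 'rV[R]_l) x :
  (forall j, differentiable (fun y => F y ord0 j) x) -> differentiable F x.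
Proof.
move=> dF; rewrite (_ : F = \sum_(j < l) (fun y => F y ord0 j *: delta_mx ord0 j)).
  by apply: differentiable_sum => j; exact: differentiableZl.
apply/funext => y; rewrite fct_sumE; exact: row_sum_delta.
Qed.

Lemma chain_rule m l (F : 'rV[R]_m -> 'rV[R]_l) (g : 'rV[R]_l -> R) x v :
  (forall j, differentiable (fun y => F y ord0 j) x) ->
  differentiable g (F x) ->
  'D_v (g \o F) x = \sum_j 'D_v (fun y => F y ord0 j) x *
                            'D_(delta_mx ord0 j) g (F x).
Proof.
move=> dF dg; have dF' := differentiable_row dF.
rewrite deriveE; last exact: differentiable_comp.
rewrite diff_comp//= -!deriveE// derive_sum_coord//.
by apply: eq_bigr => j _; rewrite derive_mx ?mxE//; exact: diff_derivable.
Qed.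

Lemma generated_sum m (S : ('rV[R]_m -> R) -> Prop) n (F : 'I_n -> 'rV[R]_m -> R) :
  S (fun=> 0) -> (forall i, generated S (F i)) -> generated S (fun y => \sum_i F i y).
Proof.
move=> S0; elim: n F => [|n IH] F sF.
  by under eq_fun do rewrite big_ord0; exact: generated_base.
under eq_fun do rewrite big_ord_recl.
by apply: generated_add => //; apply: IH.
Qed.

Lemma row_cont m l (F : 'rV[R]_m -> 'rV[R]_l) x :
  (forall j, smooth_at (fun y => F y ord0 j) x) -> {for x, continuous F}.
Proof.
by move=> sF; apply/differentiable_continuous/differentiable_row => j; exact/smooth_at_diff.
Qed.

Lemma near_forall (T : topologicalType) n (x : T) (P : 'I_n -> T -> Prop) :
  (forall i, \near x, P i x) -> \near x, forall i, P i x.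
Proof. by move=> H; apply: filter_forall. Qed.

(** The class consists of the smooth functions and of the g \o F with F and g
    smooth: by the chain rule its derivatives are sums of products of
    members. *)
Lemma smooth_at_comp m l (F : 'rV[R]_m -> 'rV[R]_l) (g : 'rV[R]_l -> R) x :
  (forall j, smooth_at (fun y => F y ord0 j) x) -> smooth_at g (F x) -> smooth_at (g \o F) x.
Proof.
pose S (x : 'rV[R]_m) (h : 'rV[R]_m -> R) := smooth_at h x \/
  exists g, [/\ h = g \o F, forall j, smooth_at (fun y => F y ord0 j) x & smooth_at g (F x)].
move=> sF sg; apply: (@smooth_at_upto _ _ S); last by apply: generated_base; right; exists g.
- move=> {sF sg} {}x h [/smooth_at_open|[{}g [-> sF sg]]].
    by apply: filterS => y; left.
  have nF := near_forall (fun j => smooth_at_open (sF j)).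
  have ng : \near x, smooth_at g (F x) := row_cont sF (smooth_at_open sg).
  by apply: filterS2 nF ng => y Fy gy; right; exists g.
- move=> {sF sg} {}x h [/smooth_at_diff//|[{}g [-> sF sg]]].
  apply: differentiable_comp; last exact: smooth_at_diff.
  by apply: differentiable_row => j; exact: smooth_at_diff.
- move=> {sF sg} {}x h [sh|[{}g [-> sF sg]]] v.
    exists (fun y => 'D_v h y); last by near=> y.
    by apply: generated_base; left; exact: smooth_at_D.
  exists (fun y => \sum_j 'D_v (fun y => F y ord0 j) y *
                            ((fun z => 'D_(delta_mx ord0 j) g z) \o F) y).
    apply: generated_sum => [|j]; first by left; exact: smooth_at_cst.
    apply: generated_mul; apply: generated_base; first by left; exact: smooth_at_D.
    by right; exists (fun z => 'D_(delta_mx ord0 j) g z); split => //; exact: smooth_at_D.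
  have nF := near_forall (fun j => smooth_at_near_diff (sF j)).
  have ng : \near x, differentiable g (F x) := row_cont sF (smooth_at_near_diff sg).
  near=> y; rewrite (chain_rule v)//; first exact: (near nF y).
  exact: (near ng y).
Unshelve. all: by end_near. Qed.

Lemma smooth_at_coord m (j : 'I_m) (x : 'rV[R]_m) : smooth_at (fun y => y ord0 j) x.
Proof.
pose S (x : 'rV[R]_m) (h : 'rV[R]_m -> R) := smooth_at h x \/ h = fun y => y ord0 j.
apply: (@smooth_at_upto _ _ S); last by apply: generated_base; right.
- move=> {}x h [/smooth_at_open|->]; first by apply: filterS => y; left.
  by near=> y; right.
- move=> {}x h [/smooth_at_diff//|->]; exact: differentiable_coord.
- move=> {}x h [sh|->] v.
    exists (fun y => 'D_v h y); last by near=> y.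
    by apply: generated_base; left; exact: smooth_at_D.
  exists (fun=> v ord0 j); first by apply: generated_base; left; exact: smooth_at_cst.
  near=> y; have := derive_mx (@derivable_id R _ y v).
  by rewrite derive_id => /rowP/(_ j) ->; rewrite mxE.
Unshelve. all: by end_near. Qed.

(** A one-variable function h need not be treated alone: it is enough that it
    lies in a family K whose derivatives are combinations of two members of K.
    The exponential, the inverse powers and the flat functions are all of this
    kind. *)
Section Scalar.
Variables (m : nat) (O : set R) (K : (R -> R) -> Prop).
Hypothesis oO : open O.
Hypothesis KD : forall h, K h -> forall t, O t -> derivable h t 1.
Hypothesis KE : forall h, K h -> exists h1 h2 a b, [/\ K h1, K h2 &
  forall t, O t -> 'D_1 h t = a * h1 t + b * h2 t].

Lemma smooth_at_scalar (f : 'rV[R]_m -> R) (h : R -> R) x :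
  smooth_at f x -> O (f x) -> K h -> smooth_at (h \o f) x.
Proof.
pose S (x : 'rV[R]_m) (k : 'rV[R]_m -> R) := smooth_at k x \/
  exists h, [/\ k = h \o f, K h, smooth_at f x & O (f x)].
move=> sf Of Kh; apply: (@smooth_at_upto _ _ S); last by apply: generated_base; right; exists h.
- move=> {sf Of Kh} {}x k [/smooth_at_open|[{}h [-> Kh sf Of]]].
    by apply: filterS => y; left.
  have nO : nbhs x (f @^-1` O) by apply: (smooth_at_cont sf); exact: open_nbhs_nbhs.
  by apply: filterS2 (smooth_at_open sf) nO => y fy Oy; right; exists h.
- move=> {sf Of Kh} {}x k [/smooth_at_diff//|[{}h [-> Kh sf Of]]].
  apply: differentiable_comp; first exact: smooth_at_diff.
  by apply/derivable1_diffP; exact: KD.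
- move=> {sf Of Kh} {}x k [sk|[{}h [-> Kh sf Of]]] v.
    exists (fun y => 'D_v k y); last by near=> y.
    by apply: generated_base; left; exact: smooth_at_D.
  have [h1 [h2 [a [b [K1 K2 hE]]]]] := KE Kh.
  exists (fun y => (a * (h1 \o f) y + b * (h2 \o f) y) * 'D_v f y).
    apply: generated_mul; last by apply: generated_base; left; exact: smooth_at_D.
    apply: generated_add; apply: generated_mul; apply: generated_base.
    + by left; exact: smooth_at_cst.
    + by right; exists h1.
    + by left; exact: smooth_at_cst.
    + by right; exists h2.
  have nO : nbhs x (f @^-1` O) by apply: (smooth_at_cont sf); exact: open_nbhs_nbhs.
  have nf := smooth_at_near_diff sf.
  near=> y.
  have dy : differentiable f y by exact: (near nf y).
  have Oy : O (f y) by exact: (near nO y).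
  have dh : differentiable h (f y) by apply/derivable1_diffP; exact: KD.
  rewrite -hE// (deriveE v (differentiable_comp dy dh)) diff_comp//= (deriveE v dy).
  by rewrite (diff1E dh) derive1E /GRing.scale/= mulrC.
Unshelve. all: by end_near. Qed.

End Scalar.

Lemma smooth_at_exp m (f : 'rV[R]_m -> R) x : smooth_at f x -> smooth_at (fun y => expR (f y)) x.
Proof.
move=> sf; apply: (@smooth_at_scalar m setT (fun h => h = expR) _ _ _ f expR) => //.
- exact: openT.
- by move=> h -> t _; exact: derivable_expR.
- move=> h ->; exists expR, expR, 1, 0; split=> // t _.
  by rewrite mul1r mul0r addr0; exact: (congr1 (@^~ t) (derive_expR R)).
Qed.

Lemma is_derive_expVn n (t : R) : t != 0 ->
  is_derive t 1 (fun t : R => t ^- n) (- n%:R * t ^- n.+1).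
Proof.
move=> t0; have tn0 : t ^+ n != 0 by rewrite expf_neq0.
apply: DeriveDef.
  by apply: (@derivableV R R^o (fun t : R => t ^+ n)) => //; exact: exprn_derivable.
rewrite (@deriveV R R^o (fun t : R => t ^+ n)) => //; last exact: exprn_derivable.
rewrite exp_derive /GRing.scale/= mulr1 !mulNr; congr (- _).
case: n tn0 => [|n] _; first by rewrite !mul0r mulr0.
have sn0 : t ^+ n != 0 by rewrite expf_neq0.
rewrite /= !exprS; move: (t ^+ n) sn0 => s s0; field.
by rewrite t0 s0.
Qed.

Lemma smooth_at_inv m (f : 'rV[R]_m -> R) x : smooth_at f x -> f x != 0 ->
  smooth_at (fun y => (f y)^-1) x.
Proof.
move=> sf fx; apply: (@smooth_at_scalar m [set t | t != 0]
  (fun h => exists n, h = fun t => t ^- n) _ _ _ f (fun t => t^-1)) => //.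
- by move=> h [n ->] t /(is_derive_expVn n)[].
- move=> h [n ->]; exists (fun t => t ^- n.+1), (fun t => t ^- n.+1), (- n%:R), 0.
  split; [by exists n.+1|by exists n.+1|] => t /(is_derive_expVn n)[_ ->].
  by rewrite mul0r addr0.
- by exists 1%N; apply/funext => t; rewrite expr1.
Qed.

End Chain.

(** * Symmetry of second derivatives *)

Section Schwarz.
Context {R : realType} {m : nat}.
Implicit Types (f : 'rV[R]_m -> R) (x u v : 'rV[R]_m).

Lemma is_derive_line f x u s : differentiable f (x + s *: u) ->
  is_derive s 1 (fun t : R => f (x + t *: u)) ('D_u f (x + s *: u)).
Proof.
move=> df; have := @diff_derivable _ _ _ _ _ u df.
have E : (fun h : R => h^-1 *: (((fun t : R => f (x + t *: u)) \o shift s) (h *: 1) -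
     f (x + s *: u))) =
   (fun h : R => h^-1 *: ((f \o shift (x + s *: u)) (h *: u) - f (x + s *: u))).
  apply/funext => h; congr (_ *: (f _ - _)).
  by rewrite /= [h *: 1]mulr1 scalerDl addrCA.
move=> fd; apply: DeriveDef; last by rewrite /derive E.
by move: fd; rewrite /derivable E.
Qed.

Lemma mvt_line f x u t : 0 < t ->
  (forall s, 0 <= s <= t -> differentiable f (x + s *: u)) ->
  exists2 s, 0 < s < t & f (x + t *: u) - f x = 'D_u f (x + s *: u) * t.
Proof.
move=> t0 df.
have [||s] := @MVT R (fun s => f (x + s *: u)) (fun s => 'D_u f (x + s *: u)) 0 t t0.
- move=> s; rewrite in_itv/= => /andP[s0 st]; apply: is_derive_line.
  by apply: df; rewrite !ltW.
- apply: derivable_within_continuous => s; rewrite in_itv/= => st.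
  by have [] := is_derive_line (df s st).
- by rewrite in_itv/= subr0 scale0r addr0 => st E; exists s.
Qed.

Lemma near_plane x u v (P : 'rV[R]_m -> Prop) : (\near x, P x) ->
  exists2 r : R, 0 < r & forall a b, 0 <= a <= r -> 0 <= b <= r ->
    P (x + a *: u + b *: v).
Proof.
move=> /nbhs_normP[e /= e0 Pe].
pose N := `|u| + `|v| + 1.
have N0 : 0 < N by rewrite ltr_wpDl// addr_ge0.
exists (e / 2 / N) => [|a b /andP[a0 ar] /andP[b0 br]]; first by rewrite !divr_gt0.
apply: Pe => /=; rewrite -addrA opprD addrA subrr add0r normrN.
apply: (@le_lt_trans _ _ (e / 2)); last by lra.
apply: le_trans (ler_normD _ _) _; rewrite !normrZ !ger0_norm//.
apply: (@le_trans _ _ (e / 2 / N * `|u| + e / 2 / N * `|v|)).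
  by apply: lerD; apply: ler_wpM2r.
rewrite -mulrDr -[leRHS](divfK (lt0r_neq0 N0)) ler_pM2l ?divr_gt0//.
by rewrite /N lerDl.
Qed.

Let quot f x u v (t : R) :=
  f (x + t *: u + t *: v) - f (x + t *: u) - (f (x + t *: v) - f x).

Let quotC f x u v t : quot f x u v t = quot f x v u t.
Proof.
rewrite /quot (addrAC x (t *: v)).
move: (f (x + t *: u + t *: v)) (f (x + t *: u)) (f (x + t *: v)) (f x) => a b c d.
by ring.
Qed.

(** The mean value theorem is applied along u to the increment of f in the
    direction v, and then along v to the derivative of f in the direction u. *)
Let quot_mvt f x u v : smooth_at f x -> exists2 r : R, 0 < r & forall t, 0 < t <= r ->
  exists a b, [/\ 0 <= a <= t, 0 <= b <= t &
    quot f x u v t = 'D_v (fun y => 'D_u f y) (x + a *: u + b *: v) * t * t].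
Proof.
move=> sf; have [r r0 H] := near_plane u v (smooth_at_open sf).
exists r => // t /andP[t0 tr].
pose g y := f (y + t *: v) - f y.
have dD s : 0 <= s <= t -> differentiable (fun y => f (y + t *: v)) (x + s *: u).
  move=> /andP[s0 st]; apply: (@differentiable_comp _ _ _ _ (fun y => y + t *: v)).
    by [].
  apply: smooth_at_diff; apply: H; first by rewrite s0 (le_trans st).
  by rewrite ltW.
have df s : 0 <= s <= t -> differentiable f (x + s *: u).
  move=> /andP[s0 st]; have := smooth_at_diff (H s 0 _ _); rewrite scale0r addr0; apply.
    by rewrite s0 (le_trans st).
  by rewrite lexx ltW.
have dg s : 0 <= s <= t -> differentiable g (x + s *: u).
  by move=> st; apply: differentiableB; [exact: dD|exact: df].
have [a /andP[a0 at'] gE] := mvt_line t0 dg.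
have a0t : 0 <= a <= t by rewrite !ltW.
have DgE : 'D_u g (x + a *: u) =
   'D_u f (x + a *: u + t *: v) - 'D_u f (x + a *: u).
  rewrite deriveB; [|by apply: diff_derivable; [exact: dD || exact: df]..].
  suff -> : 'D_u (fun y => f (y + t *: v)) (x + a *: u) =
            'D_u f (x + a *: u + t *: v) by [].
  rewrite /derive; do 3 f_equal; apply/funext => h /=.
  by rewrite !addrA.
have dDu s : 0 <= s <= t ->
    differentiable (fun y => 'D_u f y) (x + a *: u + s *: v).
  move=> /andP[s0 st]; apply: smooth_at_diff; apply: smooth_at_D; apply: H.
    by rewrite ltW// (le_trans (ltW at')).
  by rewrite s0 (le_trans st).
have [b /andP[b0 bt] DE] := mvt_line t0 dDu.
exists a, b; split; [by rewrite !ltW|by rewrite !ltW|].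
move: gE; rewrite {1 2}/g DgE DE => <-; rewrite /quot.
by rewrite addrAC.
Qed.

Let dist_le (e A B C D : R) : `|A - C| < e / 2 -> `|B - D| < e / 2 -> C = D ->
  `|A - B| <= e.
Proof.
move=> AC BD CD; rewrite (_ : A - B = (A - C) - (B - D)).
  by apply: le_trans (ler_normB _ _) _; lra.
by rewrite CD opprB addrA subrK.
Qed.

(** The second difference of f over the parallelogram spanned by t u and t v is
    symmetric in u and v; divided by t^2 it is a value, near x, of either
    iterated derivative, and both are continuous at x. *)
Lemma derive_sym f x u v : smooth_at f x ->
  'D_v (fun y => 'D_u f y) x = 'D_u (fun y => 'D_v f y) x.
Proof.
move=> sf; apply/eqP; rewrite -subr_eq0 -normr_eq0; apply/eqP/le_anti.
rewrite normr_ge0 andbT; apply/ler_addgt0Pl => e e0; rewrite addr0.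
have e20 : 0 < e / 2 by rewrite divr_gt0.
have [r1 r10 H1] := quot_mvt u v sf.
have [r2 r20 H2] := quot_mvt v u sf.
have near_close w w' : \forall y \near x,
    `|'D_w (fun y => 'D_w' f y) x - 'D_w (fun y => 'D_w' f y) y| < e / 2.
  have /smooth_at_cont := smooth_at_D w (smooth_at_D w' sf).
  by move=> /cvgrPdist_lt /(_ _ e20).
have [r3 r30 H3] := near_plane u v (near_close v u).
have [r4 r40 H4] := near_plane v u (near_close u v).
pose t := Num.min (Num.min r1 r2) (Num.min r3 r4).
have t0 : 0 < t by rewrite !lt_min r10 r20 r30 r40.
have [t1 t2 t3 t4] : [/\ t <= r1, t <= r2, t <= r3 & t <= r4].
  by rewrite !ge_min !lexx !orbT.
have [|a [b [/andP[a0 at'] /andP[b0 bt] E1]]] := H1 t; first by rewrite t0.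
have [|c [d [/andP[c0 ct] /andP[d0 dt] E2]]] := H2 t; first by rewrite t0.
have K3 := H3 a b; rewrite a0 b0 (le_trans at' t3) (le_trans bt t3) in K3.
have K4 := H4 c d; rewrite c0 d0 (le_trans ct t4) (le_trans dt t4) in K4.
have E : 'D_v (fun y => 'D_u f y) (x + a *: u + b *: v) =
         'D_u (fun y => 'D_v f y) (x + c *: v + d *: u).
  apply: (mulIf (lt0r_neq0 t0)); apply: (mulIf (lt0r_neq0 t0)).
  by move: (quotC f x u v t); rewrite E1 E2.
exact: dist_le (K3 isT isT) (K4 isT isT) E.
Qed.

End Schwarz.

(** * Bump functions *)

Section Bump.
Context {R : realType}.

(** The powers t^-n are carried along because the derivatives of exp (-1/t)
    produce them: the family is closed under derivation, see
    [is_derive_flat]. *)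
Definition flat (n : nat) (t : R) : R := if 0 < t then t ^- n * expR (- t^-1) else 0.

Lemma flat_gt0 n t : 0 < t -> 0 < flat n t.
Proof. by move=> t0; rewrite /flat t0 mulr_gt0 ?expR_gt0 ?invr_gt0 ?exprn_gt0. Qed.

Lemma flat_le0 n t : t <= 0 -> flat n t = 0.
Proof. by rewrite /flat leNgt => /negbTE ->. Qed.

(** With y = 1/t this is y^(n+2) <= (n+2)! exp y, a term of the exponential
    series.  A quadratic bound is what gives derivative 0 at the origin. *)
Lemma flat_bound n : exists2 C : R, 0 < C & forall t, `|flat n t| <= C * t ^+ 2.
Proof.
exists (n.+2`!%:R) => [|t]; first by rewrite ltr0n fact_gt0.
have F0 : (0 : R) < n.+2`!%:R by rewrite ltr0n fact_gt0.
have [t0|t0] := ltP 0 t; last by rewrite flat_le0// normr0 mulr_ge0 ?sqr_ge0 ?ltW.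
rewrite gtr0_norm ?flat_gt0// /flat t0 expRN.
have i0 : 0 < t^-1 by rewrite invr_gt0.
have := @expR_ge1Dxn R t^-1 n.+1 (ltW i0).
set E := expR _; set F := (n.+2)`!%:R : R => H.
have E0 : 0 < E by exact: expR_gt0.
have H' : (t^-1) ^+ n.+2 <= F * E.
  by rewrite -ler_pdivrMl// mulrC; apply: le_trans H; rewrite lerDr.
rewrite ler_pdivrMr// mulrAC.
apply: le_trans (_ : t^-1 ^+ n.+2 * t ^+ 2 <= _).
  have tn0 := lt0r_neq0 t0.
  by rewrite -addn2 exprD -mulrA -exprMn mulVf// expr1n mulr1 exprVn.
by rewrite ler_pM2r ?exprn_gt0.
Qed.

Lemma is_derive_flat n (t : R) :
  is_derive t 1 (flat n) (- n%:R * flat n.+1 t + flat n.+2 t).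
Proof.
have [t0|t0|t0] := ltgtP t 0.
- rewrite !flat_le0 ?ltW// mulr0 addr0.
  apply: (@near_eq_is_derive R R^o R^o (cst 0)).
  by near=> s; rewrite flat_le0//; apply/ltW; near: s; exact: lt_nbhsl.
- apply: (@near_eq_is_derive R R^o R^o (fun s => s ^- n * expR (- s ^- 1))).
    near=> s; rewrite /flat (_ : 0 < s = true) ?expr1//.
    by near: s; exact: lt_nbhsr.
  have tn0 := lt0r_neq0 t0.
  have d1 := is_derive_expVn n tn0.
  have d2 := is_derive_expVn 1 tn0.
  have d3 : is_derive t 1 (fun s : R => expR (- s ^- 1))
     (expR (- t ^- 1) * (- (- 1%:R * t ^- 2))).
    by apply: (@is_derive1_comp _ expR (fun s : R => - s ^- 1)).
  have := @is_deriveM R R^o (fun s : R => s ^- n) (fun s : R => expR (- s ^- 1)) _ _ _ _ d1 d3.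
  move=> d4; apply: is_derive_eq d4 _.
  rewrite /flat t0 /GRing.scale/= expr1 !exprS.
  have sn0 : t ^+ n != 0 by rewrite expf_neq0.
  move: (t ^+ n) sn0 (expR _) => s s0 E; field.
  by rewrite tn0 s0.
- rewrite t0 !flat_le0// mulr0 addr0.
  have [C C0 H] := flat_bound n.
  have L : (fun h : R => h^-1 *: ((flat n \o shift 0) (h *: 1) - flat n 0)) @ 0^' --> (0 : R).
    apply/cvgrPdist_le => e e0.
    near=> h; rewrite sub0r normrN /= (flat_le0 n (lexx 0)) subr0 addr0 [h *: 1]mulr1.
    have h0 : h != 0 by near: h; exact: nbhs_dnbhs_neq.
    rewrite normrM normfV ler_pdivrMl ?normr_gt0//.
    apply: le_trans (H h) _; rewrite -real_normK ?num_real// expr2 mulrA mulrC.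
    rewrite ler_wpM2l// mulrC -ler_pdivlMr//.
    by near: h; apply: dnbhs0_le; rewrite divr_gt0.
  by apply: DeriveDef; [apply/cvg_ex; exists 0|exact: cvg_lim L].
Unshelve. all: by end_near. Qed.

Lemma smooth_at_flat m n (f : 'rV[R]_m -> R) x :
  smooth_at f x -> smooth_at (fun y => flat n (f y)) x.
Proof.
move=> sf; apply: (@smooth_at_scalar _ m setT
  (fun h => exists n, h = flat n) _ _ _ f (flat n)) => //.
- exact: openT.
- by move=> h [k ->] t _; have [] := is_derive_flat k t.
- move=> h [k ->]; exists (flat k.+1), (flat k.+2), (- k%:R), 1.
  split; [by exists k.+1|by exists k.+2|] => t _.
  by have [_ ->] := is_derive_flat k t; rewrite mul1r.
- by exists n.
Qed.

End Bump.

Section BumpSpace.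
Context {R : realType} {m : nat}.

(** The function is positive on the Euclidean ball of radius r, which lies in the
    compact cube K of half-side r, a ball of the sup norm. *)
Lemma bump_space (x : 'rV[R]_m) (A : set 'rV[R]_m) : nbhs x A ->
  exists (b : 'rV[R]_m -> R) (K : set 'rV[R]_m),
    [/\ forall y, smooth_at b y, b x != 0, compact K, K `<=` A &
        forall y, b y != 0 -> K y].
Proof.
move=> /nbhs_ballP[e /= e0 Ae].
pose r := e / 2; have r0 : 0 < r by rewrite divr_gt0.
pose b (y : 'rV[R]_m) := flat 0 (r ^+ 2 - \sum_i (y ord0 i - x ord0 i) ^+ 2).
exists b, [set y | forall i, `[x ord0 i - r, x ord0 i + r]%classic (y ord0 i)].
split.
- move=> y; apply: smooth_at_flat; apply: smooth_atD; first exact: smooth_at_cst.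
  apply: smooth_atN; apply: smooth_at_sum => i.
  under eq_fun do rewrite expr2.
  by apply: smooth_atM; apply: smooth_atD; [exact: smooth_at_coord|exact: smooth_at_cst|
                              exact: smooth_at_coord|exact: smooth_at_cst].
- rewrite lt0r_neq0// flat_gt0// big1 ?subr0 ?exprn_gt0// => i _.
  by rewrite subrr expr0n.
- apply: (@rV_compact _ _ (fun i => `[x ord0 i - r, x ord0 i + r]%classic)) => i.
  exact: segment_compact.
- move=> y Ky; apply: Ae; split => // i j; rewrite ord1.
  have := Ky j; rewrite /= in_itv/= => /andP[y1 y2].
  rewrite /ball/= ltr_norml /r in y1 y2 *; lra.
- move=> y by0 i; rewrite /= in_itv/=.
  have : 0 < r ^+ 2 - \sum_i (y ord0 i - x ord0 i) ^+ 2.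
    by rewrite ltNge; apply: contra by0 => /flat_le0; rewrite /b => ->.
  rewrite subr_gt0 (bigD1 i)//= => H.
  have : (y ord0 i - x ord0 i) ^+ 2 < r ^+ 2.
    by apply: le_lt_trans H; rewrite lerDl sumr_ge0// => j _; exact: sqr_ge0.
  move=> H2; have : `|y ord0 i - x ord0 i| < r.
    rewrite -(@ltr_pXn2r R 2 isT) ?nnegrE// ?(ltW r0)//.
    by rewrite real_normK// num_real.
  rewrite ltr_norml => /andP[h1 h2].
  by apply/andP; split; lra.
Qed.

End BumpSpace.

(** * Vector fields as derivations *)

Section Manifold.
Context {R : realType} {m : nat}.

(** Hausdorffness is what makes a function with compact support in a chart domain
    smooth when it is extended by zero. *)
Definition manifold (M : charted_space R m) : Prop :=
  [/\ hausdorff_space M,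
      forall c : M, is_chart (chart_at c),
      forall c : M, cdom (chart_at c) c &
      forall (c : M) i, smooth_on (cdom (chart_at c)) (xcoord c i)].

Lemma smooth_manifold_manifold M : smooth_manifold M -> manifold M.
Proof. by case. Qed.

Context {M : charted_space R m}.
Local Notation D c := (cdom (chart_at c)).
Local Notation e c := (ccoord (chart_at c)).
Local Notation g c := (cparam (chart_at c)).
Implicit Types (p q c : M) (f h : M -> R) (v w : 'rV[R]_m) (U V W : vfield M).

Definition smooth_germ f p := smooth_at (f \o g p) (e p p).

Definition partial c (i : 'I_m) f : M -> R :=
  fun q => 'D_(delta_mx ord0 i) (f \o g c) (e c q).

Hypothesis hM : manifold M.

Lemma mem_dom c : D c c. Proof. by case: hM. Qed.
#[local] Hint Resolve mem_dom : core.

Lemma chart_coordK c p : D c p -> g c (e c p) = p.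
Proof. by move=> Dp; have [_ /(_ c)[_ _ H _ _] _ _] := hM; exact: H. Qed.

Lemma near_dom c p : D c p -> \near p, D c p.
Proof.
by move=> Dp; have [_ /(_ c)[oD _ _ _ _] _ _] := hM; exact: open_nbhs_nbhs.
Qed.

Lemma cont_coord c p : D c p -> {for p, continuous (e c)}.
Proof. by move=> Dp; have [_ /(_ c)[_ _ _ H _] _ _] := hM; exact: H. Qed.

Lemma cont_param c p : D c p -> {for e c p, continuous (g c)}.
Proof.
by move=> Dp; have [_ /(_ c)[_ _ _ _ H] _ _] := hM; apply: H; exists p.
Qed.

Lemma near_param c p (P : M -> Prop) : D c p -> (\near p, P p) ->
  \forall y \near e c p, P (g c y).
Proof. by move=> Dp nP; apply: (cont_param Dp); rewrite /= chart_coordK. Qed.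

Lemma near_coord c p (P : 'rV[R]_m -> Prop) : D c p -> (\forall y \near e c p, P y) ->
  \near p, P (e c p).
Proof. by move=> Dp nP; exact: (cont_coord Dp). Qed.

Lemma near_im c p : D c p -> \forall y \near e c p, D c (g c y) /\ e c (g c y) = y.
Proof.
move=> Dp; have [_ /(_ c)[_ oi _ _ _] _ _] := hM.
have : nbhs (e c p) (e c @` D c) by apply: open_nbhs_nbhs; split => //; exists p.
by apply: filterS => _ [q Dq <-]; rewrite chart_coordK.
Qed.

Let open_W c (A : set M) : open A ->
  open [set x | (e c @` D c) x /\ A (g c x)].
Proof.
move=> oA; rewrite openE => x [[p Dp <-]]; rewrite chart_coordK// => Ap.
have nA : \near p, A p by exact: open_nbhs_nbhs.
apply: filterS2 (near_im Dp) (near_param Dp nA) => y [Dy ey] Ay.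
by split => //; exists (g c y).
Qed.

Let smooth_at_transition c c' p i : D c p -> D c' p -> smooth_at (xcoord c' i \o g c) (e c p).
Proof.
move=> Dp D'p; have [_ /(_ c')[oD' _ _ _ _] _ /(_ c' i) H] := hM.
apply: (smooth_atP _ (@open_W c _ oD')).1; first exact: H.
by split; [exists p|rewrite chart_coordK].
Qed.

Let smooth_at_change c c' f p : D c p -> D c' p ->
  smooth_at (f \o g c) (e c p) -> smooth_at (f \o g c') (e c' p).
Proof.
move=> Dp D'p sf.
apply: (@smooth_at_near_eq _ _ ((f \o g c) \o (e c \o g c'))).
  have := near_param D'p (near_dom Dp).
  by apply: filterS => y Dy /=; rewrite chart_coordK.
apply: smooth_at_comp => [j|]; first exact: smooth_at_transition.
by rewrite /= chart_coordK.
Qed.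

(** Transition maps are smooth, so smoothness at p may be tested in any chart
    around p. *)
Lemma smooth_germ_chart c f p : D c p -> smooth_germ f p <-> smooth_at (f \o g c) (e c p).
Proof. by move=> Dp; split; apply: smooth_at_change. Qed.

Lemma smooth_onP A f : open A -> smooth_on A f <-> (forall p, A p -> smooth_germ f p).
Proof.
move=> oA; split=> [H p Ap|H c].
  apply: (smooth_atP _ (@open_W p _ oA)).1; first exact: H.
  by split; [exists p|rewrite chart_coordK].
apply/(smooth_atP _ (@open_W c _ oA)) => x [[p Dp <-]]; rewrite chart_coordK// => Ap.
by apply/smooth_germ_chart => //; exact: H.
Qed.

Lemma smooth_funP f : smooth_fun f <-> (forall p, smooth_germ f p).
Proof.
by rewrite /smooth_fun smooth_onP; [split=> H p //; exact: H|exact: openT].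
Qed.

Lemma smooth_germ_near_eq f h p : (\near p, f p = h p) -> smooth_germ f p -> smooth_germ h p.
Proof.
by move=> fh; apply: smooth_at_near_eq; exact: (near_param (mem_dom p) fh).
Qed.

Lemma smooth_germ_near f p : smooth_germ f p -> \near p, smooth_germ f p.
Proof.
move=> /smooth_at_open /(near_coord (mem_dom p)) H.
by apply: filterS2 (near_dom (mem_dom p)) H => q Dq; exact: (smooth_germ_chart _ Dq).2.
Qed.

Lemma smooth_germ_cst a p : smooth_germ (fun=> a) p. Proof. exact: smooth_at_cst. Qed.

Lemma smooth_germD f h p : smooth_germ f p -> smooth_germ h p -> smooth_germ (fun q => f q + h q) p.
Proof. exact: smooth_atD. Qed.

Lemma smooth_germM f h p : smooth_germ f p -> smooth_germ h p -> smooth_germ (fun q => f q * h q) p.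
Proof. exact: smooth_atM. Qed.

Lemma smooth_germN f p : smooth_germ f p -> smooth_germ (fun q => - f q) p.
Proof. exact: smooth_atN. Qed.

Lemma smooth_germB f h p : smooth_germ f p -> smooth_germ h p -> smooth_germ (fun q => f q - h q) p.
Proof. by move=> sf sh; apply: smooth_germD => //; exact: smooth_germN. Qed.

Lemma smooth_germ_sum n (F : 'I_n -> M -> R) p :
  (forall i, smooth_germ (F i) p) -> smooth_germ (fun q => \sum_i F i q) p.
Proof. exact: smooth_at_sum. Qed.

Lemma smooth_germ_inv f p : smooth_germ f p -> f p != 0 -> smooth_germ (fun q => (f q)^-1) p.
Proof. by move=> sf fp; apply: smooth_at_inv => //=; rewrite chart_coordK. Qed.

Lemma smooth_germ_exp f p : smooth_germ f p -> smooth_germ (fun q => expR (f q)) p.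
Proof. exact: smooth_at_exp. Qed.

Lemma smooth_germ_xcoord c i p : D c p -> smooth_germ (xcoord c i) p.
Proof. by move=> Dp; exact: smooth_at_transition. Qed.

Lemma smooth_germ_cont f p : smooth_germ f p -> {for p, continuous f}.
Proof.
move=> /smooth_at_cont fc.
apply: (@near_eq_continuous_at _ _ ((f \o g p) \o e p)).
  by have := near_dom (mem_dom p); apply: filterS => q Dq /=; rewrite chart_coordK.
exact: (continuous_comp (cont_coord (mem_dom p)) fc).
Qed.

Lemma smooth_germ_neq0 f p : smooth_germ f p -> f p != 0 -> \near p, f p != 0.
Proof.
move=> /smooth_germ_cont fc fp.
suff : nbhs (f p) [set x : R | x != 0] by move/fc.
by apply: open_nbhs_nbhs; split => //; exact: (@open_neq R 0).
Qed.

Lemma smooth_germ_partial c i f p : D c p -> smooth_germ f p -> smooth_germ (partial c i f) p.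
Proof.
move=> Dp /(smooth_germ_chart _ Dp)/(smooth_at_D (delta_mx ord0 i)) sf.
apply/(smooth_germ_chart _ Dp); apply: smooth_at_near_eq sf.
by have := near_im Dp; apply: filterS => y [_ ey]; rewrite /partial /= ey.
Qed.

Lemma tangent_act_near_eq p v f h : (\near p, f p = h p) -> tangent_act p v f = tangent_act p v h.
Proof.
by move=> fh; apply: near_eq_derive; exact: (near_param (mem_dom p) fh).
Qed.

Lemma tangent_act_cst p v a : tangent_act p v (fun=> a) = 0.
Proof. exact: derive_cst. Qed.

Lemma tangent_actD p v f h : smooth_germ f p -> smooth_germ h p ->
  tangent_act p v (fun q => f q + h q) = tangent_act p v f + tangent_act p v h.
Proof. by move=> /smooth_at_diff sf /smooth_at_diff sh; exact: (deriveD_fun v sf sh). Qed.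

Lemma tangent_actM p v f h : smooth_germ f p -> smooth_germ h p ->
  tangent_act p v (fun q => f q * h q) = tangent_act p v f * h p + f p * tangent_act p v h.
Proof.
move=> /smooth_at_diff sf /smooth_at_diff sh.
by rewrite /tangent_act (deriveM_fun v sf sh) /= chart_coordK.
Qed.

Lemma tangent_actZ p v a f : smooth_germ f p ->
  tangent_act p v (fun q => a * f q) = a * tangent_act p v f.
Proof.
move=> sf; rewrite tangent_actM//; last exact: smooth_germ_cst.
by rewrite tangent_act_cst mul0r add0r.
Qed.

Lemma tangent_actN p v f : smooth_germ f p ->
  tangent_act p v (fun q => - f q) = - tangent_act p v f.
Proof.
move=> sf; rewrite -mulN1r -tangent_actZ//; congr tangent_act; apply/funext => q.
by rewrite mulN1r.
Qed.

Lemma tangent_actB p v f h : smooth_germ f p -> smooth_germ h p ->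
  tangent_act p v (fun q => f q - h q) = tangent_act p v f - tangent_act p v h.
Proof. by move=> sf sh; rewrite tangent_actD ?tangent_actN//; exact: smooth_germN. Qed.

Lemma tangent_act_sum n (F : 'I_n -> M -> R) p v : (forall i, smooth_germ (F i) p) ->
  tangent_act p v (fun q => \sum_i F i q) = \sum_i tangent_act p v (F i).
Proof.
elim: n F => [|n IH] F sF.
  by rewrite big_ord0; under eq_fun do rewrite big_ord0; exact: tangent_act_cst.
under eq_fun do rewrite big_ord_recl.
by rewrite tangent_actD// ?IH ?big_ord_recl//; apply: smooth_germ_sum.
Qed.

Lemma tangent_act_xcoord p v i : tangent_act p v (xcoord p i) = v ord0 i.
Proof.
rewrite /tangent_act (near_eq_derive v (g := fun y : 'rV[R]_m => y ord0 i)); last first.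
  by have := near_im (mem_dom p); apply: filterS => y [_ ey]; rewrite /= /xcoord ey.
have := derive_mx (@derivable_id R _ (e p p) v).
by rewrite derive_id => /rowP/(_ i) ->; rewrite mxE.
Qed.

Lemma tangent_act_chart c p v f : D c p -> smooth_germ f p ->
  tangent_act p v f = \sum_j tangent_act p v (xcoord c j) * partial c j f p.
Proof.
move=> Dp sf; rewrite /tangent_act.
rewrite (near_eq_derive v (g := (f \o g c) \o (e c \o g p))); last first.
  have := near_param (mem_dom p) (near_dom Dp).
  by apply: filterS => y Dy /=; rewrite chart_coordK.
rewrite chain_rule/= ?chart_coordK//; last exact/smooth_at_diff/(smooth_germ_chart _ Dp).
by move=> j; apply/smooth_at_diff; exact: smooth_at_transition.
Qed.

Lemma tangent_act_expand p v f : smooth_germ f p ->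
  tangent_act p v f = \sum_j v ord0 j * partial p j f p.
Proof.
move=> sf; rewrite (tangent_act_chart v (mem_dom p))//.
by under eq_bigr do rewrite tangent_act_xcoord.
Qed.

Lemma tangent_act_linear p a v w f : smooth_germ f p ->
  tangent_act p (a *: v + w) f = a * tangent_act p v f + tangent_act p w f.
Proof.
move=> sf; rewrite !tangent_act_expand// mulr_sumr -big_split/=; apply: eq_bigr => j _.
by rewrite !mxE mulrDl mulrA.
Qed.

(** The coordinates at p are smooth germs and recover the components of a tangent
    vector. *)
Lemma tangentP p v w :
  (forall f, smooth_germ f p -> tangent_act p v f = tangent_act p w f) -> v = w.
Proof.
move=> H; apply/rowP => i; rewrite -!(tangent_act_xcoord p); apply: H.
by apply: smooth_germ_xcoord.
Qed.

Lemma smooth_vfieldP U : smooth_vfield U <->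
  (forall c i p, D c p -> smooth_germ (act U (xcoord c i)) p).
Proof.
have oD c : open (D c) by have [_ /(_ c)[]] := hM.
by split=> H c i; apply/(smooth_onP _ (oD c)); exact: H.
Qed.

Lemma act_chart U c p f : D c p -> smooth_germ f p ->
  \near p, act U f p = \sum_j act U (xcoord c j) p * partial c j f p.
Proof.
move=> Dp sf; apply: filterS2 (near_dom Dp) (smooth_germ_near sf) => q Dq sq.
exact: tangent_act_chart.
Qed.

Lemma smooth_germ_act U f p : smooth_vfield U -> smooth_germ f p -> smooth_germ (act U f) p.
Proof.
move=> /smooth_vfieldP sU sf.
apply: (@smooth_germ_near_eq (fun q => \sum_j act U (xcoord p j) q * partial p j f q)).
  by apply: filterS (act_chart U (mem_dom p) sf) => q ->.
by apply: smooth_germ_sum => j; apply: smooth_germM; [exact: sU|exact: smooth_germ_partial].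
Qed.

Lemma partial_sym c i j f p : D c p -> smooth_germ f p ->
  partial c i (partial c j f) p = partial c j (partial c i f) p.
Proof.
move=> Dp /(smooth_germ_chart _ Dp) sf.
have H k l : partial c k (partial c l f) p =
    'D_(delta_mx ord0 k) (fun y => 'D_(delta_mx ord0 l) (f \o g c) y) (e c p).
  apply: near_eq_derive.
  by have := near_im Dp; apply: filterS => y [_ ey]; rewrite /partial /= ey.
by rewrite !H; apply: derive_sym.
Qed.

(** Only the second sum involves second derivatives of f, and it is symmetric in U
    and V by [partial_sym]. *)
Let act_act U V p f : smooth_vfield V -> smooth_germ f p ->
  act U (act V f) p =
  \sum_j act U (act V (xcoord p j)) p * partial p j f p +
  \sum_j \sum_i U p ord0 i * V p ord0 j * partial p i (partial p j f) p.
Proof.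
move=> /smooth_vfieldP sV sf.
rewrite /act (tangent_act_near_eq _ (act_chart V (mem_dom p) sf)) tangent_act_sum; last first.
  by move=> j; apply: smooth_germM; [exact: sV|exact: smooth_germ_partial].
rewrite -big_split/=; apply: eq_bigr => j _.
rewrite tangent_actM; [|exact: sV|exact: smooth_germ_partial].
congr (_ + _); rewrite {1}/act tangent_act_xcoord tangent_act_expand;
  last exact: smooth_germ_partial.
by rewrite mulr_sumr; apply: eq_bigr => i _; rewrite mulrCA mulrA.
Qed.

(** The components of the bracket are those of the first-order part of the
    commutator; the second-order parts cancel, see [act_act]. *)
Lemma act_bracket U V p f : smooth_vfield U -> smooth_vfield V -> smooth_germ f p ->
  act (bracket U V) f p = act U (act V f) p - act V (act U f) p.
Proof.
move=> sU sV sf; rewrite !act_act// {1}/act tangent_act_expand//.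
rewrite opprD addrACA [X in _ = _ + X](_ : _ = 0) ?addr0.
  rewrite -sumrB; apply: eq_bigr => j _.
  by rewrite /bracket mxE mulrBl.
apply/eqP; rewrite subr_eq0 exchange_big/=; apply/eqP.
apply: eq_bigr => i _; apply: eq_bigr => j _.
by rewrite partial_sym// [X in X * _ = _]mulrC.
Qed.

Lemma smooth_bracket U V : smooth_vfield U -> smooth_vfield V ->
  smooth_vfield (bracket U V).
Proof.
move=> sU sV; apply/smooth_vfieldP => c i p Dp.
apply: (@smooth_germ_near_eq (fun q => act U (act V (xcoord c i)) q
                             - act V (act U (xcoord c i)) q)).
  have := near_dom Dp; apply: filterS => q Dq.
  by rewrite -act_bracket//; exact: smooth_germ_xcoord.
by apply: smooth_germB; do 2!apply: smooth_germ_act => //; exact: smooth_germ_xcoord.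
Qed.

Lemma smooth_lin f U V : smooth_fun f -> smooth_vfield U -> smooth_vfield V ->
  smooth_vfield (fun q => f q *: U q + V q).
Proof.
move=> /smooth_funP sf sU sV; apply/smooth_vfieldP => c i p Dp.
apply: (@smooth_germ_near_eq (fun q => f q * act U (xcoord c i) q + act V (xcoord c i) q)).
  have := near_dom Dp; apply: filterS => q Dq.
  by rewrite /act tangent_act_linear//; exact: smooth_germ_xcoord.
apply: smooth_germD; [apply: smooth_germM => //|];
  by apply: smooth_germ_act => //; exact: smooth_germ_xcoord.
Qed.

Lemma smooth_vfield0 : @smooth_vfield R m M (fun=> 0).
Proof.
apply/smooth_vfieldP => c i p Dp; apply: (@smooth_germ_near_eq (fun=> 0)); last first.
  exact: smooth_germ_cst.
have := near_dom Dp; apply: filterS => q Dq.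
rewrite /act tangent_act_expand; last exact: smooth_germ_xcoord.
by rewrite big1// => j _; rewrite mxE mul0r.
Qed.

Lemma bracketC U V p : bracket U V p = - bracket V U p.
Proof. by apply/rowP => i; rewrite !mxE opprB. Qed.

Lemma act_near_eq U f h p : (\near p, f p = h p) -> act U f p = act U h p.
Proof. exact: tangent_act_near_eq. Qed.

Lemma act_cst U a p : act U (fun=> a) p = 0.
Proof. exact: tangent_act_cst. Qed.

Lemma actD U f h p : smooth_germ f p -> smooth_germ h p ->
  act U (fun q => f q + h q) p = act U f p + act U h p.
Proof. exact: tangent_actD. Qed.

Lemma actM U f h p : smooth_germ f p -> smooth_germ h p ->
  act U (fun q => f q * h q) p = act U f p * h p + f p * act U h p.
Proof. exact: tangent_actM. Qed.

Lemma actZ U a f p : smooth_germ f p -> act U (fun q => a * f q) p = a * act U f p.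
Proof. exact: tangent_actZ. Qed.

Lemma actN U f p : smooth_germ f p -> act U (fun q => - f q) p = - act U f p.
Proof. exact: tangent_actN. Qed.

Lemma actB U f h p : smooth_germ f p -> smooth_germ h p ->
  act U (fun q => f q - h q) p = act U f p - act U h p.
Proof. exact: tangent_actB. Qed.

Lemma act_lin f U V h p : smooth_germ h p ->
  act (fun q => f q *: U q + V q) h p = f p * act U h p + act V h p.
Proof. exact: tangent_act_linear. Qed.

Lemma act_xcoord U p i : act U (xcoord p i) p = U p ord0 i.
Proof. exact: tangent_act_xcoord. Qed.

Let rowE3 (a b x y : R) v w (u : 'rV[R]_m) i : v ord0 i = x -> w ord0 i = y ->
  (a *: v + w - b *: u) ord0 i = a * x + y - b * u ord0 i.
Proof. by move=> <- <-; rewrite !mxE. Qed.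

Let rowP_ord0 (v w : 'rV[R]_m) : (forall i, v ord0 i = w ord0 i) -> v = w.
Proof. by move=> H; apply/rowP => i; exact: H. Qed.

Let ring_aux (f aU aV wf u wU wV : R) :
  (f * aU + aV) - ((wf * u + f * wU) + wV) = f * (aU - wU) + (aV - wV) - wf * u.
Proof. by ring. Qed.

Lemma bracketE U V p i : bracket U V p ord0 i =
  act U (act V (xcoord p i)) p - act V (act U (xcoord p i)) p.
Proof. by rewrite mxE. Qed.

Lemma bracket_lin f U V W : smooth_fun f ->
  smooth_vfield U -> smooth_vfield V -> smooth_vfield W -> forall p,
  bracket (fun q => f q *: U q + V q) W p =
  f p *: bracket U W p + bracket V W p - act W f p *: U p.
Proof.
move=> sf sU sV sW p; apply: rowP_ord0 => i.
apply: etrans (bracketE _ _ _ _) _; apply: esym.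
apply: etrans (rowE3 _ _ _ (bracketE _ _ _ _) (bracketE _ _ _ _)) _; apply: esym.
have sx : smooth_germ (xcoord p i) p := smooth_germ_xcoord i (mem_dom p).
have sf' := (smooth_funP f).1 sf p.
have aU := smooth_germ_act sU sx; have aV := smooth_germ_act sV sx.
have aW := smooth_germ_act sW sx.
rewrite act_lin//.
have -> : act W (act (fun q => f q *: U q + V q) (xcoord p i)) p =
   act W (fun q => f q * act U (xcoord p i) q + act V (xcoord p i) q) p.
  apply: act_near_eq; have := smooth_germ_near sx; apply: filterS => q sq.
  exact: act_lin.
rewrite actD//; last exact: smooth_germM.
rewrite actM// act_xcoord.
exact: ring_aux.
Qed.

Lemma tangent_act_zero p f : smooth_germ f p -> tangent_act p 0 f = 0.
Proof. by move=> sf; rewrite tangent_act_expand// big1// => i _; rewrite mxE mul0r. Qed.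

Lemma act_zero f p : smooth_germ f p -> @act R m M (fun=> 0) f p = 0.
Proof. exact: tangent_act_zero. Qed.

Lemma bracket_zero W p : smooth_vfield W -> @bracket R m M (fun=> 0) W p = 0.
Proof.
move=> sW; apply: rowP_ord0 => i; apply: etrans (bracketE _ _ _ _) _; rewrite [RHS]mxE.
have sx : smooth_germ (xcoord p i) p := smooth_germ_xcoord i (mem_dom p).
have E1 := act_zero (smooth_germ_act sW sx).
have E2 : act W (act (fun=> 0) (xcoord p i)) p = 0.
  rewrite (act_near_eq W (h := fun=> 0)) ?act_cst//.
  by apply: filterS (smooth_germ_near sx) => q; exact: act_zero.
by apply: etrans (congr2 (fun a b : R => a - b) E1 E2) _; rewrite subrr.
Qed.

End Manifold.

(** * Linear forms *)

Section ScalarForm.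
Context {R : realType} {m : nat} (a : 'rV[R]_m -> R) (al : scalar a).

Lemma scalar_form0 : a 0 = 0.
Proof.
have := al 1 0 0; rewrite scaler0 addr0 mul1r => /(congr1 (fun x => x - a 0)).
by rewrite subrr addrK.
Qed.

Lemma scalar_formZ k v : a (k *: v) = k * a v.
Proof. by rewrite -[k *: v]addr0 al scalar_form0 addr0. Qed.

Lemma scalar_formD v w : a (v + w) = a v + a w.
Proof. by rewrite -[v]scale1r al mul1r scale1r. Qed.

Lemma scalar_formN v : a (- v) = - a v.
Proof. by rewrite -scaleN1r scalar_formZ mulN1r. Qed.

Lemma scalar_formB v w : a (v - w) = a v - a w.
Proof. by rewrite scalar_formD scalar_formN. Qed.

Lemma scalar_form_sum n (v : 'I_n -> 'rV[R]_m) : a (\sum_i v i) = \sum_i a (v i).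
Proof. exact: (big_morph _ scalar_formD scalar_form0). Qed.

End ScalarForm.

(** * Cutoff functions and tensors *)

Section Cutoff.
Context {R : realType} {m : nat} {M : charted_space R m}.
Local Notation D c := (cdom (chart_at c)).
Local Notation e c := (ccoord (chart_at c)).
Local Notation g c := (cparam (chart_at c)).
Implicit Types (p q c : M) (f h : M -> R) (v w : 'rV[R]_m) (U V W : vfield M).
Hypothesis hM : manifold M.

(** The image in M of the compact support of a bump function in the chart at p is
    compact, hence closed; so the extension by zero vanishes near every point
    outside the chart domain. *)
Lemma cutoff p : exists b : M -> R,
  [/\ smooth_fun b, b p != 0 & forall q, ~ D p q -> \near q, b q = 0].
Proof.
have Dp := mem_dom hM p.
have nA : nbhs (e p p) (e p @` D p).
  have [_ /(_ p)[_ oi _ _ _] _ _] := hM.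
  by apply: open_nbhs_nbhs; split => //; exists p.
have [b [K [sb bp cK KA bK]]] := bump_space nA.
pose B q := if `[< D p q >] then b (e p q) else 0.
have BE q : D p q -> B q = b (e p q) by move=> Dq; rewrite /B asboolT.
have B0 q : ~ D p q -> \near q, B q = 0.
  move=> nDq.
  have cK' : closed (g p @` K).
    apply: compact_closed; first by case: hM.
    apply: continuous_compact cK; apply: continuous_in_subspaceT => y.
    rewrite inE => /KA[q' Dq' <-]; exact: cont_param.
  have : nbhs q (~` (g p @` K)).
    apply: open_nbhs_nbhs; split; first exact: closed_openC.
    by move=> [y Ky yq]; apply: nDq; have [q' Dq' qy] := KA _ Ky;
       rewrite -yq -qy (chart_coordK hM).
  apply: filterS => q' nK; rewrite /B; case: asboolP => // Dq'.
  apply/eqP; apply: contraT => /bK Kq'; exfalso; apply: nK.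
  by exists (e p q') => //; rewrite (chart_coordK hM).
exists B; split => //; last by rewrite BE.
apply/(smooth_funP hM) => q; have [Dq|nDq] := pselect (D p q).
  apply/(smooth_germ_chart hM _ Dq); apply: smooth_at_near_eq (sb (e p q)).
  by have := near_im hM Dq; apply: filterS => y [Dy ey] /=; rewrite BE// ey.
apply: (smooth_germ_near_eq hM _ (smooth_germ_cst 0 q)).
by have := B0 _ nDq; apply: filterS => y ->.
Qed.

(** Multiplied by a cutoff b, the coordinate fields of the chart at p become the
    global fields E i, a substitute for a frame near p. *)
Lemma chart_frame p : exists (b : M -> R) (E : 'I_m -> vfield M),
  [/\ smooth_fun b, b p != 0,
      (forall q, ~ D p q -> \near q, b q = 0),
      (forall i, smooth_vfield (E i)) &
      (forall q v, D p q ->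
        b q *: v = \sum_i tangent_act q v (xcoord p i) *: E i q)].
Proof.
have [b [sb bp b0]] := cutoff p.
pose E (i : 'I_m) : vfield M := fun q =>
  b q *: \row_k 'D_(delta_mx ord0 i) (xcoord q k \o g p) (e p q).
have EE i q f : D p q -> smooth_germ f q -> tangent_act q (E i q) f = b q * partial p i f q.
  move=> Dq sf; rewrite -[E i q]addr0 (tangent_act_linear hM)// [X in _ + X](_ : _ = 0).
    rewrite addr0; congr (_ * _); rewrite (tangent_act_expand hM)//.
    have -> : partial p i f q = 'D_(delta_mx ord0 i) ((f \o g q) \o (e q \o g p)) (e p q).
      apply: near_eq_derive.
      have := near_param hM Dq (near_dom hM (mem_dom hM q)).
      by apply: filterS => y Dy /=; rewrite (chart_coordK hM).
    rewrite chain_rule/= ?(chart_coordK hM)//; last exact/smooth_at_diff.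
      by apply: eq_bigr => k _; rewrite mxE.
    move=> k; apply/smooth_at_diff; apply: (smooth_germ_chart hM (xcoord q k) Dq).1.
    by apply: (smooth_germ_xcoord hM); exact: mem_dom.
  by rewrite (tangent_act_expand hM)// big1// => k _; rewrite mxE mul0r.
exists b, E; split => //.
- move=> i; apply/(smooth_vfieldP hM) => c j q Dcq.
  have sx := smooth_germ_xcoord hM j Dcq.
  have [Dq|nDq] := pselect (D p q).
    apply: (@smooth_germ_near_eq _ _ _ hM (fun q => b q * partial p i (xcoord c j) q)).
      by apply: filterS2 (near_dom hM Dq) (smooth_germ_near hM sx) => y Dy sy; rewrite /act EE.
    apply: smooth_germM; first exact: (smooth_funP hM _).1.
    exact: smooth_germ_partial.
  apply: (smooth_germ_near_eq hM _ (smooth_germ_cst 0 q)).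
  apply: filterS2 (b0 _ nDq) (smooth_germ_near hM sx) => y by0 sy.
  rewrite /act /E by0 scale0r (tangent_act_expand hM)// big1// => k _.
  by rewrite mxE mul0r.
- move=> q v Dq; apply: (tangentP hM (p := q)) => f sf.
  rewrite -[b q *: v]addr0 (tangent_act_linear hM)// [X in _ + X](_ : _ = 0) ?addr0; last first.
    by rewrite (tangent_act_expand hM)// big1// => k _; rewrite mxE mul0r.
  have -> : tangent_act q (\sum_i tangent_act q v (xcoord p i) *: E i q) f =
    \sum_i tangent_act q v (xcoord p i) * tangent_act q (E i q) f.
    elim/big_rec2: _ => [|k x y _ IH]; last by rewrite (tangent_act_linear hM)// IH.
    by rewrite (tangent_act_expand hM)// big1// => k _; rewrite mxE mul0r.
  rewrite (tangent_act_chart hM _ Dq sf) mulr_sumr; apply: eq_bigr => i _.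
  by rewrite EE// mulrCA.
Qed.

Definition tensorial (X : lmodType R) (p : M) (T : vfield M -> X) : Prop :=
  forall f U V, smooth_fun f -> smooth_vfield U -> smooth_vfield V ->
    T (fun q => f q *: U q + V q) = f p *: T U + T V.

Lemma smooth_cst a : @smooth_fun R m M (fun=> a).
Proof. by apply/(smooth_funP hM) => p; exact: smooth_germ_cst. Qed.

Lemma smooth_funM f h : smooth_fun f -> smooth_fun h -> smooth_fun (fun q => f q * h q).
Proof.
move=> /(smooth_funP hM) sf /(smooth_funP hM) sh; apply/(smooth_funP hM) => p.
exact: smooth_germM.
Qed.

Lemma smooth_funZ_vfield f U :
  smooth_fun f -> smooth_vfield U -> smooth_vfield (fun q => f q *: U q).
Proof.
move=> sf sU; rewrite (_ : (fun _ => _) = (fun q => f q *: U q + 0)).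
  by apply: (smooth_lin hM) => //; exact: smooth_vfield0.
by apply/funext => q; rewrite addr0.
Qed.

Section Tensorial.
Variables (X : lmodType R) (p : M) (T : vfield M -> X).
Hypothesis tT : tensorial p T.

Lemma tensorial0 : T (fun=> 0) = 0.
Proof.
have s0 := smooth_vfield0 hM.
have : T (fun=> 0) = 1 *: T (fun=> 0) + T (fun=> 0).
  rewrite -(tT (smooth_cst 1) s0 s0); congr T; apply/funext => q.
  by rewrite scaler0 addr0.
rewrite scale1r.
by move=> /(congr1 (fun x => x - T (fun=> 0))); rewrite subrr addrK.
Qed.

Lemma tensorialZ f U : smooth_fun f -> smooth_vfield U ->
  T (fun q => f q *: U q) = f p *: T U.
Proof.
move=> sf sU; rewrite (_ : (fun _ => _) = (fun q => f q *: U q + 0)).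
  by rewrite tT ?tensorial0 ?addr0//; exact: smooth_vfield0.
by apply/funext => q; rewrite addr0.
Qed.

Lemma tensorial_sum n (f : 'I_n -> M -> R) (E : 'I_n -> vfield M) :
  (forall i, smooth_fun (f i)) -> (forall i, smooth_vfield (E i)) ->
  smooth_vfield (fun q => \sum_i f i q *: E i q) /\
  T (fun q => \sum_i f i q *: E i q) = \sum_i f i p *: T (E i).
Proof.
elim: n f E => [|n IH] f E sf sE.
  rewrite big_ord0; under eq_fun do rewrite big_ord0.
  by split; [exact: smooth_vfield0|exact: tensorial0].
under eq_fun do rewrite big_ord_recl.
have [sS TS] := IH _ _ (fun i => sf (lift ord0 i)) (fun i => sE (lift ord0 i)).
by split; [exact: (smooth_lin hM)|rewrite tT// TS big_ord_recl].
Qed.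

(** With b and E as in [chart_frame] and U^i the components of U in the chart at
    p, the identity b^2 U = sum_i (b U^i) E_i holds on all of M, its coefficients
    are smooth functions on M, and those on the right vanish at p. *)
Lemma tensorial_eq0 U : smooth_vfield U -> U p = 0 -> T U = 0.
Proof.
move=> sU Up; have [b [E [sb bp b0 sE bE]]] := chart_frame p.
have bU i : smooth_fun (fun q => b q * act U (xcoord p i) q).
  apply/(smooth_funP hM) => q; have [Dq|nDq] := pselect (D p q).
    apply: smooth_germM; first exact: (smooth_funP hM _).1.
    by apply: (smooth_germ_act hM) => //; exact: smooth_germ_xcoord.
  apply: (smooth_germ_near_eq hM _ (smooth_germ_cst 0 q)).
  by apply: filterS (b0 _ nDq) => y ->; rewrite mul0r.
have E1 : (fun q => (b q * b q) *: U q) =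
          (fun q => \sum_i (b q * act U (xcoord p i) q) *: E i q).
  apply/funext => q; have [Dq|nDq] := pselect (D p q).
    by rewrite -scalerA (bE q (U q) Dq) scaler_sumr; apply: eq_bigr => i _; rewrite scalerA.
  rewrite (nbhs_singleton (b0 _ nDq)) mul0r scale0r big1// => i _.
  by rewrite mul0r scale0r.
have := tensorialZ (smooth_funM sb sb) sU.
rewrite E1 (tensorial_sum bU sE).2 big1 => [/eqP|i _].
  by rewrite eq_sym scaler_eq0 mulf_eq0 (negbTE bp)/= => /eqP.
by rewrite (act_xcoord hM) Up mxE mulr0 scale0r.
Qed.

Lemma tensorial_eq U V : smooth_vfield U -> smooth_vfield V -> U p = V p -> T U = T V.
Proof.
move=> sU sV UV; have s1 := smooth_cst (-1).
have sW := smooth_lin hM s1 sV sU.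
have := tensorial_eq0 sW; rewrite UV scaleN1r addNr => /(_ erefl).
by rewrite tT// scaleN1r => /eqP; rewrite addrC subr_eq0 => /eqP.
Qed.

End Tensorial.

Lemma vfield_extension p v : exists2 V : vfield M, smooth_vfield V & V p = v.
Proof.
have [b [E [sb bp b0 sE bE]]] := chart_frame p.
pose c i : M -> R := fun=> (b p)^-1 * v ord0 i.
exists (fun q => \sum_i c i q *: E i q).
  elim: (index_enum _) => [|i s IH].
    by under eq_fun do rewrite big_nil; exact: smooth_vfield0.
  under eq_fun do rewrite big_cons; apply: (smooth_lin hM) => //.
  exact: smooth_cst.
have := bE p v (mem_dom hM p).
move=> /(congr1 (fun x => (b p)^-1 *: x)); rewrite scalerA mulVf// scale1r => ->.
rewrite scaler_sumr; apply: eq_bigr => i _.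
by rewrite (tangent_act_xcoord hM) scalerA.
Qed.

End Cutoff.

(** * Smooth maps and related vector fields *)

Section SmoothMaps.
Context {R : realType} {m k : nat} {N : charted_space R m} {M : charted_space R k}.
Hypotheses (hN : manifold N) (hM : manifold M).
Variable h : N -> M.
Hypothesis sh : smooth_map h.
Local Notation e c := (ccoord (chart_at c)).
Local Notation g c := (cparam (chart_at c)).

Lemma smooth_germ_xcoord_map q i : smooth_germ (xcoord (h q) i \o h) q.
Proof.
have [hc /(_ (h q) i)] := sh.
have oD : open (h @^-1` cdom (chart_at (h q))).
  by apply: open_comp => [x _|]; [exact: hc|have [_ /(_ (h q))[]] := hM].
by move=> /(smooth_onP hN _ oD); apply; exact: mem_dom.
Qed.

Let near_map q : \forall y \near e q q, g (h q) (e (h q) (h (g q y))) = h (g q y).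
Proof.
have [hc _] := sh.
have nD := near_dom hM (mem_dom hM (h q)).
have nh : \forall x \near q, cdom (chart_at (h q)) (h x) by exact: (hc q).
have := near_param hN (mem_dom hN q) nh.
by apply: filterS => y Dy; rewrite (chart_coordK hM).
Qed.

Lemma smooth_germ_comp f q : smooth_germ f (h q) -> smooth_germ (f \o h) q.
Proof.
move=> sf; rewrite /smooth_germ.
apply: (@smooth_at_near_eq _ _ ((f \o g (h q)) \o (e (h q) \o (h \o g q)))).
  by apply: filterS (near_map q) => y /= ->.
apply: smooth_at_comp => [j|]; first exact: smooth_germ_xcoord_map.
by rewrite /= (chart_coordK hN) ?mem_dom//; exact: mem_dom.
Qed.

Lemma smooth_comp f : smooth_fun f -> smooth_fun (f \o h).
Proof.
by move=> /(smooth_funP hM) sf; apply/(smooth_funP hN) => q; exact: smooth_germ_comp.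
Qed.

Lemma tangent_act_map q v f : smooth_germ f (h q) ->
  tangent_act (h q) (tangent_map h q v) f = tangent_act q v (f \o h).
Proof.
move=> sf; rewrite (tangent_act_expand hM)// [RHS]/tangent_act.
rewrite (near_eq_derive v (g := (f \o g (h q)) \o (e (h q) \o (h \o g q)))); last first.
  by apply: filterS (near_map q) => y /= ->.
have eE : (e (h q) \o (h \o g q)) (e q q) = e (h q) (h q).
  by rewrite /= (chart_coordK hN)//; exact: mem_dom.
rewrite chain_rule.
- by rewrite eE; apply: eq_bigr => j _; rewrite mxE.
- by move=> j; apply/smooth_at_diff; exact: smooth_germ_xcoord_map.
- by rewrite eE; exact: smooth_at_diff.
Qed.

Lemma tangent_map_linear q a v w :
  tangent_map h q (a *: v + w) = a *: tangent_map h q v + tangent_map h q w.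
Proof.
apply/rowP => i; rewrite !mxE (tangent_act_linear hN)//; exact: smooth_germ_xcoord_map.
Qed.

Lemma tangent_map0 q : tangent_map h q 0 = 0.
Proof. by apply/rowP => i; rewrite !mxE (tangent_act_zero hN)//; exact: smooth_germ_xcoord_map. Qed.

Definition related (Z : vfield N) (U : vfield M) : Prop :=
  forall q, tangent_map h q (Z q) = U (h q).

Lemma act_related Z U f q : related Z U -> smooth_germ f (h q) ->
  act Z (f \o h) q = act U f (h q).
Proof. by move=> ZU sf; rewrite /act -tangent_act_map// ZU. Qed.

Let act_act_related Z U Z' U' f q : related Z U -> related Z' U' ->
  smooth_vfield U' -> smooth_germ f (h q) ->
  act Z (act Z' (f \o h)) q = act U (act U' f) (h q).
Proof.
move=> ZU ZU' sU' sf; rewrite -(act_related ZU); last exact: (smooth_germ_act hM).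
have [hc _] := sh.
have nf : \near q, smooth_germ f (h q) by exact: (hc q _ (smooth_germ_near hM sf)).
by apply: (act_near_eq hN); apply: filterS nf => y sy; exact: act_related.
Qed.

(** Both sides act on a function f on M as commutators: the left one on the
    composite of f with h, the right one on f. *)
Lemma bracket_related Z U Z' U' : smooth_vfield Z -> smooth_vfield U ->
  smooth_vfield Z' -> smooth_vfield U' -> related Z U -> related Z' U' ->
  related (bracket Z Z') (bracket U U').
Proof.
move=> sZ sU sZ' sU' ZU ZU' q; apply: (tangentP hM (p := h q)) => f sf.
rewrite tangent_act_map//.
apply: etrans (act_bracket hN sZ sZ' (smooth_germ_comp sf)) _.
apply: etrans _ (esym (act_bracket hM sU sU' sf)).
exact: (congr2 (fun a b : R => a - b) (act_act_related ZU ZU' sU' sf)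
                                     (act_act_related ZU' ZU sU sf)).
Qed.

(** W need not be related to a field on M, so the frame of [chart_frame] is used:
    near a given point, b times the pullback evaluated at W is the sum of the
    W(x^i \o h) a(E_i), and b does not vanish. *)
Lemma smooth_pullback1 (a : forall p : M, 'rV[R]_k -> R) (W : vfield N) :
  smooth_1form a -> smooth_vfield W ->
  smooth_fun (fun q => a (h q) (tangent_map h q (W q))).
Proof.
move=> [al as_] sW; apply/(smooth_funP hN) => q0.
have [b [E [sb bp b0 sE bE]]] := chart_frame hM (h q0).
have [hc _] := sh.
apply: (@smooth_germ_near_eq _ _ _ hN (fun q => ((b \o h) q)^-1 *
  \sum_i act W (xcoord (h q0) i \o h) q * ((fun p => a p (E i p)) \o h) q)).
  have nD : \forall q \near q0, cdom (chart_at (h q0)) (h q).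
    exact: (hc q0 _ (near_dom hM (mem_dom hM (h q0)))).
  have nb : \forall q \near q0, b (h q) != 0.
    exact: (hc q0 _ (smooth_germ_neq0 hM ((smooth_funP hM _).1 sb _) bp)).
  near=> q.
  have Dq : cdom (chart_at (h q0)) (h q) by exact: (near nD q).
  have bq : b (h q) != 0 by exact: (near nb q).
  apply: (mulfI bq); rewrite /= mulrA mulfV// mul1r.
  rewrite -(scalar_formZ (al (h q))) bE// (scalar_form_sum (al (h q))).
  apply: eq_bigr => i _; rewrite (scalar_formZ (al (h q))); congr (_ * _).
  by rewrite tangent_act_map//; exact: smooth_germ_xcoord.
have sbh := smooth_comp sb.
apply: smooth_germM; first by apply: (smooth_germ_inv hN) => //; exact: (smooth_funP hN _).1.
apply: smooth_germ_sum => i; apply: smooth_germM.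
  by apply: (smooth_germ_act hN) => //; exact: smooth_germ_xcoord_map.
by apply: smooth_germ_comp; apply: (smooth_funP hM _).1; exact: as_.
Unshelve. all: by end_near. Qed.

End SmoothMaps.

(** * Exterior derivative of a one-form *)

Section OneForms.
Context {R : realType} {m : nat} {M : charted_space R m}.
Hypothesis hM : manifold M.
Variable a : forall p : M, 'rV[R]_m -> R.
Hypothesis sa : smooth_1form a.
Implicit Types (U V W : vfield M) (f : M -> R) (p : M).

Lemma smooth_germ_1form U p : smooth_vfield U -> smooth_germ (fun q => a q (U q)) p.
Proof. by move=> sU; apply: (smooth_funP hM _).1; exact: sa.2. Qed.

Lemma d1C U V p : d1 a U V p = - d1 a V U p.
Proof.
rewrite /d1 (bracketC U) (scalar_formN (sa.1 p)).
by move: (act _ _ p) (act _ _ p) (a _ _) => x y z; rewrite !opprB opprK addrC addrA.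
Qed.

Let ring_aux (f x1 x2 y1 y2 u vf b1 b2 : R) :
  (f * x1 + x2) - ((vf * u + f * y1) + y2) - (f * b1 + b2 - vf * u) =
  f * (x1 - y1 - b1) + (x2 - y2 - b2).
Proof. by ring. Qed.

(** The term V(f) a(U) coming from V(a(f U)) is cancelled by the one in the bracket of
    f U with V. *)
Lemma d1_lin f U U' V p : smooth_fun f ->
  smooth_vfield U -> smooth_vfield U' -> smooth_vfield V ->
  d1 a (fun q => f q *: U q + U' q) V p = f p * d1 a U V p + d1 a U' V p.
Proof.
move=> sf sU sU' sV.
have E1 : act (fun q => f q *: U q + U' q) (fun q => a q (V q)) p =
  f p * act U (fun q => a q (V q)) p + act U' (fun q => a q (V q)) p.
  by apply: act_lin => //; exact: smooth_germ_1form.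
have sf' := (smooth_funP hM _).1 sf p.
have sUa := smooth_germ_1form p sU; have sUa' := smooth_germ_1form p sU'.
have E2 : act V (fun q => a q (f q *: U q + U' q)) p =
  (act V f p * a p (U p) + f p * act V (fun q => a q (U q)) p) + act V (fun q => a q (U' q)) p.
  rewrite -(actM hM V sf' sUa) -(actD V (smooth_germM sf' sUa) sUa').
  by apply: (act_near_eq hM); near=> q; rewrite sa.1.
have E3 : a p (bracket (fun q => f q *: U q + U' q) V p) =
  f p * a p (bracket U V p) + a p (bracket U' V p) - act V f p * a p (U p).
  rewrite (bracket_lin hM sf sU sU' sV) (scalar_formB (sa.1 p)).
  by rewrite (scalar_formD (sa.1 p)) !(scalar_formZ (sa.1 p)).
rewrite /d1.
apply: etrans (congr2 (fun x y : R => x - y) (congr2 (fun x y : R => x - y) E1 E2) E3) _.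
exact: ring_aux.
Unshelve. all: by end_near. Qed.

Lemma smooth_d1 U V : smooth_vfield U -> smooth_vfield V -> smooth_fun (d1 a U V).
Proof.
move=> sU sV; apply/(smooth_funP hM) => p.
apply: smooth_germB; last by apply: smooth_germ_1form; exact: smooth_bracket.
by apply: smooth_germB; apply: (smooth_germ_act hM) => //; exact: smooth_germ_1form.
Qed.

End OneForms.

(** * The cylinder and its exact two-form *)

Section Exp.
Context {R : realType} {m : nat} {M : charted_space R m}.
Hypothesis hM : manifold M.

Lemma tangent_act_exp p v (f : M -> R) : smooth_germ f p ->
  tangent_act p v (fun q => expR (f q)) = expR (f p) * tangent_act p v f.
Proof.
move=> /smooth_at_diff df; rewrite /tangent_act.
set F := f \o _ in df *; set x := ccoord _ _ in df *.
have Fx : F x = f p by rewrite /F /x /= (chart_coordK hM)//; exact: mem_dom.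
have de : differentiable expR (F x) by apply/derivable1_diffP; exact: derivable_expR.
rewrite -[fun q => _]/(expR \o f) -[_ \o cparam _]/(expR \o F).
rewrite (deriveE v (differentiable_comp df de)) diff_comp//= (deriveE v df).
rewrite (diff1E de) derive1E (congr1 (@^~ (F x)) (derive_expR R)) /GRing.scale/= Fx.
by rewrite mulrC.
Qed.

End Exp.

Section Cylinder.
Context {R : realType} {m : nat} {N : charted_space R m}.
Hypothesis hN : manifold N.
Local Notation P := (cylinder N).
Local Notation D c := (cdom (chart_at c)).
Local Notation e c := (ccoord (chart_at c)).
Local Notation g c := (cparam (chart_at c)).

Let lsubmx_cont : continuous (lsubmx : 'rV[R]_(m + 1) -> 'rV[R]_m).
Proof. by move=> x; exact/differentiable_continuous/differentiable_lsubmx. Qed.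

Let row_cvg (T : topologicalType) l (F : T -> 'rV[R]_l) q :
  (forall j, {for q, continuous (fun x => F x ord0 j)}) -> {for q, continuous F}.
Proof.
move=> cF; apply/cvg_ballP => /= eps e0.
have H j : \forall x \near q, ball (F q ord0 j) eps (F x ord0 j).
  by have /cvg_ballP/(_ _ e0) := cF j.
have := near_forall H; apply: filterS => x Hx; split => // i j.
by rewrite (ord1 i); exact: Hx.
Qed.

Let xcoordl (c : P) i : xcoord c (lshift 1 i) = xcoord (p1 c) i \o @p1 R m N.
Proof. by apply/funext => q; rewrite /xcoord /= row_mxEl. Qed.

Let xcoordr (c : P) : xcoord c (rshift m ord0) = @scoord R m N.
Proof. by apply/funext => q; rewrite /xcoord /= row_mxEr mxE. Qed.

Let image_chart (c : P) : (e c @` D c) = [set x | (e (p1 c) @` D (p1 c)) (lsubmx x)].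
Proof.
apply/seteqP; split=> x /=.
  by move=> [q [Dq _] <-]; exists q.1 => //=; rewrite row_mxKl.
move=> [y Dy yx]; exists (y, rsubmx x ord0 ord0) => //=.
rewrite yx -[RHS]hsubmxK; congr row_mx; apply/rowP => i.
by rewrite (ord1 i) !mxE.
Qed.

Lemma cylinder_manifold : manifold P.
Proof.
have [hH hC hm hS] := hN.
have oD (c : P) : open (D c).
  rewrite openE => -[y s] [/= Dy _].
  exists (D (p1 c), setT) => /=; last by move=> [y' s'] /= [].
  by split; [exact: near_dom|exact: filterT].
have cc (c : P) q : D c q -> {for q, continuous (e c)}.
  move=> [Dq _]; apply: row_cvg => j; case: (split_ordP j) => i ->.
    rewrite (_ : (fun _ => _) = (fun y : 'rV[R]_m => y ord0 i) \o (e (p1 c) \o fst)); last first.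
      by apply/funext => y; rewrite /= row_mxEl.
    apply: continuous_comp; last exact: coord_continuous.
    by apply: continuous_comp; [exact: cvg_fst|exact: cont_coord].
  rewrite (_ : (fun _ => _) = snd); first exact: cvg_snd.
  by apply/funext => y; rewrite /= row_mxEr mxE.
have oi (c : P) : open (e c @` D c).
  rewrite image_chart.
  apply: (open_comp (f := lsubmx : 'rV[R]_(m + 1) -> 'rV[R]_m)) => [x _|]; first exact: lsubmx_cont.
  by have [] := hC (p1 c).
have cp (c : P) x : (e c @` D c) x -> {for x, continuous (g c)}.
  rewrite image_chart /= => im.
  have c1 : {for x, continuous (g (p1 c) \o (lsubmx : 'rV[R]_(m + 1) -> 'rV[R]_m))}.
    apply: continuous_comp; first exact: lsubmx_cont.
    by have [_ _ _ _ H] := hC (p1 c); exact: H.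
  have c2 : {for x, continuous ((fun y : 'rV[R]_1 => y ord0 ord0) \o
                                (rsubmx : 'rV[R]_(m + 1) -> 'rV[R]_1))}.
    apply: continuous_comp; last exact: coord_continuous.
    exact/differentiable_continuous/differentiable_rsubmx.
  exact: (cvg_pair c1 c2).
split=> //.
- move=> -[y s] -[y' s'] cl; congr (_, _).
    apply: hH => A B nA nB.
    have [||[a b] [[Aa _] [Ba _]]] := cl (A `*` setT) (B `*` setT); last by exists a.
      by exists (A, setT) => //; split => //; exact: filterT.
    by exists (B, setT) => //; split => //; exact: filterT.
  apply: (@Rhausdorff R) => A B nA nB.
  have [||[a b] [[_ Aa] [_ Ba]]] := cl (setT `*` A) (setT `*` B); last by exists b.
    by exists (setT, A) => //; split => //; exact: filterT.
  by exists (setT, B) => //; split => //; exact: filterT.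
- move=> c; split; [exact: oD|exact: oi| |exact: cc|exact: cp].
  by move=> [y s] [Dy _] /=; rewrite row_mxKl row_mxKr mxE chart_coordK.
move=> c i c' kk.
have oW : open [set x | (e c' @` D c') x /\ D c (g c' x)].
  rewrite openE => x [im Dx].
  have n1 : nbhs x (e c' @` D c') by apply: open_nbhs_nbhs; split => //; exact: oi.
  have n2 : nbhs (g c' x) (D c) by apply: open_nbhs_nbhs; split => //; exact: oD.
  by have n3 := cp _ _ im _ n2; apply: filterI.
move: kk; apply/(smooth_atP _ oW) => x [im Dx].
case: (split_ordP i) => j -> /=.
  rewrite xcoordl; apply: (@smooth_at_comp _ _ _ lsubmx (xcoord (p1 c) j \o g (p1 c'))).
    move=> l; rewrite (_ : (fun _ => _) = (fun y : 'rV[R]_(m + 1) => y ord0 (lshift 1 l))).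
      exact: smooth_at_coord.
    by apply/funext => y; rewrite mxE.
  move: im; rewrite image_chart /= => -[y Dy yx].
  rewrite -yx; move: Dx => [/= Dx _]; rewrite -yx chart_coordK// in Dx.
  exact/(smooth_germ_chart hN _ Dy)/smooth_germ_xcoord.
rewrite (ord1 j) xcoordr.
rewrite (_ : _ \o _ = (fun y : 'rV[R]_(m + 1) => y ord0 (rshift m ord0))).
  exact: smooth_at_coord.
by apply/funext => y; rewrite /= mxE.
Qed.

Let hP := cylinder_manifold.

Lemma smooth_germ_scoord q : smooth_germ (@scoord R m N) q.
Proof.
by rewrite -(xcoordr q); apply: (smooth_germ_xcoord hP); exact: mem_dom.
Qed.

Lemma smooth_map_p1 : smooth_map (@p1 R m N).
Proof.
split=> [q|c i]; first exact: cvg_fst.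
have oD : open (@p1 R m N @^-1` D c).
  apply: open_comp => [x _|]; first exact: cvg_fst.
  by have [_ /(_ c)[]] := hN.
apply/(smooth_onP hP _ oD) => q Dq.
by rewrite -(xcoordl (c, 0)); apply: (smooth_germ_xcoord hP); split.
Qed.

Lemma tangent_map_p1 q v : tangent_map (@p1 R m N) q v = lsubmx v.
Proof. by apply/rowP => i; rewrite !mxE -xcoordl (tangent_act_xcoord hP). Qed.

Lemma tangent_act_scoord q v : tangent_act q v (@scoord R m N) = v ord0 (rshift m ord0).
Proof. by rewrite -(xcoordr q) (tangent_act_xcoord hP). Qed.

(** Brackets on the cylinder are computed from this: the projection to N is
    governed by relatedness, the last component by the action on s. *)
Lemma cylinder_tangentP (v w : 'rV[R]_(m + 1)) :
  lsubmx v = lsubmx w -> v ord0 (rshift m ord0) = w ord0 (rshift m ord0) -> v = w.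
Proof.
move=> vw1 vw2; rewrite -[v]hsubmxK -[w]hsubmxK vw1; congr row_mx.
by apply/rowP => i; rewrite (ord1 i) !mxE.
Qed.

Lemma related_slice (Z : vfield N) : related (@p1 R m N) (slice_ext Z) Z.
Proof. by move=> q; rewrite tangent_map_p1 row_mxKl. Qed.

Lemma related_dds : related (@p1 R m N) (dds N) (fun=> 0).
Proof. by move=> q; rewrite tangent_map_p1 row_mxKl. Qed.

Lemma act_slice_scoord (Z : vfield N) : act (slice_ext Z) (@scoord R m N) = fun=> 0.
Proof. by apply/funext => q; rewrite /act tangent_act_scoord row_mxEr mxE. Qed.

Lemma act_dds_scoord : act (dds N) (@scoord R m N) = fun=> 1.
Proof. by apply/funext => q; rewrite /act tangent_act_scoord row_mxEr mxE. Qed.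

Lemma act_slice (Z : vfield N) (f : N -> R) q : smooth_germ f (p1 q) ->
  act (slice_ext Z) (f \o @p1 R m N) q = act Z f (p1 q).
Proof. exact: (act_related hP hN smooth_map_p1 (related_slice Z)). Qed.

Lemma act_dds (f : N -> R) q : smooth_germ f (p1 q) -> act (dds N) (f \o @p1 R m N) q = 0.
Proof.
move=> sf; rewrite (act_related hP hN smooth_map_p1 related_dds)//.
by rewrite /act (tangent_act_expand hN)// big1// => i _; rewrite mxE mul0r.
Qed.

(** The coordinates of the cylinder are those of N, on which Z acts as V, and s. *)
Lemma smooth_cylinder (Z : vfield P) (V : vfield N) (s : R) :
  related (@p1 R m N) Z V -> smooth_vfield V ->
  act Z (@scoord R m N) = (fun=> s) -> smooth_vfield Z.
Proof.
move=> ZV sV Zs; apply/(smooth_vfieldP hP) => c i q [Dq _].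
case: (split_ordP i) => j -> /=; last first.
  by rewrite (ord1 j) xcoordr Zs; exact: smooth_germ_cst.
have sx := smooth_germ_xcoord hN j Dq.
apply: (@smooth_germ_near_eq _ _ _ hP (act V (xcoord (p1 c) j) \o @p1 R m N)).
  have [hc _] := smooth_map_p1.
  have n1 : \forall x \near q, smooth_germ (xcoord (p1 c) j) (p1 x).
    exact: (hc q _ (smooth_germ_near hN sx)).
  apply: filterS n1 => x s1; rewrite xcoordl.
  exact/esym/(act_related hP hN smooth_map_p1 ZV).
by apply: (smooth_germ_comp hP hN smooth_map_p1); exact: smooth_germ_act.
Qed.

Lemma smooth_slice (Z : vfield N) : smooth_vfield Z -> smooth_vfield (slice_ext Z).
Proof.
move=> sZ; exact: smooth_cylinder (related_slice Z) sZ (act_slice_scoord Z).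
Qed.

Lemma smooth_dds : smooth_vfield (dds N).
Proof.
exact: smooth_cylinder related_dds (smooth_vfield0 hN) act_dds_scoord.
Qed.

Let bracket_scoord (Z Z' : vfield P) s s' q : smooth_vfield Z -> smooth_vfield Z' ->
  act Z (@scoord R m N) = (fun=> s) -> act Z' (@scoord R m N) = (fun=> s') ->
  bracket Z Z' q ord0 (rshift m ord0) = 0.
Proof.
move=> sZ sZ' Zs Z's; rewrite -(tangent_act_scoord q).
apply: etrans (act_bracket hP sZ sZ' (smooth_germ_scoord q)) _.
by rewrite Zs Z's !act_cst subrr.
Qed.

Lemma bracket_slice (Z Z' : vfield N) q : smooth_vfield Z -> smooth_vfield Z' ->
  bracket (slice_ext Z) (slice_ext Z') q = slice_ext (bracket Z Z') q.
Proof.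
move=> sZ sZ'; have sS := smooth_slice sZ; have sS' := smooth_slice sZ'.
apply: cylinder_tangentP.
  rewrite -(tangent_map_p1 q) [RHS]row_mxKl.
  exact: (bracket_related hP hN smooth_map_p1 sS sZ sS' sZ' (related_slice Z) (related_slice Z')).
rewrite [RHS]row_mxEr [RHS]mxE.
exact: bracket_scoord sS sS' (act_slice_scoord Z) (act_slice_scoord Z').
Qed.

Lemma bracket_dds (Z : vfield N) q : smooth_vfield Z ->
  bracket (dds N) (slice_ext Z) q = 0.
Proof.
move=> sZ; have sS := smooth_slice sZ; have sD := smooth_dds.
apply: cylinder_tangentP.
  rewrite -(tangent_map_p1 q).
  apply: etrans (bracket_related hP hN smooth_map_p1 sD (smooth_vfield0 hN) sS sZ
    related_dds (related_slice Z) q) _.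
  rewrite (bracket_zero hN _ sZ); apply/rowP => i; by rewrite !mxE.
rewrite [RHS]mxE.
exact: bracket_scoord sD sS act_dds_scoord (act_slice_scoord Z).
Qed.

End Cylinder.

Section ExpForm.
Context {R : realType} {m : nat} {N : charted_space R m}.
Hypothesis hN : manifold N.
Local Notation P := (cylinder N).
Variable alpha : forall x : N, 'rV[R]_m -> R.
Hypothesis sa : smooth_1form alpha.
Local Notation theta := (exp_form alpha).
Let hP : manifold P := cylinder_manifold hN.

Definition exp2s (q : P) : R := expR (2 * scoord q).

Lemma smooth_germ_exp2s q : smooth_germ exp2s q.
Proof.
by apply: smooth_germ_exp; apply: smooth_germM; [exact: smooth_germ_cst|exact: smooth_germ_scoord].
Qed.

Let tangent_act_exp2s q v : tangent_act q v exp2s = exp2s q * (2 * v ord0 (rshift m ord0)).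
Proof.
have ss := smooth_germ_scoord hN q.
rewrite (tangent_act_exp hP) ?(tangent_actZ hP)// ?(tangent_act_scoord hN)//.
by apply: smooth_germM => //; exact: smooth_germ_cst.
Qed.

Lemma act_slice_exp2s (Z : vfield N) q : act (slice_ext Z) exp2s q = 0.
Proof. by apply: etrans (tangent_act_exp2s q _) _; rewrite row_mxEr mxE !mulr0. Qed.

Lemma act_dds_exp2s q : act (dds N) exp2s q = 2 * exp2s q.
Proof. by apply: etrans (tangent_act_exp2s q _) _; rewrite row_mxEr mxE mulr1 mulrC. Qed.

Lemma exp_formE q v : theta q v = exp2s q * alpha (p1 q) (lsubmx v).
Proof. by rewrite /exp_form (tangent_map_p1 hN). Qed.

Lemma smooth_exp_form : smooth_1form theta.
Proof.
split=> [q a v w|U sU].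
  by rewrite !exp_formE linearP/= sa.1; ring.
apply/(smooth_funP hP) => q; apply: smooth_germM; first exact: smooth_germ_exp2s.
apply: (smooth_funP hP _).1.
exact: (smooth_pullback1 hP hN (smooth_map_p1 hN) sa sU).
Qed.

Let theta_slice (Z : vfield N) :
  (fun q => theta q (slice_ext Z q)) =
  (fun q => exp2s q * ((fun x => alpha x (Z x)) \o @p1 R m N) q).
Proof. by apply/funext => q; rewrite exp_formE row_mxKl. Qed.

Let theta_dds : (fun q => theta q (dds N q)) = (fun=> 0).
Proof.
by apply/funext => q; rewrite exp_formE row_mxKl (scalar_form0 (sa.1 _)) mulr0.
Qed.

Let act_slice_theta (Z Z' : vfield N) q : smooth_vfield Z' ->
  act (slice_ext Z) (fun q => theta q (slice_ext Z' q)) q =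
  exp2s q * act Z (fun x => alpha x (Z' x)) (p1 q).
Proof.
move=> sZ'; have sx := smooth_germ_1form hN sa (p1 q) sZ'.
rewrite theta_slice.
apply: etrans (actM hP _ (smooth_germ_exp2s q) (smooth_germ_comp hP hN (smooth_map_p1 hN) sx)) _.
by rewrite act_slice_exp2s mul0r add0r; congr (_ * _); exact: act_slice.
Qed.

Let aux (x a b c : R) : x * a - x * b - x * c = x * (a - b - c).
Proof. by ring. Qed.

(** This and [d1_exp_dds] are the two parts of
    d(e^(2s) alpha) = e^(2s) (d(alpha) + 2 ds /\ alpha). *)
Lemma d1_exp_slice (Z Z' : vfield N) q : smooth_vfield Z -> smooth_vfield Z' ->
  d1 theta (slice_ext Z) (slice_ext Z') q = exp2s q * d1 alpha Z Z' (p1 q).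
Proof.
move=> sZ sZ'; rewrite /d1.
have E3 : theta q (bracket (slice_ext Z) (slice_ext Z') q) =
    exp2s q * alpha (p1 q) (bracket Z Z' (p1 q)).
  by rewrite (bracket_slice hN q sZ sZ') exp_formE row_mxKl.
apply: etrans (congr2 (fun x y : R => x - y) (congr2 (fun x y : R => x - y)
  (act_slice_theta Z q sZ') (act_slice_theta Z' q sZ)) E3) _.
exact: aux.
Qed.

Lemma d1_exp_dds (Z : vfield N) q : smooth_vfield Z ->
  d1 theta (dds N) (slice_ext Z) q = 2 * exp2s q * alpha (p1 q) (Z (p1 q)).
Proof.
move=> sZ; rewrite /d1.
have sx := smooth_germ_1form hN sa (p1 q) sZ.
have E1 : act (dds N) (fun q => theta q (slice_ext Z q)) q =
    2 * exp2s q * alpha (p1 q) (Z (p1 q)).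
  rewrite theta_slice.
  apply: etrans (actM hP _ (smooth_germ_exp2s q) (smooth_germ_comp hP hN (smooth_map_p1 hN) sx)) _.
  by rewrite act_dds_exp2s (act_dds hN sx) mulr0 addr0.
have E2 : act (slice_ext Z) (fun q => theta q (dds N q)) q = 0.
  by rewrite theta_dds; exact: act_cst.
have E3 : theta q (bracket (dds N) (slice_ext Z) q) = 0.
  by rewrite (bracket_dds hN q sZ) (scalar_form0 (smooth_exp_form.1 q)).
apply: etrans (congr2 (fun x y : R => x - y) (congr2 (fun x y : R => x - y) E1 E2) E3) _.
by rewrite !subr0.
Qed.

End ExpForm.

(** * Submersions with one-dimensional fibres *)

Section Kernel.
Context {F : fieldType} {k : nat}.
Variables (L : 'rV[F]_k.+1 -> 'rV[F]_k) (a : 'rV[F]_k.+1 -> F) (x : 'rV[F]_k.+1).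
Hypotheses (L_lin : linear L) (a_lin : scalar a).
Hypothesis L_surj : forall y, exists v, L v = y.
Hypotheses (Lx : L x = 0) (ax : a x = 1).

(** L has rank k on a space of dimension k + 1, so its kernel is the line spanned
    by x, on which a is injective. *)
Lemma kernel_line v : L v = 0 -> a v = 0 -> v = 0.
Proof.
pose Lm := GRing.isLinear.Build _ _ _ _ L L_lin.
pose L' : {linear 'rV[F]_k.+1 -> 'rV[F]_k} := HB.pack L Lm.
pose am := GRing.isLinear.Build _ _ _ _ a a_lin.
pose a' : {scalar 'rV[F]_k.+1} := HB.pack a am.
pose A := lin1_mx L'.
have AE y : y *m A = L y by rewrite mul_rV_lin1.
have a0 : a 0 = 0 by exact: (linear0 a').
have rA : \rank A = k.
  apply/eqP; rewrite eqn_leq rank_leq_col /=.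
  have : (1%:M <= A)%MS.
    apply/row_subP => i; have [y <-] := L_surj (row i 1%:M).
    by rewrite -AE submxMl.
  by move=> /mxrankS; rewrite mxrank1.
have rK : \rank (kermx A) = 1%N by rewrite mxrank_ker rA subSnn.
have x0 : x != 0.
  by apply/eqP => x0; move: ax; rewrite x0 a0 => /eqP; rewrite eq_sym oner_eq0.
have xK : (x <= kermx A)%MS by apply/sub_kermxP; rewrite AE.
have Kx : (kermx A <= x)%MS.
  by rewrite -(mxrank_leqif_sup xK).2 rK rank_rV x0.
move=> Lv av; have : (v <= x)%MS.
  by apply: submx_trans Kx; apply/sub_kermxP; rewrite AE.
move=> /sub_rVP[c vc]; move: av; rewrite vc.
have -> : a (c *: x) = c * a x.
  by have := a_lin c x 0; rewrite addr0 a0 addr0.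
by rewrite ax mulr1 => ->; rewrite scale0r.
Qed.

End Kernel.

(** * Pointwise identities behind flatness and parallelism *)

(** In this section w is the symplectic form at a point, c and j stand for
    1 / (2(n+1)) and 2n+1, and a triple (A, p, s) for the tangent vector of the
    cylinder with horizontal part A, Reeb component p and s-component s.  Covariant
    derivatives enter as independent variables, so that the curvature of the
    cylinder becomes an identity of linear algebra. *)
Section Algebra.
Context {R : realType} {d : nat}.
Local Notation V := 'rV[R]_d.
Variables (w : V -> V -> R) (rho : V -> V) (c j : R) (u : V) (f : R).
Hypotheses (wl : forall x, scalar (w x)) (wr : forall y, scalar (w^~ y)).
Hypothesis wC : forall x y, w x y = - w y x.
Hypothesis rho_lin : linear rho.
Hypothesis ws : forall x y, w x (rho y) = w y (rho x).
Hypothesis j0 : j != 0.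
Local Notation k := (c / j).

Definition conn_gamma A p B q : R :=
  c * w A (rho B) - k * p * w u B - k * q * w u A + k * f * p * q.
(** The components of nabla1 of (B, q, t) along (A, p, s).  The argument D is the
    derivative along A of the component in question: nabla_A B, A(q) and A(t)
    respectively. *)
Definition conn_hor D A p s B q t : V :=
  D - (c * q) *: rho A - (c * p) *: rho B - (k * p * q) *: u + s *: B + t *: A.
Definition conn_alpha D A p s B q t : R := D - w A B + s * q + t * p.
Definition conn_s D A p s B q t : R := D + conn_gamma A p B q + s * t.

(** [drho] is nabla_A (rho B) with D = nabla_A B, and [du] is nabla_A u. *)
Definition drho A B D : V := rho D - j^-1 *: (w u B *: A + w A B *: u).
Definition du A : V := - (c * j) *: rho (rho A) + f *: A.
(** The derivative along some vector field of [conn_hor] with constant p, s, q, t: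
    its arguments D, A, B, DAA, DAB and DDu are the derivatives of the D, A, B, rho A,
    rho B and u of [conn_hor]. *)
Definition dconn_hor D A p s B q t DAA DAB DDu : V :=
  D - (c * q) *: DAA - (c * p) *: DAB - (k * p * q) *: DDu + s *: B + t *: A.

Let wDl x y z : w (x + y) z = w x z + w y z. Proof. exact: (scalar_formD (wr z)). Qed.
Let wDr x y z : w z (x + y) = w z x + w z y. Proof. exact: (scalar_formD (wl z)). Qed.
Let wNl x z : w (- x) z = - w x z. Proof. exact: (scalar_formN (wr z)). Qed.
Let wNr x z : w z (- x) = - w z x. Proof. exact: (scalar_formN (wl z)). Qed.
Let wZl a x z : w (a *: x) z = a * w x z. Proof. exact: (scalar_formZ (wr z)). Qed.
Let wZr a x z : w z (a *: x) = a * w z x. Proof. exact: (scalar_formZ (wl z)). Qed.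
Let rho0 : rho 0 = 0.
Proof.
have := rho_lin 1 0 0; rewrite scaler0 addr0 scale1r => /(congr1 (fun x => x - rho 0)).
by rewrite subrr addrK.
Qed.
Let rZ a x : rho (a *: x) = a *: rho x.
Proof. by have := rho_lin a x 0; rewrite !addr0 rho0 addr0. Qed.
Let rD x y : rho (x + y) = rho x + rho y.
Proof. by have := rho_lin 1 x y; rewrite !scale1r. Qed.
Let rN x : rho (- x) = - rho x.
Proof. by rewrite -scaleN1r rZ scaleN1r. Qed.
Let wrl x y : w (rho x) y = - w x (rho y).
Proof. by rewrite wC ws. Qed.
Let ws2 x y : w x (rho (rho y)) = - w y (rho (rho x)).
Proof. by rewrite ws wrl. Qed.
Let ws3 x y : w x (rho (rho (rho y))) = w y (rho (rho (rho x))).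
Proof. by rewrite ws2 wrl ws2 wrl opprK -wrl -wrl. Qed.

Let wxx x : w x x = 0.
Proof.
by have /eqP := wC x x; rewrite -addr_eq0 -mulr2n mulrn_eq0/= => /eqP.
Qed.
Let wxx2 x : w x (rho (rho x)) = 0.
Proof.
by have /eqP := ws2 x x; rewrite -addr_eq0 -mulr2n mulrn_eq0/= => /eqP.
Qed.

Let lin := (wDl, wDr, wNl, wNr, wZl, wZr, rD, rN, rZ).

(* w x (rho^k y) is skew in x and y for even k and symmetric for odd k; fixing one
   order for each pair gives [field] a normal form. *)
Ltac orient x y :=
  rewrite ?(wC y x) ?(ws y x) ?(ws2 y x) ?(ws3 y x).

(** The variable dik stands for nabla_(A_i) A_k, eikl for
    nabla_(A_i) (nabla_(A_k) A_l) and eb for nabla_[A1, A2] A3.  The hypothesis is the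
    Ricci-type formula for R(A1, A2)A3; the other terms of the curvature of the
    cylinder, including those from the Reeb component - 2 w A1 A2 of the bracket, add
    up to its opposite. *)
Lemma curvature_hor A1 A2 A3 d12 d21 d13 d23 e123 e213 eb t p1 p2 p3 s1 s2 s3 :
  w (e123 - e213 - eb) t = - c *
    (2 * w A1 A2 * w A3 (rho t) + w A1 A3 * w A2 (rho t) + w A1 t * w A2 (rho A3)
     - w A2 A3 * w A1 (rho t) - w A2 t * w A1 (rho A3)) ->
  let B23 := conn_hor d23 A2 p2 s2 A3 p3 s3 in
  let B13 := conn_hor d13 A1 p1 s1 A3 p3 s3 in
  let a23 := conn_alpha 0 A2 p2 s2 A3 p3 s3 in
  let a13 := conn_alpha 0 A1 p1 s1 A3 p3 s3 in
  let s23 := conn_s 0 A2 p2 s2 A3 p3 s3 in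
  let s13 := conn_s 0 A1 p1 s1 A3 p3 s3 in
  let D1 := dconn_hor e123 d12 p2 s2 d13 p3 s3 (drho A1 A2 d12) (drho A1 A3 d13) (du A1) in
  let D2 := dconn_hor e213 d21 p1 s1 d23 p3 s3 (drho A2 A1 d21) (drho A2 A3 d23) (du A2) in
  w (conn_hor D1 A1 p1 s1 B23 a23 s23 - conn_hor D2 A2 p2 s2 B13 a13 s13
     - conn_hor eb (d12 - d21) (- 2 * w A1 A2) 0 A3 p3 s3) t = 0.
Proof.
rewrite !lin => H.
have {}H : w e123 t = w e213 t + w eb t + - c *
    (2 * w A1 A2 * w A3 (rho t) + w A1 A3 * w A2 (rho t) + w A1 t * w A2 (rho A3)
     - w A2 A3 * w A1 (rho t) - w A2 t * w A1 (rho A3)).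
  by rewrite -H; ring.
rewrite /= /conn_hor /dconn_hor /conn_alpha /conn_s /conn_gamma /drho /du.
rewrite !lin ?wrl H.
orient A1 A2; orient A1 A3; orient A2 A3; orient A1 u; orient A2 u; orient A3 u.
by rewrite ?(wxx, wxx2); field.
Qed.

Lemma curvature_al A1 A2 A3 d12 d21 d13 d23 p1 p2 p3 s1 s2 s3 :
  let B23 := conn_hor d23 A2 p2 s2 A3 p3 s3 in
  let B13 := conn_hor d13 A1 p1 s1 A3 p3 s3 in
  let a23 := conn_alpha 0 A2 p2 s2 A3 p3 s3 in
  let a13 := conn_alpha 0 A1 p1 s1 A3 p3 s3 in
  let s23 := conn_s 0 A2 p2 s2 A3 p3 s3 in
  let s13 := conn_s 0 A1 p1 s1 A3 p3 s3 in
  conn_alpha (- (w d12 A3 + w A2 d13)) A1 p1 s1 B23 a23 s23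
  - conn_alpha (- (w d21 A3 + w A1 d23)) A2 p2 s2 B13 a13 s13
  - conn_alpha 0 (d12 - d21) (- 2 * w A1 A2) 0 A3 p3 s3 = 0.
Proof.
rewrite /= /conn_hor /conn_alpha /conn_s /conn_gamma !lin ?wrl.
orient A1 A2; orient A1 A3; orient A2 A3; orient A1 u; orient A2 u; orient A3 u.
by rewrite ?(wxx, wxx2); field.
Qed.

(** The derivative of [conn_s] with constant coefficients; dA3, dU and df are the
    derivatives of rho A3, u and f. *)
Definition dconn_s A2 p2 A3 p3 d12 d13 dA3 dU df : R :=
  c * (w d12 (rho A3) + w A2 dA3) - k * p2 * (w dU A3 + w u d13)
  - k * p3 * (w dU A2 + w u d12) + k * p2 * p3 * df.

(** The differential of f along A_i is entered with the value found in
    [act_f]. *)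
Lemma curvature_s A1 A2 A3 d12 d21 d13 d23 p1 p2 p3 s1 s2 s3 :
  let B23 := conn_hor d23 A2 p2 s2 A3 p3 s3 in
  let B13 := conn_hor d13 A1 p1 s1 A3 p3 s3 in
  let a23 := conn_alpha 0 A2 p2 s2 A3 p3 s3 in
  let a13 := conn_alpha 0 A1 p1 s1 A3 p3 s3 in
  let s23 := conn_s 0 A2 p2 s2 A3 p3 s3 in
  let s13 := conn_s 0 A1 p1 s1 A3 p3 s3 in
  conn_s (dconn_s A2 p2 A3 p3 d12 d13 (drho A1 A3 d13) (du A1) (2 * c * w u (rho A1)))
    A1 p1 s1 B23 a23 s23
  - conn_s (dconn_s A1 p1 A3 p3 d21 d23 (drho A2 A3 d23) (du A2) (2 * c * w u (rho A2)))
    A2 p2 s2 B13 a13 s13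
  - conn_s 0 (d12 - d21) (- 2 * w A1 A2) 0 A3 p3 s3 = 0.
Proof.
rewrite /= /conn_hor /conn_alpha /conn_s /dconn_s /drho /du /conn_gamma !lin ?wrl.
orient A1 A2; orient A1 A3; orient A2 A3; orient A1 u; orient A2 u; orient A3 u.
orient A1 d12; orient A1 d21; orient A1 d13; orient A1 d23.
orient A2 d12; orient A2 d21; orient A2 d13; orient A2 d23.
orient A3 d12; orient A3 d21; orient A3 d13; orient A3 d23.
orient u d12; orient u d21; orient u d13; orient u d23.
by rewrite ?(wxx, wxx2); field.
Qed.

(** The factor 2 e^(2s) of mu has been divided out; its derivative along
    (A3, p3, s3) is the term with 2 * s3. *)
Lemma parallel_alg A1 A2 A3 d31 d32 p1 p2 p3 s1 s2 s3 :
  let B1 := conn_hor d31 A3 p3 s3 A1 p1 s1 in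
  let B2 := conn_hor d32 A3 p3 s3 A2 p2 s2 in
  let a1 := conn_alpha 0 A3 p3 s3 A1 p1 s1 in
  let a2 := conn_alpha 0 A3 p3 s3 A2 p2 s2 in
  let t1 := conn_s 0 A3 p3 s3 A1 p1 s1 in
  let t2 := conn_s 0 A3 p3 s3 A2 p2 s2 in
  2 * s3 * (w A1 A2 + s1 * p2 - s2 * p1) + (w d31 A2 + w A1 d32) =
  (w B1 A2 + t1 * p2 - s2 * a1) + (w A1 B2 + s1 * a2 - t2 * p1).
Proof.
rewrite /= /conn_hor /conn_alpha /conn_s /conn_gamma !lin ?wrl.
orient A1 A2; orient A1 A3; orient A2 A3; orient A1 u; orient A2 u; orient A3 u.
orient A1 d31; orient A1 d32; orient A2 d31; orient A2 d32.
by rewrite ?(wxx, wxx2); field.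
Qed.

(** The left hand side of the hypothesis is R(A, B)u, expanded with the formulas
    for nabla u and nabla rho; dAB and dBA stand for nabla_A B and nabla_B A.  What
    survives the Ricci-type formula are the terms with df and w u (rho _). *)
Lemma curvature_u A B dAB dBA dfA dfB t :
  w ((- (c * j) *: (drho A (rho B) (drho A B dAB)) + (dfA *: B + f *: dAB))
     - (- (c * j) *: (drho B (rho A) (drho B A dBA)) + (dfB *: A + f *: dBA))
     - du (dAB - dBA)) t
  = - c *
    (2 * w A B * w u (rho t) + w A u * w B (rho t) + w A t * w B (rho u)
     - w B u * w A (rho t) - w B t * w A (rho u)) ->
  (dfA - 2 * c * w u (rho A)) * w B t = (dfB - 2 * c * w u (rho B)) * w A t.
Proof.
rewrite /du /drho !lin ?wrl.
orient A B; orient A u; orient B u.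
move=> /eqP; rewrite -subr_eq0 => /eqP H; apply/eqP; rewrite -subr_eq0; apply/eqP.
by rewrite -[RHS]H ?(wxx, wxx2); field.
Qed.

End Algebra.

(** * Rules of calculus for vector fields and connections *)

Section VectorFieldClosure.
Context {R : realType} {m : nat} {M : charted_space R m}.
Hypothesis hM : manifold M.
Implicit Types (U V : vfield M) (f h : M -> R).

Lemma smooth_vfieldD U V : smooth_vfield U -> smooth_vfield V ->
  smooth_vfield (fun p => U p + V p).
Proof.
move=> sU sV; rewrite (_ : (fun p => U p + V p) = (fun p => (fun=> 1) p *: U p + V p)).
  exact: (smooth_lin hM (smooth_cst hM 1) sU sV).
by apply/funext => p; rewrite scale1r.
Qed.

Lemma smooth_vfieldZ a U : smooth_vfield U -> smooth_vfield (fun p => a *: U p).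
Proof. exact: (smooth_funZ_vfield hM (smooth_cst hM a)). Qed.

Lemma smooth_vfieldN U : smooth_vfield U -> smooth_vfield (fun p => - U p).
Proof.
move=> /(smooth_vfieldZ (-1)); rewrite (_ : (fun p => -1 *: U p) = (fun p => - U p))//.
by apply/funext => p; rewrite scaleN1r.
Qed.

Lemma smooth_vfieldB U V : smooth_vfield U -> smooth_vfield V ->
  smooth_vfield (fun p => U p - V p).
Proof. by move=> sU /smooth_vfieldN; exact: smooth_vfieldD. Qed.

Lemma smooth_funD f h : smooth_fun f -> smooth_fun h -> smooth_fun (fun p => f p + h p).
Proof.
move=> /(smooth_funP hM) sf /(smooth_funP hM) sh; apply/(smooth_funP hM) => p.
exact: smooth_germD.
Qed.

Lemma smooth_funN f : smooth_fun f -> smooth_fun (fun p => - f p).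
Proof.
by move=> /(smooth_funP hM) sf; apply/(smooth_funP hM) => p; exact: smooth_germN.
Qed.

Lemma smooth_funB f h : smooth_fun f -> smooth_fun h -> smooth_fun (fun p => f p - h p).
Proof. by move=> sf /smooth_funN; exact: smooth_funD. Qed.

Lemma smooth_funZ a f : smooth_fun f -> smooth_fun (fun p => a * f p).
Proof. exact: (smooth_funM hM (smooth_cst hM a)). Qed.

Lemma smooth_act U f : smooth_vfield U -> smooth_fun f -> smooth_fun (act U f).
Proof.
by move=> sU /(smooth_funP hM) sf; apply/(smooth_funP hM) => p; exact: (smooth_germ_act hM).
Qed.

Section Connection.
Variable nab : vfield M -> vfield M -> vfield M.
Hypothesis cnab : connection nab.

Lemma connection_smooth U V : smooth_vfield U -> smooth_vfield V -> smooth_vfield (nab U V).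
Proof. by case: cnab => H _ _ _; exact: H. Qed.

Lemma connectionDr U V V' p : smooth_vfield U -> smooth_vfield V -> smooth_vfield V' ->
  nab U (fun q => V q + V' q) p = nab U V p + nab U V' p.
Proof. by move=> sU sV sV'; case: cnab => _ _ H _; rewrite H. Qed.

Lemma connectionMr g U V p : smooth_fun g -> smooth_vfield U -> smooth_vfield V ->
  nab U (fun q => g q *: V q) p = act U g p *: V p + g p *: nab U V p.
Proof. by move=> sg sU sV; case: cnab => _ _ _ H; rewrite H. Qed.

Lemma connectionZr a U V p : smooth_vfield U -> smooth_vfield V ->
  nab U (fun q => a *: V q) p = a *: nab U V p.
Proof.
move=> sU sV; have := connectionMr p (smooth_cst hM a) sU sV.
by rewrite act_cst scale0r add0r.
Qed.

Lemma connectionNr U V p : smooth_vfield U -> smooth_vfield V ->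
  nab U (fun q => - V q) p = - nab U V p.
Proof.
move=> sU sV; rewrite -scaleN1r -connectionZr//; congr (nab U _ p).
by apply/funext => q; rewrite scaleN1r.
Qed.

Lemma connectionBr U V V' p : smooth_vfield U -> smooth_vfield V -> smooth_vfield V' ->
  nab U (fun q => V q - V' q) p = nab U V p - nab U V' p.
Proof.
move=> sU sV sV'; rewrite (connectionDr p sU sV (smooth_vfieldN sV')).
by rewrite (connectionNr p sU sV').
Qed.

Lemma connection_linl g U U' V p : smooth_fun g ->
  smooth_vfield U -> smooth_vfield U' -> smooth_vfield V ->
  nab (fun q => g q *: U q + U' q) V p = g p *: nab U V p + nab U' V p.
Proof. by move=> sg sU sU' sV; case: cnab => _ H _ _; rewrite H. Qed.

End Connection.

End VectorFieldClosure.

(** * The connection of Ricci type *)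

Section Base.
Context {R : realType} {n : nat} {M : charted_space R (2 * n)}.
Hypothesis hM : manifold M.
Local Notation T := 'rV[R]_(2 * n).
Variable omega : forall p : M, T -> T -> R.
Hypothesis homega : symplectic_form omega.
Variable nabla : vfield M -> vfield M -> vfield M.
Hypothesis hnabla : connection nabla.
Hypothesis hsympl : symplectic_connection (on_fields omega) nabla.
Variable Rm : forall p : M, T -> T -> T -> T.
Hypothesis hRm : curvature_tensor nabla Rm.
Hypothesis hricci : ricci_type omega Rm.
Variable rho : forall p : M, T -> T.
Hypothesis hrho : smooth_endo rho.
Hypothesis hrhoE : forall p x y, omega p x (rho p y) = ricci Rm p x y.
Variable u : vfield M.
Hypothesis hu : smooth_vfield u.
Variable f : M -> R.
Hypothesis hf : smooth_fun f.
Hypothesis hnabla_rho : forall U V, smooth_vfield U -> smooth_vfield V -> forall p,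
  nabla U (fun q => rho q (V q)) p - rho p (nabla U V p) =
  - (2 * n + 1)%:R^-1 *:
    (omega p (u p) (V p) *: U p + omega p (U p) (V p) *: u p).
Hypothesis hnabla_u : forall U, smooth_vfield U -> forall p,
  nabla U u p =
  - ((2 * n + 1)%:R / (2 * n.+1%:R)) *: rho p (rho p (U p)) + f p *: U p.

Local Notation c := ((2 * n.+1%:R)^-1 : R).
Local Notation j := ((2 * n + 1)%:R : R).
Implicit Types (A B C : vfield M) (p : M).

Lemma omega_linr p x : scalar (omega p x). Proof. by case: homega => -[]. Qed.
Lemma omega_linl p y : scalar (omega p ^~ y). Proof. by case: homega => -[]. Qed.
Lemma omegaC p x y : omega p x y = - omega p y x. Proof. by case: homega. Qed.
Lemma omega_nondeg p x y : (forall t, omega p x t = omega p y t) -> x = y.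
Proof.
move=> H; apply/eqP; rewrite -subr_eq0; apply/eqP; case: homega => _ _ _ nd.
apply: (nd p) => t; have := scalar_formB (omega_linl p t) x y => /= ->.
by rewrite H subrr.
Qed.
Lemma smooth_omega A B : smooth_vfield A -> smooth_vfield B ->
  smooth_fun (on_fields omega A B).
Proof. by case: homega => -[_ _ H] _ _ _; exact: H. Qed.
Lemma rho_linear p : linear (rho p). Proof. exact: hrho.1. Qed.
Lemma smooth_rho A : smooth_vfield A -> smooth_vfield (fun p => rho p (A p)).
Proof. exact: hrho.2. Qed.
Lemma dim_neq0 : j != 0. Proof. by rewrite addn1 pnatr_eq0. Qed.

Lemma act_omega A B C p : smooth_vfield A -> smooth_vfield B -> smooth_vfield C ->
  act A (on_fields omega B C) p =
  omega p (nabla A B p) (C p) + omega p (B p) (nabla A C p).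
Proof. by move=> sA sB sC; exact: hsympl.2. Qed.

Lemma nabla_rho A B p : smooth_vfield A -> smooth_vfield B ->
  nabla A (fun q => rho q (B q)) p =
  drho (omega p) (rho p) j (u p) (A p) (B p) (nabla A B p).
Proof.
move=> sA sB; rewrite /drho -scaleNr -(hnabla_rho sA sB p).
by rewrite addrC subrK.
Qed.

Lemma nabla_u A p : smooth_vfield A ->
  nabla A u p = du (rho p) c j (f p) (A p).
Proof. by move=> sA; rewrite /du (hnabla_u sA) [_ / _]mulrC. Qed.

Lemma curvature_omega A B C p t :
  smooth_vfield A -> smooth_vfield B -> smooth_vfield C ->
  omega p (nabla A (nabla B C) p - nabla B (nabla A C) p - nabla (bracket A B) C p) t =
  - c *
    (2 * omega p (A p) (B p) * omega p (C p) (rho p t)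
     + omega p (A p) (C p) * omega p (B p) (rho p t)
     + omega p (A p) t * omega p (B p) (rho p (C p))
     - omega p (B p) (C p) * omega p (A p) (rho p t)
     - omega p (B p) t * omega p (A p) (rho p (C p))).
Proof.
move=> sA sB sC; rewrite -[X in omega p X](hRm sA sB sC p) hricci.
by rewrite -!hrhoE.
Qed.

Lemma bracket_nabla A B : smooth_vfield A -> smooth_vfield B ->
  bracket A B = (fun p => nabla A B p - nabla B A p).
Proof. by move=> sA sB; apply/funext => p; rewrite hsympl.1. Qed.

Section SymmetricPoint.
Variable p : M.
Hypothesis rho_sym : forall x y, omega p x (rho p y) = omega p y (rho p x).

(** The two computations of R(A, B)u give [key]; for t = A the right hand side
    vanishes, and B is chosen with omega(B, A) <> 0. *)
Lemma act_f A : smooth_vfield A -> act A f p = 2 * c * omega p (u p) (rho p (A p)).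
Proof.
move=> sA.
have nn B C : smooth_vfield B -> smooth_vfield C -> nabla B (nabla C u) p =
    - (c * j) *: drho (omega p) (rho p) j (u p) (B p) (rho p (C p))
        (drho (omega p) (rho p) j (u p) (B p) (C p) (nabla B C p))
    + (act B f p *: C p + f p *: nabla B C p).
  move=> sB sC; have sr := smooth_rho sC; have srr := smooth_rho sr.
  rewrite (_ : nabla C u = fun q => - (c * j) *: rho q (rho q (C q)) + f q *: C q).
    have z1 := smooth_vfieldZ hM (- (c * j)) srr; have z2 := smooth_funZ_vfield hM hf sC.
    rewrite (connectionDr hnabla p sB z1 z2) (connectionZr hM hnabla (- (c * j)) p sB srr).
    by rewrite (connectionMr hnabla p hf sB sC) (nabla_rho p sB sr) (nabla_rho p sB sC).
  by apply/funext => q; rewrite nabla_u.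
have key B t : smooth_vfield B ->
    (act A f p - 2 * c * omega p (u p) (rho p (A p))) * omega p (B p) t =
    (act B f p - 2 * c * omega p (u p) (rho p (B p))) * omega p (A p) t.
  move=> sB; have := curvature_omega p t sA sB hu.
  have sAB := smooth_vfieldB hM (connection_smooth hnabla sA sB) (connection_smooth hnabla sB sA).
  rewrite (nn A B sA sB) (nn B A sB sA) (bracket_nabla sA sB) (nabla_u p sAB).
  exact: (curvature_u (omega_linl p) (omegaC p) (rho_linear p) rho_sym dim_neq0).
have [A0|A0] := eqVneq (A p) 0.
  rewrite A0 -[LHS]/(tangent_act p (A p) f) A0.
  rewrite (tangent_act_expand hM); last exact: (smooth_funP hM _).1.
  have -> : rho p 0 = 0.
    have := rho_linear p 1 0 0; rewrite scaler0 addr0 scale1r => /(congr1 (fun x => x - rho p 0)).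
    by rewrite subrr addrK.
  rewrite (scalar_form0 (omega_linr p (u p))) mulr0 big1// => i _.
  by rewrite mxE mul0r.
have [b bA] : exists b, omega p b (A p) != 0.
  apply: contrapT => H; move/eqP: A0; apply; apply: (@omega_nondeg p) => t.
  rewrite (scalar_form0 (omega_linl p t)) omegaC; apply/eqP; rewrite oppr_eq0.
  by apply: contraT => tA; exfalso; apply: H; exists t.
have [B sB Bp] := vfield_extension hM p b.
have := key B (A p) sB; rewrite Bp.
have -> : omega p (A p) (A p) = 0.
  by have /eqP := omegaC p (A p) (A p); rewrite -addr_eq0 -mulr2n mulrn_eq0/= => /eqP.
rewrite mulr0 => /eqP; rewrite mulf_eq0 (negbTE bA) orbF subr_eq0 => /eqP.
by [].
Qed.

End SymmetricPoint.

Lemma nabla_conn_hor A1 A2 A3 p (p2 s2 p3 s3 : R) :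
  smooth_vfield A1 -> smooth_vfield A2 -> smooth_vfield A3 ->
  nabla A1 (fun q => conn_hor (rho q) c j (u q) (nabla A2 A3 q) (A2 q) p2 s2 (A3 q) p3 s3) p =
  dconn_hor c j (nabla A1 (nabla A2 A3) p) (nabla A1 A2 p) p2 s2 (nabla A1 A3 p) p3 s3
    (drho (omega p) (rho p) j (u p) (A1 p) (A2 p) (nabla A1 A2 p))
    (drho (omega p) (rho p) j (u p) (A1 p) (A3 p) (nabla A1 A3 p))
    (du (rho p) c j (f p) (A1 p)).
Proof.
move=> s1 sA2 sA3.
have sn := connection_smooth hnabla sA2 sA3.
have r2 := smooth_rho sA2; have r3 := smooth_rho sA3.
have z1 := smooth_vfieldZ hM (c * p3) r2.
have z2 := smooth_vfieldZ hM (c * p2) r3.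
have z3 := smooth_vfieldZ hM (c / j * p2 * p3) hu.
have z4 := smooth_vfieldZ hM s2 sA3.
have z5 := smooth_vfieldZ hM s3 sA2.
have b1 := smooth_vfieldB hM sn z1.
have b2 := smooth_vfieldB hM b1 z2.
have b3 := smooth_vfieldB hM b2 z3.
have b4 := smooth_vfieldD hM b3 z4.
rewrite /conn_hor /dconn_hor -!nabla_rho// -nabla_u//.
rewrite (connectionDr hnabla _ s1 b4 z5) (connectionDr hnabla _ s1 b3 z4).
rewrite (connectionBr hM hnabla _ s1 b2 z3) (connectionBr hM hnabla _ s1 b1 z2).
rewrite (connectionBr hM hnabla _ s1 sn z1).
by rewrite !(connectionZr hM hnabla).
Qed.

Lemma act_conn_alpha A1 A2 A3 p (p2 s2 p3 s3 : R) :
  smooth_vfield A1 -> smooth_vfield A2 -> smooth_vfield A3 ->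
  act A1 (fun q => conn_alpha (omega q) 0 (A2 q) p2 s2 (A3 q) p3 s3) p =
  - (omega p (nabla A1 A2 p) (A3 p) + omega p (A2 p) (nabla A1 A3 p)).
Proof.
move=> s1 sA2 sA3; rewrite -act_omega//.
have sw := (smooth_funP hM _).1 (smooth_omega sA2 sA3) p.
rewrite (_ : (fun q => _) = (fun q => - on_fields omega A2 A3 q + (s2 * p3 + s3 * p2))).
  by rewrite actD ?(actN hM)// ?act_cst ?addr0//; [exact: smooth_germN|exact: smooth_germ_cst].
by apply/funext => q; rewrite /conn_alpha sub0r addrA.
Qed.

Lemma act_conn_s A1 A2 A3 p (p2 s2 p3 s3 : R) :
  smooth_vfield A1 -> smooth_vfield A2 -> smooth_vfield A3 ->
  act A1 (fun q => conn_s (omega q) (rho q) c j (u q) (f q) 0 (A2 q) p2 s2 (A3 q) p3 s3) p =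
  dconn_s (omega p) (rho p) c j (u p) (A2 p) p2 (A3 p) p3
    (nabla A1 A2 p) (nabla A1 A3 p)
    (drho (omega p) (rho p) j (u p) (A1 p) (A3 p) (nabla A1 A3 p))
    (du (rho p) c j (f p) (A1 p)) (act A1 f p).
Proof.
move=> s1 sA2 sA3; have r3 := smooth_rho sA3.
have S := smooth_funP hM.
have w1 := (S _).1 (smooth_omega sA2 r3) p.
have w2 := (S _).1 (smooth_omega hu sA3) p.
have w3 := (S _).1 (smooth_omega hu sA2) p.
have w4 := (S _).1 hf p.
have sZ a h : smooth_germ h p -> smooth_germ (fun q : M => a * h q) p.
  by move=> sh; apply: smooth_germM => //; exact: smooth_germ_cst.
pose g1 q := c * on_fields omega A2 (fun q => rho q (A3 q)) q.
pose g2 q := c / j * p2 * on_fields omega u A3 q.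
pose g3 q := c / j * p3 * on_fields omega u A2 q.
pose g4 q := c / j * p2 * p3 * f q.
rewrite (_ : (fun q => _) = (fun q => g1 q - g2 q - g3 q + g4 q + s2 * s3)); last first.
  apply/funext => q; rewrite /conn_s /conn_gamma add0r /g1 /g2 /g3 /g4.
  by congr (_ - _ - _ + _ + _); [rewrite /on_fields; ring..|ring].
have t1 := sZ c _ w1; have t2 := sZ (c / j * p2) _ w2.
have t3 := sZ (c / j * p3) _ w3; have t4 := sZ (c / j * p2 * p3) _ w4.
have b1 := smooth_germB t1 t2; have b2 := smooth_germB b1 t3; have b3 := smooth_germD b2 t4.
rewrite (actD A1 b3 (smooth_germ_cst _ _)) act_cst addr0 (actD A1 b2 t4).
rewrite (actB hM A1 b1 t3) (actB hM A1 t1 t2).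
rewrite /g1 /g2 /g3 /g4 (actZ hM A1 c w1) (actZ hM A1 _ w2) (actZ hM A1 _ w3) (actZ hM A1 _ w4).
rewrite (act_omega p s1 sA2 r3) (act_omega p s1 hu sA3) (act_omega p s1 hu sA2).
by rewrite (nabla_rho p s1 sA3) (nabla_u p s1).
Qed.

End Base.

(** * Tensors attached to a connection *)

Section TensorsOfConnection.
Context {R : realType} {m : nat} {M : charted_space R m}.
Hypothesis hM : manifold M.
Variable nab : vfield M -> vfield M -> vfield M.
Hypothesis cnab : connection nab.
Local Notation T := 'rV[R]_m.
Implicit Types (U V W : vfield M) (p : M).

Let aux1 (f w : R) (a b c d x y u : T) :
  (f *: a + b) - ((w *: u + f *: c) + d) - (f *: x + y - w *: u) =
  f *: (a - c - x) + (b - d - y).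
Proof. by apply/rowP => i; rewrite !mxE; ring. Qed.

(** The derivative W(f) of the coefficient appears in the second term and in the
    bracket, with opposite effect. *)
Lemma tensorial_torsion W p : smooth_vfield W ->
  tensorial p (fun V => nab V W p - nab W V p - bracket V W p).
Proof.
move=> sW f U V sf sU sV.
have sfU := smooth_funZ_vfield hM sf sU.
have E1 := connection_linl cnab p sf sU sV sW.
have E2 := etrans (connectionDr cnab p sW sfU sV)
  (congr2 +%R (connectionMr cnab p sf sW sU) erefl).
have E3 := bracket_lin hM sf sU sV sW p.
apply: etrans (congr2 (fun x y : T => x - y) (congr2 (fun x y : T => x - y) E1 E2) E3) _.
exact: aux1.
Qed.

Let aux0 (a b : R) (x y z : T) : a *: x + y - b *: z = a *: x + (- b *: z + y).
Proof. by rewrite -addrA scaleNr [y + _]addrC. Qed.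

Let aux2 (f w : R) (a b c c' d x y u : T) :
  (f *: a + b) - ((w *: c + f *: c') + d) - (f *: x + (- w *: c + y)) =
  f *: (a - c' - x) + (b - d - y).
Proof. by apply/rowP => i; rewrite !mxE; ring. Qed.

Lemma tensorial_curvature1 V W p : smooth_vfield V -> smooth_vfield W ->
  tensorial p (fun U => curvature nab U V W p).
Proof.
move=> sV sW f U U' sf sU sU'.
have sVW := connection_smooth cnab sV sW.
have sUW := connection_smooth cnab sU sW; have sU'W := connection_smooth cnab sU' sW.
have sa := smooth_act hM sV sf.
have E1 := connection_linl cnab p sf sU sU' sVW.
have E2 : nab V (nab (fun q => f q *: U q + U' q) W) p =
    (act V f p *: nab U W p + f p *: nab V (nab U W) p) + nab V (nab U' W) p.
  have -> : nab (fun q => f q *: U q + U' q) W = (fun q => f q *: nab U W q + nab U' W q).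
    by case: cnab => _ H _ _; exact: H.
  rewrite (connectionDr cnab p sV (smooth_funZ_vfield hM sf sUW) sU'W).
  by rewrite (connectionMr cnab p sf sV sUW).
have E3 : nab (bracket (fun q => f q *: U q + U' q) V) W p =
    f p *: nab (bracket U V) W p + (- act V f p *: nab U W p + nab (bracket U' V) W p).
  have sb := smooth_bracket hM sU sV; have sb' := smooth_bracket hM sU' sV.
  have -> : bracket (fun q => f q *: U q + U' q) V =
      (fun q => f q *: bracket U V q + (- act V f q *: U q + bracket U' V q)).
    by apply/funext => q; apply: etrans (bracket_lin hM sf sU sU' sV q) (aux0 _ _ _ _ _).
  have sN := smooth_funN hM sa.
  rewrite (connection_linl cnab p sf sb (smooth_lin hM sN sU sb') sW).
  by rewrite (connection_linl cnab p sN sU sb' sW).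
apply: etrans (congr2 (fun x y : T => x - y) (congr2 (fun x y : T => x - y) E1 E2) E3) _.
exact: (aux2 _ _ _ _ _ _ _ _ _ 0).
Qed.

Let aux3 (f a b ab ba l : R) (w u v x y z x' y' z' : T) : l = ab - ba ->
  ((ab *: w + b *: u) + (a *: v + f *: x)) + x' -
  (((ba *: w + a *: v) + (b *: u + f *: y)) + y') - ((l *: w + f *: z) + z') =
  f *: (x - y - z) + (x' - y' - z').
Proof. by move=> ->; apply/rowP => i; rewrite !mxE; ring. Qed.

Let second U V W W' f p : smooth_vfield U -> smooth_vfield V -> smooth_vfield W ->
  smooth_vfield W' -> smooth_fun f ->
  nab U (nab V (fun q => f q *: W q + W' q)) p =
  ((act U (act V f) p *: W p + act V f p *: nab U W p) +
   (act U f p *: nab V W p + f p *: nab U (nab V W) p)) + nab U (nab V W') p.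
Proof.
move=> sU sV sW sW' sf; have sfW := smooth_funZ_vfield hM sf sW.
have sVW := connection_smooth cnab sV sW; have sVW' := connection_smooth cnab sV sW'.
have sa := smooth_act hM sV sf.
have -> : nab V (fun q => f q *: W q + W' q) =
    (fun q => (act V f q *: W q + f q *: nab V W q) + nab V W' q).
  apply/funext => q; rewrite (connectionDr cnab q sV sfW sW').
  by rewrite (connectionMr cnab q sf sV sW).
have z1 := smooth_funZ_vfield hM sa sW; have z2 := smooth_funZ_vfield hM sf sVW.
rewrite (connectionDr cnab p sU (smooth_vfieldD hM z1 z2) sVW').
rewrite (connectionDr cnab p sU z1 z2).
by rewrite (connectionMr cnab p sa sU sW) (connectionMr cnab p sf sU sVW).
Qed.

(** The first derivatives of f cancel by symmetry, and U(V(f)) - V(U(f)) is absorbed by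
    the bracket. *)
Lemma tensorial_curvature3 U V p : smooth_vfield U -> smooth_vfield V ->
  tensorial p (fun W => curvature nab U V W p).
Proof.
move=> sU sV f W W' sf sW sW'; have sfW := smooth_funZ_vfield hM sf sW.
have sUV := smooth_bracket hM sU sV.
have E1 := second p sU sV sW sW' sf; have E2 := second p sV sU sW sW' sf.
have E3 := etrans (connectionDr cnab p sUV sfW sW')
  (congr2 +%R (connectionMr cnab p sf sUV sW) erefl).
apply: etrans (congr2 (fun x y : T => x - y) (congr2 (fun x y : T => x - y) E1 E2) E3) _.
by apply: aux3; apply: (act_bracket hM sU sV); exact: (smooth_funP hM _).1.
Qed.

Let aux4 (x y z : T) : x - y - (- z) = - (y - x - z).
Proof. by apply/rowP => i; rewrite !mxE; ring. Qed.

Lemma curvatureC U V W p : smooth_vfield U -> smooth_vfield V -> smooth_vfield W ->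
  curvature nab U V W p = - curvature nab V U W p.
Proof.
move=> sU sV sW; have sVU := smooth_bracket hM sV sU.
have E : nab (bracket U V) W p = - nab (bracket V U) W p.
  have tT : tensorial p (fun Z => nab Z W p).
    by move=> f Z Z' sf sZ sZ'; exact: (connection_linl cnab p sf sZ sZ' sW).
  have -> : bracket U V = (fun q => (fun=> -1) q *: bracket V U q).
    by apply/funext => q; rewrite scaleN1r bracketC.
  by rewrite (tensorialZ hM tT (smooth_cst hM (-1)) sVU) scaleN1r.
apply: etrans (congr1 (fun x : T => _ - _ - x) E) _.
exact: aux4.
Qed.

End TensorsOfConnection.

Section ParallelTensor.
Context {R : realType} {m : nat} {M : charted_space R m}.
Hypothesis hM : manifold M.
Variable nab : vfield M -> vfield M -> vfield M.
Hypothesis cnab : connection nab.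
Variable a : forall p : M, 'rV[R]_m -> R.
Hypothesis sa : smooth_1form a.
Implicit Types (U V W : vfield M) (p : M).

Definition nabla_form U V W p : R :=
  act U (d1 a V W) p - d1 a (nab U V) W p - d1 a V (nab U W) p.

Let aux1 (f x x' y y' z z' : R) :
  (f * x + x') - (f * y + y') - (f * z + z') = f *: (x - y - z) + (x' - y' - z').
Proof. by rewrite /GRing.scale/=; ring. Qed.

Let aux0 (f x x' y y' : R) : y = - x -> y' = - x' -> - (f * x + x') = f * y + y'.
Proof. by move=> -> ->; ring. Qed.

Lemma d1_linr f U U' V p : smooth_fun f ->
  smooth_vfield U -> smooth_vfield U' -> smooth_vfield V ->
  d1 a V (fun q => f q *: U q + U' q) p = f p * d1 a V U p + d1 a V U' p.
Proof.
move=> sf sU sU' sV; apply: etrans (d1C sa _ _ p) _.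
apply: etrans (congr1 -%R (d1_lin hM sa p sf sU sU' sV)) _.
exact: aux0 (d1C sa V U p) (d1C sa V U' p).
Qed.

Lemma tensorial_nabla_form1 V W p : smooth_vfield V -> smooth_vfield W ->
  tensorial p (fun U => nabla_form U V W p : R^o).
Proof.
move=> sV sW f U U' sf sU sU'.
have sUV := connection_smooth cnab sU sV; have sU'V := connection_smooth cnab sU' sV.
have sUW := connection_smooth cnab sU sW; have sU'W := connection_smooth cnab sU' sW.
have linl Z : smooth_vfield Z ->
    nab (fun q => f q *: U q + U' q) Z = (fun q => f q *: nab U Z q + nab U' Z q).
  by move=> sZ; case: cnab => _ H _ _; exact: H.
have sVW := (smooth_funP hM _).1 (smooth_d1 hM sa sV sW) p.
have E1 := act_lin hM f U U' sVW.
have E2 : d1 a (nab (fun q => f q *: U q + U' q) V) W p =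
    f p * d1 a (nab U V) W p + d1 a (nab U' V) W p.
  by rewrite (linl V sV); exact: (d1_lin hM sa p sf sUV sU'V sW).
have E3 : d1 a V (nab (fun q => f q *: U q + U' q) W) p =
    f p * d1 a V (nab U W) p + d1 a V (nab U' W) p.
  by rewrite (linl W sW); exact: (d1_linr p sf sUW sU'W sV).
apply: etrans (congr2 (fun x y : R => x - y) (congr2 (fun x y : R => x - y) E1 E2) E3) _.
exact: aux1.
Qed.

Let aux2 (f w x x' y y' z z' d : R) :
  (w * d + f * x + x') - (w * d + (f * y + y')) - (f * z + z') =
  f *: (x - y - z) + (x' - y' - z').
Proof. by rewrite /GRing.scale/=; ring. Qed.

Lemma tensorial_nabla_form2 U W p : smooth_vfield U -> smooth_vfield W ->
  tensorial p (fun V => nabla_form U V W p : R^o).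
Proof.
move=> sU sW f V V' sf sV sV'; have S := smooth_funP hM.
have sUV := connection_smooth cnab sU sV; have sUV' := connection_smooth cnab sU sV'.
have sUW := connection_smooth cnab sU sW; have sfV := smooth_funZ_vfield hM sf sV.
have sVW := (S _).1 (smooth_d1 hM sa sV sW) p.
have sV'W := (S _).1 (smooth_d1 hM sa sV' sW) p.
have sfp := (S _).1 sf p.
have E1 : act U (d1 a (fun q => f q *: V q + V' q) W) p =
    act U f p * d1 a V W p + f p * act U (d1 a V W) p + act U (d1 a V' W) p.
  have -> : d1 a (fun q => f q *: V q + V' q) W = (fun q => f q * d1 a V W q + d1 a V' W q).
    by apply/funext => q; exact: (d1_lin hM sa q sf sV sV' sW).
  by rewrite (actD U (smooth_germM sfp sVW) sV'W) (actM hM U sfp sVW).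
have E2 : d1 a (nab U (fun q => f q *: V q + V' q)) W p =
    act U f p * d1 a V W p + (f p * d1 a (nab U V) W p + d1 a (nab U V') W p).
  have -> : nab U (fun q => f q *: V q + V' q) =
      (fun q => act U f q *: V q + (f q *: nab U V q + nab U V' q)).
    apply/funext => q; rewrite (connectionDr cnab q sU sfV sV').
    by rewrite (connectionMr cnab q sf sU sV) addrA.
  rewrite (d1_lin hM sa p (smooth_act hM sU sf) sV (smooth_lin hM sf sUV sUV') sW).
  by rewrite (d1_lin hM sa p sf sUV sUV' sW).
have E3 := d1_lin hM sa p sf sV sV' sUW.
apply: etrans (congr2 (fun x y : R => x - y) (congr2 (fun x y : R => x - y) E1 E2) E3) _.
exact: aux2.
Qed.

Lemma nabla_formC U V W p : smooth_vfield V -> smooth_vfield W ->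
  nabla_form U V W p = - nabla_form U W V p.
Proof.
move=> sV sW; rewrite /nabla_form.
have sWV := (smooth_funP hM _).1 (smooth_d1 hM sa sW sV) p.
have E1 : act U (d1 a V W) p = - act U (d1 a W V) p.
  rewrite -(actN hM U sWV); congr (act U _ p).
  by apply/funext => q; exact: d1C.
have E2 : d1 a (nab U V) W p = - d1 a W (nab U V) p := d1C sa _ _ p.
have E3 : d1 a V (nab U W) p = - d1 a (nab U W) V p := d1C sa _ _ p.
apply: etrans (congr2 (fun x y : R => x - y) (congr2 (fun x y : R => x - y) E1 E2) E3) _.
by move: (act _ _ p) (d1 a W _ p) (d1 a _ V p) => x y z; ring.
Qed.

End ParallelTensor.

(** * The induced connection on the cylinder *)

Section Induced.
Context {R : realType} {n : nat} {M : charted_space R (2 * n)}.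
Hypothesis hM : manifold M.
Local Notation T := 'rV[R]_(2 * n).
Variable omega : forall p : M, T -> T -> R.
Hypothesis homega : symplectic_form omega.
Variable nabla : vfield M -> vfield M -> vfield M.
Hypothesis hnabla : connection nabla.
Hypothesis hsympl : symplectic_connection (on_fields omega) nabla.
Variable Rm : forall p : M, T -> T -> T -> T.
Hypothesis hRm : curvature_tensor nabla Rm.
Hypothesis hricci : ricci_type omega Rm.
Variable rho : forall p : M, T -> T.
Hypothesis hrho : smooth_endo rho.
Hypothesis hrhoE : forall p x y, omega p x (rho p y) = ricci Rm p x y.
Variable u : vfield M.
Hypothesis hu : smooth_vfield u.
Variable f : M -> R.
Hypothesis hf : smooth_fun f.
Hypothesis hnabla_rho : forall U V, smooth_vfield U -> smooth_vfield V -> forall p,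
  nabla U (fun q => rho q (V q)) p - rho p (nabla U V p) =
  - (2 * n + 1)%:R^-1 *:
    (omega p (u p) (V p) *: U p + omega p (U p) (V p) *: u p).
Hypothesis hnabla_u : forall U, smooth_vfield U -> forall p,
  nabla U u p =
  - ((2 * n + 1)%:R / (2 * n.+1%:R)) *: rho p (rho p (U p)) + f p *: U p.
Context {N : charted_space R (2 * n).+1}.
Hypothesis hN : manifold N.
Variable alpha : forall x : N, 'rV[R]_(2 * n).+1 -> R.
Hypothesis salpha : smooth_1form alpha.
Variable X : vfield N.
Hypothesis hX : reeb_field alpha X.
Variable pi : N -> M.
Hypothesis hpi : submersion pi.
Hypothesis hd : forall Z Z', smooth_vfield Z -> smooth_vfield Z' -> forall x,
  d1 alpha Z Z' x = 2 * pullback2 pi omega x (Z x) (Z' x).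
Variable lift : vfield M -> vfield N.
Hypothesis hlift : forall U, smooth_vfield U -> horizontal_lift pi alpha U (lift U).
Variable nablaN : vfield N -> vfield N -> vfield N.
Hypothesis hN_UV : forall U V, smooth_vfield U -> smooth_vfield V -> forall x,
  nablaN (lift U) (lift V) x =
  lift (nabla U V) x - pullback2 pi omega x (lift U x) (lift V x) *: X x.
Hypothesis hN_XU : forall U, smooth_vfield U -> forall x,
  nablaN X (lift U) x = - (2 * n.+1%:R)^-1 *: lift (fun p => rho p (U p)) x.
Hypothesis hN_UX : forall U, smooth_vfield U -> forall x,
  nablaN (lift U) X x = - (2 * n.+1%:R)^-1 *: lift (fun p => rho p (U p)) x.
Hypothesis hN_XX : forall x,
  nablaN X X x = - (2 * n.+1%:R * (2 * n + 1)%:R)^-1 *: lift u x.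
Variable gamma : forall x : N, 'rV[R]_(2 * n).+1 -> 'rV[R]_(2 * n).+1 -> R.
Hypothesis hgamma_sym : forall x v w, gamma x v w = gamma x w v.
Hypothesis hgamma_XX : forall x,
  gamma x (X x) (X x) = (2 * n.+1%:R * (2 * n + 1)%:R)^-1 * f (pi x).
Hypothesis hgamma_XU : forall U, smooth_vfield U -> forall x,
  gamma x (X x) (lift U x) =
  - (2 * n.+1%:R * (2 * n + 1)%:R)^-1 * pullback2 pi omega x (lift u x) (lift U x).
Hypothesis hgamma_UV : forall U V, smooth_vfield U -> smooth_vfield V -> forall x,
  gamma x (lift U x) (lift V x) =
  (2 * n.+1%:R)^-1 *
    pullback2 pi omega x (lift U x) (lift (fun p => rho p (V p)) x).
Variable nabla1 : vfield (cylinder N) -> vfield (cylinder N) -> vfield (cylinder N).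
Hypothesis hnabla1 : connection nabla1.
Hypothesis h1_ZZ : forall Z Z', smooth_vfield Z -> smooth_vfield Z' -> forall q,
  nabla1 (slice_ext Z) (slice_ext Z') q =
  slice_ext (nablaN Z Z') q + gamma (p1 q) (Z (p1 q)) (Z' (p1 q)) *: dds N q.
Hypothesis h1_Zs : forall Z, smooth_vfield Z -> forall q,
  nabla1 (slice_ext Z) (dds N) q = slice_ext Z q.
Hypothesis h1_sZ : forall Z, smooth_vfield Z -> forall q,
  nabla1 (dds N) (slice_ext Z) q = slice_ext Z q.
Hypothesis h1_ss : forall q, nabla1 (dds N) (dds N) q = dds N q.

Local Notation c := ((2 * n.+1%:R)^-1 : R).
Local Notation j := ((2 * n + 1)%:R : R).
Local Notation P := (cylinder N).
Implicit Types (A B : vfield M) (x : N) (q : P) (phi sig psi tau : M -> R).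

Let hP : manifold P := cylinder_manifold hN.
Let spi : smooth_map pi := hpi.1.

Lemma lift_smooth A : smooth_vfield A -> smooth_vfield (lift A).
Proof. by move=> sA; have [] := hlift sA. Qed.

Lemma lift_related A : smooth_vfield A -> related pi (lift A) A.
Proof. by move=> sA; have [] := hlift sA. Qed.

Lemma alpha_lift A x : smooth_vfield A -> alpha x (lift A x) = 0.
Proof. by move=> sA; have [] := hlift sA. Qed.

Lemma reeb_smooth : smooth_vfield X. Proof. by case: hX. Qed.
Lemma alpha_reeb x : alpha x (X x) = 1. Proof. by case: hX. Qed.

(** 2 omega(pi_* X, pi_* Z) = d(alpha)(X, Z) = 0 for all Z, and pi is a
    submersion. *)
Lemma reeb_related : related pi X (fun=> 0).
Proof.
move=> x; apply: (omega_nondeg homega (p := pi x)) => t.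
rewrite /= (scalar_form0 (omega_linl homega (pi x) t)).
have [v vt] := hpi.2 x t; have [Z sZ Zx] := vfield_extension hN x v.
have [_ hXd _] := hX; have := hd reeb_smooth sZ x; rewrite hXd// Zx /pullback2 vt.
by move=> /esym/eqP; rewrite mulf_eq0 pnatr_eq0/= => /eqP.
Qed.

Lemma tangentN_eq x v w : tangent_map pi x v = tangent_map pi x w ->
  alpha x v = alpha x w -> v = w.
Proof.
move=> pvw avw; apply/eqP; rewrite -subr_eq0; apply/eqP.
have plin : linear (tangent_map pi x) by move=> a y z; exact: tangent_map_linear.
apply: (kernel_line plin (salpha.1 x) (hpi.2 x) (reeb_related x) (alpha_reeb x)).
  by rewrite addrC -scaleN1r plin pvw scaleN1r addNr.
by rewrite (scalar_formB (salpha.1 x)) avw subrr.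
Qed.

Lemma pullback_lift A B x : smooth_vfield A -> smooth_vfield B ->
  pullback2 pi omega x (lift A x) (lift B x) = omega (pi x) (A (pi x)) (B (pi x)).
Proof. by move=> sA sB; rewrite /pullback2 (lift_related sA) (lift_related sB). Qed.

(** The symmetry of the Ricci tensor is read off from that of gamma, whose values
    on lifts at x are c omega(Y, rho Z) at pi x. *)
Lemma rho_sym x y z : omega (pi x) y (rho (pi x) z) = omega (pi x) z (rho (pi x) y).
Proof.
have [Y sY <-] := vfield_extension hM (pi x) y.
have [Z sZ <-] := vfield_extension hM (pi x) z.
have c0 : c != 0 by rewrite invr_eq0 mulf_eq0 !pnatr_eq0.
have sr C : smooth_vfield C -> smooth_vfield (fun p => rho p (C p)) by exact: smooth_rho.
apply: (mulfI c0).
rewrite -(pullback_lift x sY (sr Z sZ)) -(pullback_lift x sZ (sr Y sY)).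
by rewrite -(hgamma_UV sY sZ) -(hgamma_UV sZ sY) hgamma_sym.
Qed.

(** The alpha-component is - d(alpha) on the lifts, as alpha vanishes on them. *)
Lemma bracket_lift A B x : smooth_vfield A -> smooth_vfield B ->
  bracket (lift A) (lift B) x =
  lift (bracket A B) x - (2 * omega (pi x) (A (pi x)) (B (pi x))) *: X x.
Proof.
move=> sA sB; have lA := lift_smooth sA; have lB := lift_smooth sB.
have sAB := smooth_bracket hM sA sB.
apply: tangentN_eq.
  apply: etrans (bracket_related hN hM spi lA sA lB sB (lift_related sA) (lift_related sB) x) _.
  rewrite addrC -scaleNr (tangent_map_linear hN hM spi) reeb_related scaler0 add0r.
  exact: (esym (lift_related sAB x)).
rewrite (scalar_formB (salpha.1 x)) (scalar_formZ (salpha.1 x)) alpha_reeb mulr1.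
rewrite (alpha_lift x sAB) sub0r.
rewrite -(pullback_lift x sA sB) -(hd lA lB x).
rewrite /d1; set a0 := alpha x (bracket _ _ _).
have E C D : smooth_vfield D -> act (lift C) (fun y => alpha y (lift D y)) x = 0.
  move=> sD; rewrite (_ : (fun y => _) = fun=> 0) ?act_cst//.
  by apply/funext => y; exact: alpha_lift.
by rewrite (E A B sB) (E B A sA) subrr sub0r opprK.
Qed.

Lemma bracket_reeb_lift A x : smooth_vfield A -> bracket X (lift A) x = 0.
Proof.
move=> sA; have lA := lift_smooth sA; have sX := reeb_smooth.
apply: tangentN_eq.
  have s0 := smooth_vfield0 hM.
  apply: etrans (bracket_related hN hM spi sX s0 lA sA reeb_related (lift_related sA) x) _.
  by rewrite (tangent_map0 hN hM spi) (bracket_zero hM _ sA).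
rewrite (scalar_form0 (salpha.1 x)).
have [_ hXd _] := hX; have := hXd _ lA x; rewrite /d1.
rewrite (_ : (fun y => alpha y (lift A y)) = fun=> 0); last first.
  by apply/funext => y; exact: alpha_lift.
rewrite (_ : (fun y => alpha y (X y)) = fun=> 1); last first.
  by apply/funext => y; exact: alpha_reeb.
by rewrite !act_cst subr0 sub0r => /eqP; rewrite oppr_eq0 => /eqP.
Qed.

Definition hor q (v : 'rV[R]_((2 * n).+1 + 1)) : T := tangent_map pi (p1 q) (lsubmx v).
Definition valpha q (v : 'rV[R]_((2 * n).+1 + 1)) : R := alpha (p1 q) (lsubmx v).
Definition vs (v : 'rV[R]_((2 * n).+1 + 1)) : R := v ord0 (rshift _ ord0).

Lemma hor_lin q a v w : hor q (a *: v + w) = a *: hor q v + hor q w.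
Proof. by rewrite /hor linearP (tangent_map_linear hN hM spi). Qed.
Lemma valpha_lin q : scalar (valpha q).
Proof. by move=> a v w; rewrite /valpha linearP salpha.1. Qed.
Lemma vs_lin : scalar vs.
Proof. by move=> a v w; rewrite /vs !mxE. Qed.

Lemma components_eq q v w :
  hor q v = hor q w -> valpha q v = valpha q w -> vs v = vs w -> v = w.
Proof.
by move=> hvw avw svw; exact: (cylinder_tangentP (tangentN_eq hvw avw) svw).
Qed.

Lemma components_slice q (Z : vfield N) : [/\
  hor q (slice_ext Z q) = tangent_map pi (p1 q) (Z (p1 q)),
  valpha q (slice_ext Z q) = alpha (p1 q) (Z (p1 q)) &
  vs (slice_ext Z q) = 0].
Proof. by rewrite /hor /valpha /vs row_mxKl row_mxEr mxE. Qed.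

Lemma components_dds q : [/\ hor q (dds N q) = 0, valpha q (dds N q) = 0 & vs (dds N q) = 1].
Proof.
rewrite /hor /valpha /vs row_mxKl row_mxEr mxE.
by rewrite (tangent_map0 hN hM spi) (scalar_form0 (salpha.1 _)).
Qed.

Lemma components_lift q A : smooth_vfield A -> [/\
  hor q (slice_ext (lift A) q) = A (pi (p1 q)),
  valpha q (slice_ext (lift A) q) = 0 & vs (slice_ext (lift A) q) = 0].
Proof.
move=> sA; have [-> -> ->] := components_slice q (lift A).
by rewrite (alpha_lift _ sA); split => //; exact: lift_related.
Qed.

Lemma components_reeb q : [/\
  hor q (slice_ext X q) = 0, valpha q (slice_ext X q) = 1 & vs (slice_ext X q) = 0].
Proof.
have [-> -> ->] := components_slice q X.
by rewrite alpha_reeb; split => //; exact: reeb_related.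
Qed.

(** The fields invariant under X and d/ds, whose components descend to M. *)
Definition basic_field A phi sig : vfield P := fun q =>
  phi (pi (p1 q)) *: slice_ext X q +
  (sig (pi (p1 q)) *: dds N q + slice_ext (lift A) q).

Lemma smooth_basefun phi : smooth_fun phi -> smooth_fun (fun q : P => phi (pi (p1 q))).
Proof.
move=> sphi.
exact: (smooth_comp hP hN (smooth_map_p1 hN) (smooth_comp hN hM spi sphi)).
Qed.

Lemma smooth_sX : smooth_vfield (slice_ext X).
Proof. exact: (smooth_slice hN reeb_smooth). Qed.
Lemma smooth_sD : smooth_vfield (dds N).
Proof. exact: (smooth_dds hN). Qed.
Lemma smooth_sL A : smooth_vfield A -> smooth_vfield (slice_ext (lift A)).
Proof. by move=> sA; exact: (smooth_slice hN (lift_smooth sA)). Qed.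
Lemma smooth_basic2 A sig : smooth_vfield A -> smooth_fun sig ->
  smooth_vfield (fun q : P => sig (pi (p1 q)) *: dds N q + slice_ext (lift A) q).
Proof.
move=> sA ss; exact: (smooth_lin hP (smooth_basefun ss) smooth_sD (smooth_sL sA)).
Qed.
Lemma smooth_basic A phi sig : smooth_vfield A -> smooth_fun phi -> smooth_fun sig ->
  smooth_vfield (basic_field A phi sig).
Proof.
move=> sA sp ss.
exact: (smooth_lin hP (smooth_basefun sp) smooth_sX (smooth_basic2 sA ss)).
Qed.

Let comb_hor q a b v w z : hor q (a *: v + (b *: w + z)) = a *: hor q v + (b *: hor q w + hor q z).
Proof. by rewrite !hor_lin. Qed.
Let comb_valpha q a b v w z :
  valpha q (a *: v + (b *: w + z)) = a * valpha q v + (b * valpha q w + valpha q z).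
Proof. by rewrite !valpha_lin. Qed.
Let comb_vs a b v w z : vs (a *: v + (b *: w + z)) = a * vs v + (b * vs w + vs z).
Proof. by rewrite !vs_lin. Qed.

Lemma components_basic A phi sig q : smooth_vfield A -> [/\
  hor q (basic_field A phi sig q) = A (pi (p1 q)),
  valpha q (basic_field A phi sig q) = phi (pi (p1 q)) &
  vs (basic_field A phi sig q) = sig (pi (p1 q))].
Proof.
move=> sA; rewrite /basic_field comb_hor comb_valpha comb_vs.
have [-> -> ->] := components_reeb q; have [-> -> ->] := components_dds q.
have [-> -> ->] := components_lift q sA.
by rewrite !scaler0 !add0r !mulr0 !mulr1 !addr0 add0r.
Qed.

Lemma act_base (Z : vfield P) V phi q : related (@p1 R _ N) Z V ->
  smooth_fun phi -> act Z (fun q : P => phi (pi (p1 q))) q = act V (phi \o pi) (p1 q).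
Proof.
move=> ZV sp.
exact: (act_related hP hN (smooth_map_p1 hN) ZV
          ((smooth_funP hN _).1 (smooth_comp hN hM spi sp) (p1 q))).
Qed.

Lemma act_lift_base A phi q : smooth_vfield A -> smooth_fun phi ->
  act (slice_ext (lift A)) (fun q : P => phi (pi (p1 q))) q = act A phi (pi (p1 q)).
Proof.
move=> sA sp; apply: etrans (act_base q (related_slice hN (lift A)) sp) _.
exact: (act_related hN hM spi (lift_related sA) ((smooth_funP hM _).1 sp _)).
Qed.

Lemma act_reeb_base phi q : smooth_fun phi ->
  act (slice_ext X) (fun q : P => phi (pi (p1 q))) q = 0.
Proof.
move=> sp; apply: etrans (act_base q (related_slice hN X) sp) _.
have s := (smooth_funP hM _).1 sp (pi (p1 q)).
by apply: etrans (act_related hN hM spi reeb_related s) _; exact: act_zero.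
Qed.

Lemma act_dds_base phi q : smooth_fun phi ->
  act (dds N) (fun q : P => phi (pi (p1 q))) q = 0.
Proof.
move=> sp; apply: etrans (act_base q (related_dds hN) sp) _.
by apply: (act_zero hN); exact: (smooth_funP hN _).1 (smooth_comp hN hM spi sp) _.
Qed.

Lemma act_basic A phi sig psi q : smooth_vfield A -> smooth_fun phi -> smooth_fun sig ->
  smooth_fun psi ->
  act (basic_field A phi sig) (fun q : P => psi (pi (p1 q))) q = act A psi (pi (p1 q)).
Proof.
move=> sA sp ss spsi.
have s := (smooth_funP hP _).1 (smooth_basefun spsi) q.
rewrite /basic_field (act_lin hP _ _ _ s) (act_lin hP _ _ _ s).
by rewrite act_reeb_base// act_dds_base// act_lift_base// !mulr0 !add0r.
Qed.

Section NablaFrame.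
Variables (A B : vfield M).
Hypotheses (sA : smooth_vfield A) (sB : smooth_vfield B).
Variable q : P.
Local Notation y := (pi (p1 q)).
Let sr C : smooth_vfield C -> smooth_vfield (fun p => rho p (C p)).
Proof. exact: (smooth_rho hrho). Qed.
Let kE : (2 * n.+1%:R * (2 * n + 1)%:R)^-1 = c / j :> R.
Proof. by rewrite invfM. Qed.

Let comp_slice_dds (Z : vfield N) (a : R) :
  [/\ hor q (slice_ext Z q + a *: dds N q) = tangent_map pi (p1 q) (Z (p1 q)),
  valpha q (slice_ext Z q + a *: dds N q) = alpha (p1 q) (Z (p1 q)) &
  vs (slice_ext Z q + a *: dds N q) = a].
Proof.
rewrite addrC hor_lin valpha_lin vs_lin.
have [-> -> ->] := components_dds q; have [-> -> ->] := components_slice q Z.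
by rewrite scaler0 mulr0 mulr1 !add0r addr0.
Qed.

Let hor_scale_lift a C : smooth_vfield C ->
  tangent_map pi (p1 q) (a *: lift C (p1 q)) = a *: C y.
Proof.
move=> sC; rewrite -[a *: lift C _]addr0 (tangent_map_linear hN hM spi).
by rewrite (tangent_map0 hN hM spi) addr0 (lift_related sC).
Qed.

Let valpha_scale_lift a C : smooth_vfield C -> alpha (p1 q) (a *: lift C (p1 q)) = 0.
Proof. by move=> sC; rewrite (scalar_formZ (salpha.1 _)) (alpha_lift _ sC) mulr0. Qed.

Lemma nabla1_lift_lift :
  [/\ hor q (nabla1 (slice_ext (lift A)) (slice_ext (lift B)) q) = nabla A B y,
      valpha q (nabla1 (slice_ext (lift A)) (slice_ext (lift B)) q) = - omega y (A y) (B y) &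
      vs (nabla1 (slice_ext (lift A)) (slice_ext (lift B)) q) = c * omega y (A y) (rho y (B y))].
Proof.
rewrite (h1_ZZ (lift_smooth sA) (lift_smooth sB)).
have [-> -> ->] := comp_slice_dds (nablaN (lift A) (lift B))
  (gamma (p1 q) (lift A (p1 q)) (lift B (p1 q))).
rewrite (hN_UV sA sB) (hgamma_UV sA sB) (pullback_lift _ sA sB) (pullback_lift _ sA (sr sB)).
have sn := connection_smooth hnabla sA sB.
rewrite (scalar_formB (salpha.1 _)) (scalar_formZ (salpha.1 _)).
rewrite alpha_reeb (alpha_lift _ sn) mulr1 sub0r.
split=> //; rewrite addrC -scaleNr (tangent_map_linear hN hM spi) reeb_related scaler0 add0r.
exact: (lift_related sn).
Qed.

Lemma nabla1_lift_reeb :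
  [/\ hor q (nabla1 (slice_ext (lift A)) (slice_ext X) q) = - c *: rho y (A y),
      valpha q (nabla1 (slice_ext (lift A)) (slice_ext X) q) = 0 &
      vs (nabla1 (slice_ext (lift A)) (slice_ext X) q) = - (c / j) * omega y (u y) (A y)].
Proof.
rewrite (h1_ZZ (lift_smooth sA) reeb_smooth).
have [-> -> ->] := comp_slice_dds (nablaN (lift A) X) (gamma (p1 q) (lift A (p1 q)) (X (p1 q))).
rewrite (hN_UX sA) hgamma_sym (hgamma_XU sA) (pullback_lift _ hu sA) kE.
by rewrite (hor_scale_lift _ (sr sA)) (valpha_scale_lift _ (sr sA)).
Qed.

Lemma nabla1_reeb_lift :
  [/\ hor q (nabla1 (slice_ext X) (slice_ext (lift B)) q) = - c *: rho y (B y),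
      valpha q (nabla1 (slice_ext X) (slice_ext (lift B)) q) = 0 &
      vs (nabla1 (slice_ext X) (slice_ext (lift B)) q) = - (c / j) * omega y (u y) (B y)].
Proof.
rewrite (h1_ZZ reeb_smooth (lift_smooth sB)).
have [-> -> ->] := comp_slice_dds (nablaN X (lift B)) (gamma (p1 q) (X (p1 q)) (lift B (p1 q))).
rewrite (hN_XU sB) (hgamma_XU sB) (pullback_lift _ hu sB) kE.
by rewrite (hor_scale_lift _ (sr sB)) (valpha_scale_lift _ (sr sB)).
Qed.

Lemma nabla1_reeb_reeb :
  [/\ hor q (nabla1 (slice_ext X) (slice_ext X) q) = - (c / j) *: u y,
      valpha q (nabla1 (slice_ext X) (slice_ext X) q) = 0 &
      vs (nabla1 (slice_ext X) (slice_ext X) q) = c / j * f y].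
Proof.
rewrite (h1_ZZ reeb_smooth reeb_smooth).
have [-> -> ->] := comp_slice_dds (nablaN X X) (gamma (p1 q) (X (p1 q)) (X (p1 q))).
by rewrite hN_XX hgamma_XX kE (hor_scale_lift _ hu) (valpha_scale_lift _ hu).
Qed.

End NablaFrame.

Lemma nabla1_right Z B psi tau q : smooth_vfield Z ->
  smooth_vfield B -> smooth_fun psi -> smooth_fun tau ->
  nabla1 Z (basic_field B psi tau) q =
  (act Z (fun q : P => psi (pi (p1 q))) q *: slice_ext X q
   + psi (pi (p1 q)) *: nabla1 Z (slice_ext X) q)
  + ((act Z (fun q : P => tau (pi (p1 q))) q *: dds N q
      + tau (pi (p1 q)) *: nabla1 Z (dds N) q)
     + nabla1 Z (slice_ext (lift B)) q).
Proof.
move=> sZ sB sp st; have sX := smooth_sX; have sD := smooth_sD; have sL := smooth_sL sB.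
have bp := smooth_basefun sp; have bt := smooth_basefun st.
have s1 := smooth_funZ_vfield hP bp sX; have s2 := smooth_funZ_vfield hP bt sD.
rewrite /basic_field (connectionDr hnabla1 q sZ s1 (smooth_basic2 sB st)).
rewrite (connectionDr hnabla1 q sZ s2 sL).
by rewrite (connectionMr hnabla1 q bp sZ sX) (connectionMr hnabla1 q bt sZ sD).
Qed.

Lemma nabla1_left A phi sig Z q : smooth_vfield A -> smooth_fun phi -> smooth_fun sig ->
  smooth_vfield Z ->
  nabla1 (basic_field A phi sig) Z q =
  phi (pi (p1 q)) *: nabla1 (slice_ext X) Z q +
  (sig (pi (p1 q)) *: nabla1 (dds N) Z q + nabla1 (slice_ext (lift A)) Z q).
Proof.
move=> sA sp ss sZ; have sX := smooth_sX; have sD := smooth_sD; have sL := smooth_sL sA.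
rewrite /basic_field (connection_linl hnabla1 q (smooth_basefun sp) sX (smooth_basic2 sA ss) sZ).
by rewrite (connection_linl hnabla1 q (smooth_basefun ss) sD sL sZ).
Qed.

Let nabla1_right_reeb B psi tau q : smooth_vfield B -> smooth_fun psi -> smooth_fun tau ->
  [/\ hor q (nabla1 (slice_ext X) (basic_field B psi tau) q) =
        psi (pi (p1 q)) *: (- (c / j) *: u (pi (p1 q)))
        + (- c *: rho (pi (p1 q)) (B (pi (p1 q)))),
      valpha q (nabla1 (slice_ext X) (basic_field B psi tau) q) = tau (pi (p1 q)) &
      vs (nabla1 (slice_ext X) (basic_field B psi tau) q) =
        psi (pi (p1 q)) * (c / j * f (pi (p1 q))) +
        - (c / j) * omega (pi (p1 q)) (u (pi (p1 q))) (B (pi (p1 q)))].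
Proof.
move=> sB sp st; rewrite (nabla1_right q smooth_sX sB sp st).
rewrite (act_reeb_base q sp) (act_reeb_base q st) (h1_Zs reeb_smooth) !scale0r !add0r.
rewrite comb_hor comb_valpha comb_vs.
have [-> -> ->] := nabla1_reeb_reeb q; have [-> -> ->] := nabla1_reeb_lift sB q.
have [-> -> ->] := components_reeb q.
by rewrite !scaler0 !add0r !mulr0 !mulr1 !addr0 !add0r.
Qed.

Let nabla1_right_dds B psi tau q : smooth_vfield B -> smooth_fun psi -> smooth_fun tau ->
  [/\ hor q (nabla1 (dds N) (basic_field B psi tau) q) = B (pi (p1 q)),
      valpha q (nabla1 (dds N) (basic_field B psi tau) q) = psi (pi (p1 q)) &
      vs (nabla1 (dds N) (basic_field B psi tau) q) = tau (pi (p1 q))].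
Proof.
move=> sB sp st; rewrite (nabla1_right q smooth_sD sB sp st).
rewrite (act_dds_base q sp) (act_dds_base q st) (h1_sZ reeb_smooth) h1_ss.
rewrite (h1_sZ (lift_smooth sB)) !scale0r !add0r comb_hor comb_valpha comb_vs.
have [-> -> ->] := components_dds q; have [-> -> ->] := components_lift q sB.
have [-> -> ->] := components_reeb q.
by rewrite !scaler0 !add0r !mulr0 !mulr1 !addr0 !add0r.
Qed.

Let horD q v w : hor q (v + w) = hor q v + hor q w.
Proof. by have := hor_lin q 1 v w; rewrite !scale1r. Qed.
Let horZ q a v : hor q (a *: v) = a *: hor q v.
Proof.
have := hor_lin q a v 0.
by rewrite addr0 /hor linear0 (tangent_map0 hN hM spi) addr0.
Qed.
Let valphaD q := scalar_formD (valpha_lin q).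
Let vsD := scalar_formD vs_lin.

Let nabla1_right_lift A B psi tau q : smooth_vfield A -> smooth_vfield B ->
  smooth_fun psi -> smooth_fun tau ->
  [/\ hor q (nabla1 (slice_ext (lift A)) (basic_field B psi tau) q) =
        psi (pi (p1 q)) *: (- c *: rho (pi (p1 q)) (A (pi (p1 q))))
        + (tau (pi (p1 q)) *: A (pi (p1 q)) + nabla A B (pi (p1 q))),
      valpha q (nabla1 (slice_ext (lift A)) (basic_field B psi tau) q) =
        act A psi (pi (p1 q)) - omega (pi (p1 q)) (A (pi (p1 q))) (B (pi (p1 q))) &
      vs (nabla1 (slice_ext (lift A)) (basic_field B psi tau) q) =
        psi (pi (p1 q)) * (- (c / j) * omega (pi (p1 q)) (u (pi (p1 q))) (A (pi (p1 q))))
        + (act A tau (pi (p1 q))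
           + c * omega (pi (p1 q)) (A (pi (p1 q))) (rho (pi (p1 q)) (B (pi (p1 q)))))].
Proof.
move=> sA sB sp st; rewrite (nabla1_right q (smooth_sL sA) sB sp st).
rewrite (act_lift_base q sA sp) (act_lift_base q sA st) (h1_Zs (lift_smooth sA)).
rewrite !(horD, valphaD, vsD).
rewrite !horZ !(scalar_formZ (valpha_lin q)) !(scalar_formZ vs_lin).
have [-> -> ->] := components_dds q; have [-> -> ->] := components_reeb q.
have [-> -> ->] := components_lift q sA.
have [-> -> ->] := nabla1_lift_lift sA sB q; have [-> -> ->] := nabla1_lift_reeb sA q.
by rewrite !scaler0 !mulr0 !mulr1 !add0r !addr0.
Qed.

Definition nabla_hor A phi sig B psi tau : vfield M := fun p =>
  conn_hor (rho p) c j (u p) (nabla A B p) (A p) (phi p) (sig p) (B p) (psi p) (tau p).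
Definition nabla_alpha A phi sig B psi tau : M -> R := fun p =>
  conn_alpha (omega p) (act A psi p) (A p) (phi p) (sig p) (B p) (psi p) (tau p).
Definition nabla_s A phi sig B psi tau : M -> R := fun p =>
  conn_s (omega p) (rho p) c j (u p) (f p) (act A tau p)
        (A p) (phi p) (sig p) (B p) (psi p) (tau p).

Section SmoothComponents.
Variables (A B : vfield M) (phi sig psi tau : M -> R).
Hypotheses (sA : smooth_vfield A) (sB : smooth_vfield B).
Hypotheses (sp : smooth_fun phi) (ss : smooth_fun sig).
Hypotheses (sq : smooth_fun psi) (st : smooth_fun tau).
Let srA : smooth_vfield (fun p => rho p (A p)). Proof. exact: (smooth_rho hrho). Qed.
Let srB : smooth_vfield (fun p => rho p (B p)). Proof. exact: (smooth_rho hrho). Qed.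

Lemma smooth_nabla_hor : smooth_vfield (nabla_hor A phi sig B psi tau).
Proof.
have z1 := smooth_funZ_vfield hM (smooth_funZ hM c sq) srA.
have z2 := smooth_funZ_vfield hM (smooth_funZ hM c sp) srB.
have z3 := smooth_funZ_vfield hM (smooth_funM hM (smooth_funZ hM (c / j) sp) sq) hu.
have z4 := smooth_funZ_vfield hM ss sB; have z5 := smooth_funZ_vfield hM st sA.
have sn := connection_smooth hnabla sA sB.
have b1 := smooth_vfieldB hM (smooth_vfieldB hM (smooth_vfieldB hM sn z1) z2) z3.
exact: (smooth_vfieldD hM (smooth_vfieldD hM b1 z4) z5).
Qed.

Lemma smooth_nabla_alpha : smooth_fun (nabla_alpha A phi sig B psi tau).
Proof.
have b1 := smooth_funB hM (smooth_act hM sA sq) (smooth_omega homega sA sB).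
exact: (smooth_funD hM (smooth_funD hM b1 (smooth_funM hM ss sq)) (smooth_funM hM st sp)).
Qed.

Lemma smooth_nabla_s : smooth_fun (nabla_s A phi sig B psi tau).
Proof.
have g1 := smooth_funZ hM c (smooth_omega homega sA srB).
have g2 := smooth_funM hM (smooth_funZ hM (c / j) sp) (smooth_omega homega hu sB).
have g3 := smooth_funM hM (smooth_funZ hM (c / j) sq) (smooth_omega homega hu sA).
have g4 := smooth_funM hM (smooth_funM hM (smooth_funZ hM (c / j) hf) sp) sq.
have g := smooth_funD hM (smooth_funB hM (smooth_funB hM g1 g2) g3) g4.
exact: (smooth_funD hM (smooth_funD hM (smooth_act hM sA st) g) (smooth_funM hM ss st)).
Qed.

Let hor_aux (D rA rB v B' A' : T) (a k' p s q t : R) :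
  p *: (q *: (- k' *: v) + (- a *: rB)) + (s *: B' + (q *: (- a *: rA) + (t *: A' + D))) =
  D - (a * q) *: rA - (a * p) *: rB - (k' * p * q) *: v + s *: B' + t *: A'.
Proof. by apply/rowP => i; rewrite !mxE; ring. Qed.

Let alpha_aux (p s q t d w : R) : p * t + (s * q + (d - w)) = d - w + s * q + t * p.
Proof. by ring. Qed.

Let s_aux (p s q t d a k' f' wAB wuA wuB : R) :
  p * (q * (k' * f') + - k' * wuB) + (s * t + (q * (- k' * wuA) + (d + a * wAB))) =
  d + (a * wAB - k' * p * wuB - k' * q * wuA + k' * f' * p * q) + s * t.
Proof. by ring. Qed.

(** nabla1 preserves the basic fields, hence iterated derivatives of basic fields
    are computed on M. *)
Lemma nabla1_basic : nabla1 (basic_field A phi sig) (basic_field B psi tau) =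
  basic_field (nabla_hor A phi sig B psi tau) (nabla_alpha A phi sig B psi tau)
        (nabla_s A phi sig B psi tau).
Proof.
apply/funext => q; have sZ := smooth_basic sB sq st.
have [E1 E2 E3] := components_basic (nabla_alpha A phi sig B psi tau)
  (nabla_s A phi sig B psi tau) q smooth_nabla_hor.
have [r1 r2 r3] := nabla1_right_reeb q sB sq st.
have [d1 d2 d3] := nabla1_right_dds q sB sq st.
have [l1 l2 l3] := nabla1_right_lift q sA sB sq st.
rewrite (nabla1_left q sA sp ss sZ).
apply: (components_eq (q := q)).
- by rewrite comb_hor r1 d1 l1 E1; exact: hor_aux.
- by rewrite comb_valpha r2 d2 l2 E2; exact: alpha_aux.
- by rewrite comb_vs r3 d3 l3 E3; exact: s_aux.
Qed.

End SmoothComponents.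

(** Constant coefficients already span every tangent space, and their derivatives
    vanish. *)
Definition frame A (a b : R) : vfield P := basic_field A (fun=> a) (fun=> b).

Lemma smooth_frame A a b : smooth_vfield A -> smooth_vfield (frame A a b).
Proof. by move=> sA; apply: smooth_basic => //; exact: smooth_cst. Qed.

(** By [tensorial_eq] only the value of V at q counts, and it is that of a
    frame field. *)
Lemma frame_eq0 (E : lmodType R) (F : vfield P -> E) q V : tensorial q F ->
  (forall A a b, smooth_vfield A -> F (frame A a b) = 0) ->
  smooth_vfield V -> F V = 0.
Proof.
move=> tF F0 sV; have [A sA Aq] := vfield_extension hM (pi (p1 q)) (hor q (V q)).
rewrite -(F0 A (valpha q (V q)) (vs (V q)) sA).
apply: (tensorial_eq hP tF sV (smooth_frame _ _ sA)).
have [E1 E2 E3] := components_basic (fun=> valpha q (V q)) (fun=> vs (V q)) q sA.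
by apply: (components_eq (q := q)); rewrite ?E1 ?E2 ?E3.
Qed.

Let vself (v : 'rV[R]_((2 * n).+1 + 1)) : v = - v -> v = 0.
Proof.
by move=> /eqP; rewrite -addr_eq0 -mulr2n -scaler_nat scaler_eq0 pnatr_eq0/= => /eqP.
Qed.

Let drop_term (x y z : 'rV[R]_((2 * n).+1 + 1)) (a : R) : a = 0 -> x + y - a *: z = x + y.
Proof. by move=> ->; rewrite scale0r subr0. Qed.

Let bracket_left A a b W q : smooth_vfield A -> smooth_vfield W ->
  bracket (frame A a b) W q =
  a *: bracket (slice_ext X) W q +
  (b *: bracket (dds N) W q + bracket (slice_ext (lift A)) W q).
Proof.
move=> sA sW; have sX := smooth_sX; have sD := smooth_sD; have sL := smooth_sL sA.
have ca := smooth_cst hP a; have cb := smooth_cst hP b.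
have sDL := smooth_lin hP cb sD sL.
have E1 := bracket_lin hP ca sX sDL sW q.
have E2 := bracket_lin hP cb sD sL sW q.
apply: etrans E1 _; apply: etrans (drop_term _ _ _ (act_cst W a q)) _.
exact: (congr2 +%R erefl (etrans E2 (drop_term _ _ _ (act_cst W b q)))).
Qed.

Let bracket_reeb_frame B a b q : smooth_vfield B ->
  bracket (frame B a b) (slice_ext X) q = 0.
Proof.
move=> sB; rewrite (bracket_left _ _ _ sB smooth_sX).
have -> : bracket (slice_ext X) (slice_ext X) q = 0 by apply: vself; exact: bracketC.
rewrite (bracket_dds hN q reeb_smooth) (bracketC (slice_ext (lift B))).
rewrite (bracket_slice hN q reeb_smooth (lift_smooth sB)) /slice_ext.
by rewrite bracket_reeb_lift// row_mx0 !scaler0 oppr0 !addr0.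
Qed.

Let bracket_dds_frame B a b q : smooth_vfield B ->
  bracket (frame B a b) (dds N) q = 0.
Proof.
move=> sB; rewrite (bracket_left _ _ _ sB smooth_sD).
have -> : bracket (dds N) (dds N) q = 0 by apply: vself; exact: bracketC.
rewrite (bracketC (slice_ext X)) (bracketC (slice_ext (lift B))).
rewrite (bracket_dds hN q reeb_smooth) (bracket_dds hN q (lift_smooth sB)).
by rewrite oppr0 !scaler0 !addr0.
Qed.

Let bracket_lift_frame A B a b q : smooth_vfield A -> smooth_vfield B ->
  bracket (frame B a b) (slice_ext (lift A)) q =
  bracket (slice_ext (lift B)) (slice_ext (lift A)) q.
Proof.
move=> sA sB; rewrite (bracket_left _ _ _ sB (smooth_sL sA)).
rewrite (bracket_dds hN q (lift_smooth sA)).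
rewrite (bracket_slice hN q reeb_smooth (lift_smooth sA)) {1}/slice_ext.
by rewrite bracket_reeb_lift// row_mx0 !scaler0 !add0r.
Qed.

(** X and d/ds commute with each other and with the lifts, so only the bracket of
    the two lifts remains. *)
Lemma bracket_frame A a b B a' b' : smooth_vfield A -> smooth_vfield B ->
  bracket (frame A a b) (frame B a' b') =
  basic_field (bracket A B) (fun p => - 2 * omega p (A p) (B p)) (fun=> 0).
Proof.
move=> sA sB; apply/funext => q.
have sF := smooth_frame a' b' sB; have sAB := smooth_bracket hM sA sB.
have E1 := bracketC (slice_ext X) (frame B a' b') q.
have E2 := bracketC (dds N) (frame B a' b') q.
have E3 := bracketC (slice_ext (lift A)) (frame B a' b') q.
rewrite (bracket_reeb_frame a' b' q sB) oppr0 in E1.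
rewrite (bracket_dds_frame a' b' q sB) oppr0 in E2.
rewrite (bracket_lift_frame a' b' q sA sB) -bracketC in E3.
apply: etrans (bracket_left a b q sA sF) _.
rewrite E1 E2 E3 !scaler0 !add0r.
rewrite (bracket_slice hN q (lift_smooth sA) (lift_smooth sB)).
have [C1 C2 C3] := components_basic (fun p => - 2 * omega p (A p) (B p)) (fun=> 0) q sAB.
have [S1 S2 S3] := components_slice q (bracket (lift A) (lift B)).
apply: (components_eq (q := q)).
- rewrite C1 S1 (bracket_lift _ sA sB) addrC -scaleNr (tangent_map_linear hN hM spi).
  by rewrite reeb_related scaler0 add0r; exact: lift_related.
- rewrite C2 S2 (bracket_lift _ sA sB) (scalar_formB (salpha.1 _)).
  rewrite (scalar_formZ (salpha.1 _)) alpha_reeb (alpha_lift _ sAB) mulr1 sub0r.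
  by rewrite mulNr.
- by rewrite C3 S3.
Qed.

Local Notation theta := (exp_form alpha).
Let stheta : smooth_1form theta := smooth_exp_form hN salpha.

Let d1_left A phi sig W q : smooth_vfield A -> smooth_fun phi -> smooth_fun sig ->
  smooth_vfield W ->
  d1 theta (basic_field A phi sig) W q =
  phi (pi (p1 q)) * d1 theta (slice_ext X) W q +
  (sig (pi (p1 q)) * d1 theta (dds N) W q + d1 theta (slice_ext (lift A)) W q).
Proof.
move=> sA sp ss sW; have sX := smooth_sX; have sD := smooth_sD; have sL := smooth_sL sA.
apply: etrans (d1_lin hP stheta q (smooth_basefun sp) sX (smooth_basic2 sA ss) sW) _.
by congr (_ + _); exact: (d1_lin hP stheta q (smooth_basefun ss) sD sL sW).
Qed.

Let rself (v : R) : v = - v -> v = 0.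
Proof. by move=> /eqP; rewrite -addr_eq0 -mulr2n mulrn_eq0/= => /eqP. Qed.

Let d1_dds_reeb q : d1 theta (dds N) (slice_ext X) q = 2 * exp2s q.
Proof. by rewrite (d1_exp_dds hN salpha q reeb_smooth) alpha_reeb mulr1. Qed.

Let d1_dds_lift A q : smooth_vfield A -> d1 theta (dds N) (slice_ext (lift A)) q = 0.
Proof.
by move=> sA; rewrite (d1_exp_dds hN salpha q (lift_smooth sA)) (alpha_lift _ sA) mulr0.
Qed.

Let d1_reeb_lift A q : smooth_vfield A -> d1 theta (slice_ext X) (slice_ext (lift A)) q = 0.
Proof.
move=> sA; rewrite (d1_exp_slice hN salpha q reeb_smooth (lift_smooth sA)).
by have [_ hXd _] := hX; rewrite (hXd _ (lift_smooth sA)) mulr0.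
Qed.

Let d1_lift_lift A B q : smooth_vfield A -> smooth_vfield B ->
  d1 theta (slice_ext (lift A)) (slice_ext (lift B)) q =
  exp2s q * (2 * omega (pi (p1 q)) (A (pi (p1 q))) (B (pi (p1 q)))).
Proof.
move=> sA sB; rewrite (d1_exp_slice hN salpha q (lift_smooth sA) (lift_smooth sB)).
by rewrite (hd (lift_smooth sA) (lift_smooth sB)) (pullback_lift _ sA sB).
Qed.

Let d1_aux (e p s q t w w' : R) : w' = - w ->
  p * - (q * 0 + (t * (2 * e) + - 0)) +
  (s * - (q * - (2 * e) + (t * 0 + - 0)) + - (q * 0 + (t * 0 + e * (2 * w')))) =
  2 * e * (w + s * q - t * p).
Proof. by move=> ->; ring. Qed.

Lemma d1_basic A phi sig B psi tau q : smooth_vfield A -> smooth_fun phi ->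
  smooth_fun sig -> smooth_vfield B -> smooth_fun psi -> smooth_fun tau ->
  d1 theta (basic_field A phi sig) (basic_field B psi tau) q =
  2 * exp2s q *
    (omega (pi (p1 q)) (A (pi (p1 q))) (B (pi (p1 q)))
     + sig (pi (p1 q)) * psi (pi (p1 q)) - tau (pi (p1 q)) * phi (pi (p1 q))).
Proof.
move=> sA sp ss sB sq st; have sX := smooth_sX; have sD := smooth_sD.
have sLA := smooth_sL sA; have sLB := smooth_sL sB; have sG := smooth_basic sB sq st.
have C Z Z' : d1 theta Z Z' q = - d1 theta Z' Z q := d1C stheta Z Z' q.
have z1 : d1 theta (slice_ext X) (slice_ext X) q = 0 by apply: rself; exact: C.
have z2 : d1 theta (dds N) (dds N) q = 0 by apply: rself; exact: C.
have EX : d1 theta (slice_ext X) (basic_field B psi tau) q =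
  - (psi (pi (p1 q)) * 0 + (tau (pi (p1 q)) * (2 * exp2s q) + - 0)).
  apply: etrans (C _ _) (congr1 -%R _).
  apply: etrans (d1_left q sB sq st sX) _.
  by rewrite z1 d1_dds_reeb (C _ (slice_ext X)) d1_reeb_lift.
have ED : d1 theta (dds N) (basic_field B psi tau) q =
  - (psi (pi (p1 q)) * - (2 * exp2s q) + (tau (pi (p1 q)) * 0 + - 0)).
  apply: etrans (C _ _) (congr1 -%R _).
  apply: etrans (d1_left q sB sq st sD) _.
  by rewrite z2 (C (slice_ext X)) d1_dds_reeb (C _ (dds N)) d1_dds_lift.
have EL : d1 theta (slice_ext (lift A)) (basic_field B psi tau) q =
  - (psi (pi (p1 q)) * 0 + (tau (pi (p1 q)) * 0 +
     exp2s q * (2 * omega (pi (p1 q)) (B (pi (p1 q))) (A (pi (p1 q)))))).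
  apply: etrans (C _ _) (congr1 -%R _).
  apply: etrans (d1_left q sB sq st sLA) _.
  by rewrite d1_reeb_lift// d1_dds_lift// d1_lift_lift.
apply: etrans (d1_left q sA sp ss sG) _; rewrite EX ED EL.
by apply: d1_aux; exact: (omegaC homega).
Qed.

Let horB2 q v w z : hor q (v - w - z) = hor q v - hor q w - hor q z.
Proof.
have hN' v' : hor q (- v') = - hor q v' by rewrite -scaleN1r horZ scaleN1r.
by rewrite !horD !hN'.
Qed.
Let valphaB2 q v w z : valpha q (v - w - z) = valpha q v - valpha q w - valpha q z.
Proof. by rewrite !(scalar_formB (valpha_lin q)). Qed.
Let vsB2 v w z : vs (v - w - z) = vs v - vs w - vs z.
Proof. by rewrite !(scalar_formB vs_lin). Qed.
Let components_eq0 q v w z : hor q v - hor q w - hor q z = 0 ->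
  valpha q v - valpha q w - valpha q z = 0 -> vs v - vs w - vs z = 0 ->
  v - w - z = 0.
Proof.
move=> E1 E2 E3; apply: (components_eq (q := q)).
- by rewrite horB2 E1 /hor linear0 (tangent_map0 hN hM spi).
- by rewrite valphaB2 E2 (scalar_form0 (valpha_lin q)).
- by rewrite vsB2 E3 (scalar_form0 vs_lin).
Qed.

Let cst_fun := smooth_cst hM.

Definition frame_hor A a b B a' b' : vfield M := fun p =>
  conn_hor (rho p) c j (u p) (nabla A B p) (A p) a b (B p) a' b'.
Definition frame_alpha A (a b : R) B (a' b' : R) : M -> R := fun p =>
  conn_alpha (omega p) 0 (A p) a b (B p) a' b'.
Definition frame_s A a b B a' b' : M -> R := fun p =>
  conn_s (omega p) (rho p) c j (u p) (f p) 0 (A p) a b (B p) a' b'.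

Let frame_alphaE A a b B a' b' :
  nabla_alpha A (fun=> a) (fun=> b) B (fun=> a') (fun=> b') = frame_alpha A a b B a' b'.
Proof. by apply/funext => p; rewrite /nabla_alpha act_cst. Qed.

Let frame_sE A a b B a' b' :
  nabla_s A (fun=> a) (fun=> b) B (fun=> a') (fun=> b') = frame_s A a b B a' b'.
Proof. by apply/funext => p; rewrite /nabla_s act_cst. Qed.

Lemma nabla1_frame A a b B a' b' : smooth_vfield A -> smooth_vfield B ->
  nabla1 (frame A a b) (frame B a' b') =
  basic_field (frame_hor A a b B a' b') (frame_alpha A a b B a' b') (frame_s A a b B a' b').
Proof.
move=> sA sB; rewrite -frame_alphaE -frame_sE; apply: nabla1_basic => //; exact: cst_fun.
Qed.

Lemma smooth_frame_components A a b B a' b' : smooth_vfield A -> smooth_vfield B ->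
  [/\ smooth_vfield (frame_hor A a b B a' b'), smooth_fun (frame_alpha A a b B a' b') &
      smooth_fun (frame_s A a b B a' b')].
Proof.
move=> sA sB; rewrite -frame_alphaE -frame_sE; split.
- exact: (smooth_nabla_hor sA sB (cst_fun a) (cst_fun b) (cst_fun a') (cst_fun b')).
- exact: (smooth_nabla_alpha sA sB (cst_fun a) (cst_fun b) (cst_fun a') (cst_fun b')).
- exact: (smooth_nabla_s sA sB (cst_fun a) (cst_fun b) (cst_fun a') (cst_fun b')).
Qed.

Let torsion_hor (d12 d21 rA rB v A' B' : T) (k' k'' a b a' b' : R) :
  (d12 - (k' * a') *: rA - (k' * a) *: rB - (k'' * a * a') *: v + b *: B' + b' *: A')
  - (d21 - (k' * a) *: rB - (k' * a') *: rA - (k'' * a' * a) *: v + b' *: A' + b *: B')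
  - (d12 - d21) = 0.
Proof. by apply/rowP => i; rewrite !mxE; ring. Qed.

Let torsion_alpha (w w' a b a' b' : R) : w' = - w ->
  (0 - w + b * a' + b' * a) - (0 - w' + b' * a + b * a') - (- 2 * w) = 0.
Proof. by move=> ->; ring. Qed.

Let torsion_s (wr wr' wA wB k' k'' f' a b a' b' : R) : wr = wr' ->
  (0 + (k' * wr - k'' * a * wB - k'' * a' * wA + k'' * f' * a * a') + b * b')
  - (0 + (k' * wr' - k'' * a' * wA - k'' * a * wB + k'' * f' * a' * a) + b' * b) - 0 = 0.
Proof. by move=> ->; ring. Qed.

(** Interchanging the arguments changes only nabla_A B and the sign of omega(A, B), and
    the differences are the components of the bracket; the s-component is symmetric
    because rho is. *)
Lemma torsion_frame A a b B a' b' q : smooth_vfield A -> smooth_vfield B ->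
  nabla1 (frame A a b) (frame B a' b') q - nabla1 (frame B a' b') (frame A a b) q
  - bracket (frame A a b) (frame B a' b') q = 0.
Proof.
move=> sA sB; rewrite (bracket_frame a b a' b' sA sB) !nabla1_frame//.
have [s1 _ _] := smooth_frame_components a b a' b' sA sB.
have [s2 _ _] := smooth_frame_components a' b' a b sB sA.
have sAB := smooth_bracket hM sA sB.
have [E1 E2 E3] := components_basic (frame_alpha A a b B a' b') (frame_s A a b B a' b') q s1.
have [F1 F2 F3] := components_basic (frame_alpha B a' b' A a b) (frame_s B a' b' A a b) q s2.
have [G1 G2 G3] := components_basic (fun p => - 2 * omega p (A p) (B p)) (fun=> 0) q sAB.
apply: (components_eq0 (q := q)).
- rewrite E1 F1 G1 (bracket_nabla hsympl sA sB); exact: torsion_hor.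
- by rewrite E2 F2 G2; apply: torsion_alpha; exact: (omegaC homega).
- by rewrite E3 F3 G3; apply: torsion_s; exact: rho_sym.
Qed.

(** Torsion is skew, so linearity over functions in one argument gives it in the
    other. *)
Lemma nabla1_torsion_free : torsion_free nabla1.
Proof.
move=> U V sU sV q; apply/eqP; rewrite -subr_eq0; apply/eqP.
pose tau U V : 'rV[R]_((2 * n).+1 + 1) := nabla1 U V q - nabla1 V U q - bracket U V q.
have tauC W W' : tau W W' = - tau W' W.
  by rewrite /tau (bracketC W) opprK [RHS]opprD opprK opprB.
apply: (frame_eq0 (F := tau^~ V) (q := q)) sU; first exact: tensorial_torsion.
move=> A a b sA; rewrite tauC; apply/eqP; rewrite oppr_eq0; apply/eqP.
have sF := smooth_frame a b sA.
apply: (frame_eq0 (F := tau^~ (frame A a b)) (q := q)) sV; first exact: tensorial_torsion.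
by move=> B a' b' sB; exact: torsion_frame.
Qed.

Let parallel_aux (e s w x1 x2 dh x y : R) :
  2 * s * (w + x1 - x2) + dh = x + y ->
  2 * (2 * s * e * (w + (x1 - x2)) + e * dh) - 2 * e * x - 2 * e * y = 0.
Proof.
move=> E.
rewrite (_ : _ - _ - _ = 2 * e * (2 * s * (w + x1 - x2) + dh - (x + y))); last by ring.
by rewrite E subrr mulr0.
Qed.

Lemma act_frame_exp2s A a b q : smooth_vfield A ->
  act (frame A a b) (@exp2s _ _ N) q = 2 * b * exp2s q.
Proof.
move=> sA; have se := smooth_germ_exp2s hN q.
apply: etrans (act_lin hP (fun=> a) _ _ se) _.
apply: etrans (congr2 +%R erefl (act_lin hP (fun=> b) _ _ se)) _.
rewrite (act_slice_exp2s hN) (act_slice_exp2s hN) (act_dds_exp2s hN).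
by rewrite mulr0 add0r addr0 mulrCA mulrA.
Qed.

Lemma parallel_frame C a3 b3 A a b B a' b' q :
  smooth_vfield C -> smooth_vfield A -> smooth_vfield B ->
  nabla_form nabla1 theta (frame C a3 b3) (frame A a b) (frame B a' b') q = 0.
Proof.
move=> sC sA sB; rewrite /nabla_form.
have [s1 s2 s3] := smooth_frame_components a3 b3 a b sC sA.
have [t1 t2 t3] := smooth_frame_components a3 b3 a' b' sC sB.
pose h p := omega p (A p) (B p) + (b * a' - b' * a).
have sh : smooth_fun h.
  exact: (smooth_funD hM (smooth_omega homega sA sB) (cst_fun _)).
have E0 : d1 theta (frame A a b) (frame B a' b') =
    (fun q => 2 * (exp2s q * h (pi (p1 q)))).
  apply/funext => q'.
  apply: etrans (d1_basic q' sA (cst_fun a) (cst_fun b) sB (cst_fun a') (cst_fun b')) _.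
  by rewrite /h -mulrA addrA.
have se := smooth_germ_exp2s hN q; have shq := (smooth_funP hP _).1 (smooth_basefun sh) q.
have Eh : act C h (pi (p1 q)) =
    omega (pi (p1 q)) (nabla C A (pi (p1 q))) (B (pi (p1 q))) +
    omega (pi (p1 q)) (A (pi (p1 q))) (nabla C B (pi (p1 q))).
  rewrite -(act_omega hsympl _ sC sA sB).
  have sw := (smooth_funP hM _).1 (smooth_omega homega sA sB) (pi (p1 q)).
  by apply: etrans (actD C sw (smooth_germ_cst (b * a' - b' * a) _)) _; rewrite act_cst addr0.
have E1 : act (frame C a3 b3) (d1 theta (frame A a b) (frame B a' b')) q =
    2 * (2 * b3 * exp2s q * h (pi (p1 q)) + exp2s q * act C h (pi (p1 q))).
  rewrite E0; apply: etrans (actZ hP _ 2 (smooth_germM se shq)) (congr1 ( *%R 2) _).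
  apply: etrans (actM hP _ se shq) _; rewrite (act_frame_exp2s a3 b3 q sC).
  congr (_ + _ * _); exact: (act_basic q sC (cst_fun a3) (cst_fun b3) sh).
have E2 := d1_basic q s1 s2 s3 sB (cst_fun a') (cst_fun b').
have E3 := d1_basic q sA (cst_fun a) (cst_fun b) t1 t2 t3.
rewrite (nabla1_frame a3 b3 a b sC sA) (nabla1_frame a3 b3 a' b' sC sB).
apply: etrans (congr2 (fun x y : R => x - y) (congr2 (fun x y : R => x - y) E1 E2) E3) _.
rewrite Eh /h; apply: parallel_aux.
exact: (parallel_alg c (u (pi (p1 q))) (f (pi (p1 q))) (omega_linr homega _) (omega_linl homega _)
  (omegaC homega _) (@rho_sym _) dim_neq0).
Qed.

Lemma nabla1_parallel : parallel_2form (d1 theta) nabla1.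
Proof.
move=> U V W sU sV sW q; apply/eqP; rewrite -subr_eq0 opprD addrA; apply/eqP.
rewrite -[LHS]/(nabla_form nabla1 theta U V W q).
have sF := smooth_frame; have cT := tensorial_nabla_form2 hP hnabla1 stheta.
have neg0 (x : R) : - x = 0 -> x = 0 by move/eqP; rewrite oppr_eq0 => /eqP.
apply: (frame_eq0 (E := R^o) (F := fun U => nabla_form nabla1 theta U V W q) (q := q)) sU.
  exact: (tensorial_nabla_form1 hP hnabla1 stheta q sV sW).
move=> C a3 b3 sC; have s3 := sF C a3 b3 sC.
apply: (frame_eq0 (E := R^o) (F := fun V => nabla_form nabla1 theta _ V W q) (q := q)) sV.
  exact: cT.
move=> A a b sA; have s1 := sF A a b sA.
rewrite (nabla_formC hP nabla1 stheta) //; apply/neg0; rewrite opprK.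
apply: (frame_eq0 (E := R^o) (F := fun W => nabla_form nabla1 theta _ W _ q) (q := q)) sW.
  exact: cT.
move=> B a' b' sB; have s2 := sF B a' b' sB.
by rewrite (nabla_formC hP nabla1 stheta) // parallel_frame// oppr0.
Qed.

Section CurvatureFrame.
Variables (A1 A2 A3 : vfield M) (a1 b1 a2 b2 a3 b3 : R).
Hypotheses (s1 : smooth_vfield A1) (s2 : smooth_vfield A2) (s3 : smooth_vfield A3).

Let nabla1_nabla1_frame A a b B a' b' q : smooth_vfield A -> smooth_vfield B ->
  let F := nabla1 (frame A a b) (nabla1 (frame B a' b') (frame A3 a3 b3)) q in
  let y := pi (p1 q) in
  let B3 := frame_hor B a' b' A3 a3 b3 in
  let al3 := frame_alpha B a' b' A3 a3 b3 in
  let s3 := frame_s B a' b' A3 a3 b3 in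
  [/\ hor q F = conn_hor (rho y) c j (u y)
        (dconn_hor c j (nabla A (nabla B A3) y) (nabla A B y) a' b' (nabla A A3 y) a3 b3
          (drho (omega y) (rho y) j (u y) (A y) (B y) (nabla A B y))
          (drho (omega y) (rho y) j (u y) (A y) (A3 y) (nabla A A3 y))
          (du (rho y) c j (f y) (A y)))
        (A y) a b (B3 y) (al3 y) (s3 y),
      valpha q F = conn_alpha (omega y)
        (- (omega y (nabla A B y) (A3 y) + omega y (B y) (nabla A A3 y)))
        (A y) a b (B3 y) (al3 y) (s3 y) &
      vs F = conn_s (omega y) (rho y) c j (u y) (f y)
        (dconn_s (omega y) (rho y) c j (u y) (B y) a' (A3 y) a3
          (nabla A B y) (nabla A A3 y)
          (drho (omega y) (rho y) j (u y) (A y) (A3 y) (nabla A A3 y))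
          (du (rho y) c j (f y) (A y)) (2 * c * omega y (u y) (rho y (A y))))
        (A y) a b (B3 y) (al3 y) (s3 y)].
Proof.
move=> sA sB F y B3 al3 s3'.
have [t1 t2 t3] := smooth_frame_components a' b' a3 b3 sB s3.
have E : F = basic_field (nabla_hor A (fun=> a) (fun=> b) B3 al3 s3')
    (nabla_alpha A (fun=> a) (fun=> b) B3 al3 s3')
    (nabla_s A (fun=> a) (fun=> b) B3 al3 s3') q.
  rewrite /F (nabla1_frame a' b' a3 b3 sB s3).
  exact: (congr1 (@^~ q) (nabla1_basic sA t1 (cst_fun a) (cst_fun b) t2 t3)).
have sh := smooth_nabla_hor sA t1 (cst_fun a) (cst_fun b) t2 t3.
have [e1 e2 e3] := components_basic (nabla_alpha A (fun=> a) (fun=> b) B3 al3 s3')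
  (nabla_s A (fun=> a) (fun=> b) B3 al3 s3') q sh.
rewrite -E in e1 e2 e3.
have H1 := nabla_conn_hor hM hnabla hrho hu hnabla_rho hnabla_u y a' b' a3 b3 sA sB s3.
have H2 := act_conn_alpha hM homega hsympl y a' b' a3 b3 sA sB s3.
have H3 := act_conn_s hM homega hsympl hrho hu hf hnabla_rho hnabla_u y a' b' a3 b3 sA sB s3.
rewrite (act_f hM homega hnabla hsympl hRm hricci hrho hrhoE hu hf hnabla_rho hnabla_u
  (@rho_sym _) sA) in H3.
split.
- exact: (etrans e1 (congr1 (fun D => conn_hor (rho y) c j (u y) D _ _ _ _ _ _) H1)).
- exact: (etrans e2 (congr1 (fun D => conn_alpha (omega y) D _ _ _ _ _ _) H2)).
- exact: (etrans e3 (congr1 (fun D => conn_s (omega y) (rho y) c j (u y) (f y) D _ _ _ _ _ _) H3)).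
Qed.

Lemma curvature_frame q :
  curvature nabla1 (frame A1 a1 b1) (frame A2 a2 b2) (frame A3 a3 b3) q = 0.
Proof.
have sF1 := smooth_frame a1 b1 s1; have sF2 := smooth_frame a2 b2 s2.
have s12 := smooth_bracket hM s1 s2.
have [v1 v2 v3] := nabla1_nabla1_frame a1 b1 a2 b2 q s1 s2.
have [w1 w2 w3] := nabla1_nabla1_frame a2 b2 a1 b1 q s2 s1.
pose om : M -> R := fun p => - 2 * omega p (A1 p) (A2 p).
have som : smooth_fun om := smooth_funZ hM (-2) (smooth_omega homega s1 s2).
set y := pi (p1 q) in v1 v2 v3 w1 w2 w3.
(* The Reeb component of the bracket is the function - 2 omega(A1, A2), so the
   general basic fields are needed here. *)
have zE : nabla1 (bracket (frame A1 a1 b1) (frame A2 a2 b2)) (frame A3 a3 b3) =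
    basic_field (nabla_hor (bracket A1 A2) om (fun=> 0) A3 (fun=> a3) (fun=> b3))
      (nabla_alpha (bracket A1 A2) om (fun=> 0) A3 (fun=> a3) (fun=> b3))
      (nabla_s (bracket A1 A2) om (fun=> 0) A3 (fun=> a3) (fun=> b3)).
  rewrite (bracket_frame a1 b1 a2 b2 s1 s2).
  exact: (nabla1_basic s12 s3 som (cst_fun 0) (cst_fun a3) (cst_fun b3)).
have sh := smooth_nabla_hor s12 s3 som (cst_fun 0) (cst_fun a3) (cst_fun b3).
have [z1 z2 z3] := components_basic
  (nabla_alpha (bracket A1 A2) om (fun=> 0) A3 (fun=> a3) (fun=> b3))
  (nabla_s (bracket A1 A2) om (fun=> 0) A3 (fun=> a3) (fun=> b3)) q sh.
have bE : bracket A1 A2 y = nabla A1 A2 y - nabla A2 A1 y.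
  exact: (congr1 (@^~ y) (bracket_nabla hsympl s1 s2)).
have act0 a : act (bracket A1 A2) (fun=> a) y = 0 by exact: act_cst.
rewrite -zE /nabla_hor -/y bE in z1.
rewrite -zE /nabla_alpha -/y bE act0 in z2.
rewrite -zE /nabla_s -/y bE act0 in z3.
apply: (components_eq0 (q := q)).
(* The Ricci-type formula is about omega(R(A1, A2)A3, t). *)
- rewrite v1 w1 z1; apply: (omega_nondeg homega (p := y)) => t.
  rewrite [RHS](scalar_form0 (omega_linl homega y t)).
  have H := curvature_omega hRm hricci hrhoE y t s1 s2 s3.
  exact: (curvature_hor (u y) (f y) (omega_linl homega y) (omegaC homega y)
    (rho_linear hrho y) (@rho_sym _) dim_neq0 _ _ _ _ _ _ _ _ _ _ H).
- rewrite v2 w2 z2.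
  exact: (curvature_al c (u y) (f y) (omega_linr homega y) (omega_linl homega y)
    (omegaC homega y) (@rho_sym _) dim_neq0).
- rewrite v3 w3 z3.
  exact: (curvature_s c (u y) (f y) (omega_linr homega y) (omega_linl homega y)
    (omegaC homega y) (rho_linear hrho y) (@rho_sym _) dim_neq0).
Qed.

End CurvatureFrame.

Lemma nabla1_flat : zero_curvature nabla1.
Proof.
move=> U V W sU sV sW q.
have sF := smooth_frame; have C := curvatureC hP hnabla1.
have neg0 (v : 'rV[R]_((2 * n).+1 + 1)) : - v = 0 -> v = 0.
  by move/eqP; rewrite oppr_eq0 => /eqP.
apply: (frame_eq0 (F := fun U => curvature nabla1 U V W q) (q := q)) sU.
  exact: (tensorial_curvature1 hP hnabla1 q sV sW).
move=> A1 a1 b1 s1; have t1 := sF A1 a1 b1 s1.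
rewrite C //; apply/neg0; rewrite opprK.
apply: (frame_eq0 (F := fun V => curvature nabla1 V _ W q) (q := q)) sV.
  exact: (tensorial_curvature1 hP hnabla1 q t1 sW).
move=> A2 a2 b2 s2; have t2 := sF A2 a2 b2 s2.
apply: (frame_eq0 (F := fun W => curvature nabla1 _ _ W q) (q := q)) sW.
  exact: (tensorial_curvature3 hP hnabla1 q t2 t1).
by move=> A3 a3 b3 s3; exact: curvature_frame.
Qed.

End Induced.

Theorem theorem6p1 (R : realType) (n : nat) (hn : (2 <= n)%N)
  (* the symplectic manifold (M, omega) *)
  (M : charted_space R (2 * n)) (hM : smooth_manifold M)
  (omega : forall p : M, 'rV[R]_(2 * n) -> 'rV[R]_(2 * n) -> R)
  (homega : symplectic_form omega)
  (* the symplectic connection of Ricci type, its curvature, rho, u and f *)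
  (nabla : vfield M -> vfield M -> vfield M)
  (hnabla : connection nabla)
  (hsympl : symplectic_connection (on_fields omega) nabla)
  (Rm : forall p : M, 'rV[R]_(2 * n) -> 'rV[R]_(2 * n) -> 'rV[R]_(2 * n) ->
        'rV[R]_(2 * n))
  (hRm : curvature_tensor nabla Rm)
  (hricci : ricci_type omega Rm)
  (rho : forall p : M, 'rV[R]_(2 * n) -> 'rV[R]_(2 * n))
  (hrho : smooth_endo rho)
  (hrhoE : forall p x y, omega p x (rho p y) = ricci Rm p x y)
  (u : vfield M) (hu : smooth_vfield u)
  (f : M -> R) (hf : smooth_fun f)
  (hnabla_rho : forall U V, smooth_vfield U -> smooth_vfield V -> forall p,
     nabla U (fun q => rho q (V q)) p - rho p (nabla U V p) =
     - (2 * n + 1)%:R^-1 *: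
       (omega p (u p) (V p) *: U p + omega p (U p) (V p) *: u p))
  (hnabla_u : forall U, smooth_vfield U -> forall p,
     nabla U u p =
     - ((2 * n + 1)%:R / (2 * n.+1%:R)) *: rho p (rho p (U p)) + f p *: U p)
  (* the contact manifold (N, alpha), its Reeb field X, and pi : N -> M *)
  (N : charted_space R (2 * n).+1) (hN : smooth_manifold N)
  (alpha : forall x : N, 'rV[R]_(2 * n).+1 -> R)
  (halpha : contact_form alpha)
  (X : vfield N) (hX : reeb_field alpha X)
  (pi : N -> M) (hpi : submersion pi)
  (hd : forall Z Z', smooth_vfield Z -> smooth_vfield Z' -> forall x,
     d1 alpha Z Z' x = 2 * pullback2 pi omega x (Z x) (Z' x))
  (* horizontal lifts *)
  (lift : vfield M -> vfield N)
  (hlift : forall U, smooth_vfield U -> horizontal_lift pi alpha U (lift U))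
  (* the connection on N *)
  (nablaN : vfield N -> vfield N -> vfield N)
  (hnablaN : connection nablaN)
  (hN_UV : forall U V, smooth_vfield U -> smooth_vfield V -> forall x,
     nablaN (lift U) (lift V) x =
     lift (nabla U V) x - pullback2 pi omega x (lift U x) (lift V x) *: X x)
  (hN_XU : forall U, smooth_vfield U -> forall x,
     nablaN X (lift U) x =
     - (2 * n.+1%:R)^-1 *: lift (fun p => rho p (U p)) x)
  (hN_UX : forall U, smooth_vfield U -> forall x,
     nablaN (lift U) X x =
     - (2 * n.+1%:R)^-1 *: lift (fun p => rho p (U p)) x)
  (hN_XX : forall x,
     nablaN X X x = - (2 * n.+1%:R * (2 * n + 1)%:R)^-1 *: lift u x)
  (* the symmetric bilinear form gamma on TN *)
  (gamma : forall x : N, 'rV[R]_(2 * n).+1 -> 'rV[R]_(2 * n).+1 -> R)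
  (hgamma : smooth_bilinear gamma)
  (hgamma_sym : forall x v w, gamma x v w = gamma x w v)
  (hgamma_XX : forall x,
     gamma x (X x) (X x) = (2 * n.+1%:R * (2 * n + 1)%:R)^-1 * f (pi x))
  (hgamma_XU : forall U, smooth_vfield U -> forall x,
     gamma x (X x) (lift U x) =
     - (2 * n.+1%:R * (2 * n + 1)%:R)^-1 *
       pullback2 pi omega x (lift u x) (lift U x))
  (hgamma_UV : forall U V, smooth_vfield U -> smooth_vfield V -> forall x,
     gamma x (lift U x) (lift V x) =
     (2 * n.+1%:R)^-1 *
       pullback2 pi omega x (lift U x) (lift (fun p => rho p (V p)) x))
  (* the connection on P = N x R *)
  (nabla1 : vfield (cylinder N) -> vfield (cylinder N) -> vfield (cylinder N))
  (hnabla1 : connection nabla1)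
  (h1_ZZ : forall Z Z', smooth_vfield Z -> smooth_vfield Z' -> forall q,
     nabla1 (slice_ext Z) (slice_ext Z') q =
     slice_ext (nablaN Z Z') q +
     gamma (p1 q) (Z (p1 q)) (Z' (p1 q)) *: dds N q)
  (h1_Zs : forall Z, smooth_vfield Z -> forall q,
     nabla1 (slice_ext Z) (dds N) q = slice_ext Z q)
  (h1_sZ : forall Z, smooth_vfield Z -> forall q,
     nabla1 (dds N) (slice_ext Z) q = slice_ext Z q)
  (h1_ss : forall q, nabla1 (dds N) (dds N) q = dds N q) :
  symplectic_connection (d1 (exp_form alpha)) nabla1 /\ zero_curvature nabla1.
Proof.
have mM := smooth_manifold_manifold hM; have mN := smooth_manifold_manifold hN.
have sa := halpha.1.
split; [split|].
- by eapply nabla1_torsion_free; eassumption.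
- by eapply nabla1_parallel; eassumption.
- by eapply nabla1_flat; eassumption.
Qed.
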